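(* Let $\mu\in\mathrm{L}^\infty(Q_T)$ be positively lower-bounded (there is $\alpha>0$ with $\mu\ge\alpha$ a.e.), let $G\in\mathrm{L}^2(Q_T)$, $z^0\in\mathrm{L}^2(\mathbb{T}^N)$, and let $z$ be the dual solution of the Cauchy problem $$\partial_t z-\Delta(\mu z)=G,\qquad z(0,\cdot)=z^0 .$$ Then the following two (independent) assertions hold. (i) If $z^0$ and $G$ are non-negative, then so is $z$. (ii) If $G\le r z$ for some $r\in\mathbb{R}$, then $z(t,x)\le \widetilde z(t,x)\,e^{rt}$ (almost everywhere on $Q_T$), where $\widetilde z$ is the dual solution of $$\partial_t\widetilde z-\Delta(\mu\widetilde z)=0,\qquad \widetilde z(0,\cdot)=z^0 .$$
   Context: $T>0$ and an integer $N\ge1$ are fixed, $\mathbb{T}^N$ is the flat torus, $Q_T:=[0,T)\times\mathbb{T}^N$, and $\mathscr{D}(Q_T)$ denotes the smooth functions with compact support in $[0,T)\times\mathbb{T}^N$ (they may be non-zero at $t=0$). For $\mu\in\mathrm{L}^\infty(Q_T)$ positively lower-bounded and $S\in\mathrm{L}^2(Q_T)$, $\Phi_\mu^S$ denotes the unique function in $\mathrm{L}^\infty(0,T;\mathrm{H}^1(\mathbb{T}^N))\cap\mathrm{L}^2(0,T;\mathrm{H}^2(\mathbb{T}^N))\cap\mathscr{C}^0([0,T];\mathrm{L}^2(\mathbb{T}^N))$ solving $\partial_t\Phi+\mu\Delta\Phi=S$ (an equality in $\mathrm{L}^2(Q_T)$), $\Phi(T,\cdot)=0$. Dual solution: for $\mu\in\mathrm{L}^\infty(Q_T)$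 positively lower-bounded, $G\in\mathrm{L}^2(Q_T)$ and $z^0\in\mathrm{L}^2(\mathbb{T}^N)$, the dual solution of $\partial_t z-\Delta(\mu z)=G$, $z(0,\cdot)=z^0$ is the unique distributional solution of this problem, i.e. it satisfies $-\int_{Q_T}z(\partial_t\varphi+\mu\Delta\varphi)=\int_{\mathbb{T}^N}z^0\varphi(0,\cdot)+\int_{Q_T}G\varphi$ for all $\varphi\in\mathscr{D}(Q_T)$; it belongs to $\mathrm{L}^2(Q_T)$ and is characterized by $$\forall S\in\mathrm{L}^2(Q_T),\qquad -\int_{Q_T}zS=\int_{\mathbb{T}^N}z^0\,\Phi_\mu^S(0)+\int_{Q_T}G\,\Phi_\mu^S .$$ *)

(* Defs.v *)
(* Built on MathComp-Analysis. *)
From HB Require Import structures.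
From mathcomp Require Export all_boot all_order all_algebra.
From mathcomp Require Export all_classical all_reals all_analysis.

Set Implicit Arguments.
Unset Strict Implicit.
Unset Printing Implicit Defensive.

Import Order.TTheory GRing.Theory Num.Theory.
Import numFieldNormedType.Exports.

Local Open Scope classical_set_scope.
Local Open Scope ring_scope.

(* The flat torus is R^N / Z^N.  A function on it is represented by a function
   on N-tuples of reals, of which only the values on the fundamental cell
   [0,1]^N matter, the cell being the support of [torus_measure]. *)
Section torus_measure.
Context (R : realType).

Definition tuple_cons n (p : measurableTypeR R * n.-tuple R) : n.+1.-tuple R :=
  [tuple of p.1 :: p.2].

Lemma measurable_tuple_cons n : 
  measurable_fun [set: measurableTypeR R * n.-tuple R] (@tuple_cons n).
Proof. exact: measurable_cons measurable_fst measurable_snd. Qed.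

HB.instance Definition _ n :=
  isMeasurableFun.Build _ _ _ _ (@tuple_cons n) (@measurable_tuple_cons n).

Fixpoint torus_measure n : probability (n.-tuple R) R :=
  match n with
  | 0 => dirac ([tuple] : 0.-tuple R)
  | m.+1 =>
    distribution (uniform_prob (@ltr01 R) \x torus_measure m)%E (@tuple_cons m)
  end.

Definition QT_measure (T : R) n : {measure set (measurableTypeR R * n.-tuple R) -> \bar R} :=
  (mrestr lebesgue_measure (measurable_itv `[0%R, T[) \x torus_measure n)%E.

End torus_measure.

Section test_functions.
Context (R : realType) (N : nat).
Implicit Type phi : R * 'rV[R]_N -> R.

Fixpoint is_Ck (k : nat) phi : Prop :=
  match k with
  | 0 => continuous phi
  | j.+1 => continuous phi /\
      forall v, (forall p, derivable phi p v) /\ is_Ck j ('D_v phi)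
  end.

Definition is_smooth phi : Prop := forall k, is_Ck k phi.

(* Smoothness up to t = 0 is expressed by a smooth extension to negative times;
   only the values for 0 <= t < T are ever used. *)
Definition test_function (T : R) phi : Prop :=
  [/\ is_smooth phi,
      (forall t (x : 'rV[R]_N) (i : 'I_N), phi (t, x + delta_mx 0 i) = phi (t, x)) &
      exists2 tau, tau < T & forall t x, tau <= t -> phi (t, x) = 0].

Definition dt phi : R * 'rV[R]_N -> R := 'D_(1, 0) phi.

Definition dx (i : 'I_N) phi : R * 'rV[R]_N -> R := 'D_(0, delta_mx 0 i) phi.

Definition laplacian phi : R * 'rV[R]_N -> R :=
  fun p => \sum_(i < N) dx i (dx i phi) p.

Definition row_of (x : N.-tuple R) : 'rV[R]_N := \row_i tnth x i.

End test_functions.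

Section dual_solution.
Context (R : realType) (N : nat) (T : R).

Definition positively_lower_bounded (mu : R * N.-tuple R -> R) : Prop :=
  exists2 alpha : R, 0 < alpha & {ae QT_measure T N, forall p, alpha <= mu p}.

(* z solves d_t z - Delta (mu z) = G, z(0, .) = z0 in the sense of
   distributions, within L^2(Q_T). *)
Definition is_dual_solution (mu G : R * N.-tuple R -> R) (z0 : N.-tuple R -> R)
    (z : R * N.-tuple R -> R) : Prop :=
  z \in Lfun (QT_measure T N) 2%:E /\
  forall phi, test_function T phi ->
    - (\int[QT_measure T N]_p
        (z p * (dt phi (p.1, row_of p.2)
                + mu p * laplacian phi (p.1, row_of p.2)))) =
    \int[torus_measure R N]_x (z0 x * phi (0, row_of x)) +
    \int[QT_measure T N]_p (G p * phi (p.1, row_of p.2)).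

End dual_solution.

(* Main.v *)
From HB Require Import structures.
Require Import Defs.
From mathcomp Require Import measurable_realfun ess_sup_inf ring lra.

(**
  (i) is proved by duality: it suffices to find test functions [phi] that are
  nonnegative up to a small error and for which [d_t phi + mu Delta phi] is
  close in L2 to [S = - z^-].  Three facts are used, all for trigonometric
  sums [phi] in space with smooth coefficients in time.

  - Energy: the integral of [d_t phi * Delta phi] is nonnegative, hence
    [c |Delta phi| <= |d_t phi + c Delta phi|] for constant [c], and
    [|Delta phi|] is controlled by [|d_t phi + m Delta phi|] if [m >= al > 0].
  - Density: [d_t + c Delta] has dense range, since the Fourier modes decouple
    into ordinary differential equations.  For [c >= sup m], [(c - m) Delta] is a
    strict contraction relative to [d_t + c Delta], so that [d_t + m Delta] has
    dense range for every bounded measurable [m >= al > 0].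
  - Sign: if [m] is moreover smooth in time, [|phi^-|] is at most a constant
    (depending on [m]) times [|d_t phi + m Delta phi - S|], for every [S <= 0].

  As [mu] is only measurable, the sign estimate is applied to a coefficient [m]
  which is smooth in time and close to [mu] in L2 for the weight [z ^ 2]; the error
  is the integral of [z (mu - m) Delta phi], small because [|Delta phi|] is
  bounded independently of [m].

  (ii) is (i) for [zt - exp (- r t) z], a dual solution with zero initial datum
  and source [exp (- r t) (r z - G) >= 0].
*)

(** Two requirements pull against each other. The sign estimate divides by the coefficient, so that
    the Laplacian appears with coefficient 1 and integration by parts against a convex function of
    [phi] has a sign; the price is a time derivative of the reciprocal, hence a constant [C] that
    may blow up as [m] approaches a rough [mu]. The remedy is the order of the choices: [m] first,
    then its [C], then [phi] with a residual small compared with [1 / C], which density allows for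
    any fixed [m]. Only the bound on [Delta phi] has to survive this order, and it uses nothing but
    the lower bound of [m]. A merely measurable [mu] has in general no uniform approximation by
    continuous functions, and [z] is only square integrable, so [mu - m] must be small for the
    weight [z ^ 2]. Density of trigonometric sums is therefore proved for every integrable weight,
    by showing that the sets with approximable indicator form a sigma-algebra. Exact solutions of
    the dual problem with the rough coefficient are never constructed: approximate ones suffice. *)

Set Implicit Arguments.
Unset Strict Implicit.
Unset Printing Implicit Defensive.

Import Order.TTheory GRing.Theory Num.Theory.
Import numFieldNormedType.Exports.

Local Open Scope classical_set_scope.
Local Open Scope ring_scope.

(** * Integrable and square-integrable real functions *)

Section square_integrable.
Context d (X : measurableType d) (R : realType) (mu : {measure set X -> \bar R}).
Implicit Types f g : X -> R.

Definition rintegrable f := mu.-integrable setT (EFin \o f).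

Lemma rintegrable_measurable f : rintegrable f -> measurable_fun setT f.
Proof. by move=> /integrableP[/measurable_EFinP]. Qed.

Lemma rintegrableD f g : rintegrable f -> rintegrable g -> rintegrable (fun x => f x + g x).
Proof. by move=> fi gi; exact: (integrableD measurableT fi gi). Qed.

Lemma rintegrableB f g : rintegrable f -> rintegrable g -> rintegrable (fun x => f x - g x).
Proof. by move=> fi gi; exact: (integrableB measurableT fi gi). Qed.

Lemma rintegrableZ k f : rintegrable f -> rintegrable (fun x => k * f x).
Proof. by move=> fi; exact: (integrableZl measurableT k fi). Qed.

Lemma rintegrable_ae_le f g : measurable_fun setT f -> rintegrable g ->
  {ae mu, forall x, `|f x| <= g x} -> rintegrable f.
Proof.
move=> mf ig fg; have mg := rintegrable_measurable ig.
apply/integrableP; split; first exact/measurable_EFinP.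
have /integrableP[_] := ig; apply: le_lt_trans.
apply: ae_ge0_le_integral => //.
- by do 2 apply: measurableT_comp => //.
- by do 2 apply: measurableT_comp => //.
- by apply: filterS fg => x fgx _ /=; rewrite lee_fin (le_trans fgx)// ler_norm.
Qed.

Lemma Rint_ae_ge0 f : rintegrable f -> {ae mu, forall x, 0 <= f x} ->
  0 <= \int[mu]_x f x.
Proof.
move=> fi f0; have mf := rintegrable_measurable fi.
have -> : \int[mu]_x f x = \int[mu]_x `|f x|.
  congr fine; apply: ae_eq_integral => //; do ?[exact/measurable_EFinP].
    by do 2 apply: measurableT_comp => //.
  by apply: filterS f0 => x fx _ /=; rewrite ger0_norm.
by apply: Rintegral_ge0.
Qed.

Lemma Rint_ae_le f g : rintegrable f -> rintegrable g -> {ae mu, forall x, f x <= g x} ->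
  \int[mu]_x f x <= \int[mu]_x g x.
Proof.
move=> fi gi fg; rewrite -subr_ge0 -RintegralB//.
by apply: Rint_ae_ge0; [exact: rintegrableB|apply: filterS fg => x; rewrite subr_ge0].
Qed.

Lemma Rint0_ae0 f : rintegrable f -> {ae mu, forall x, 0 <= f x} ->
  \int[mu]_x f x <= 0 -> {ae mu, forall x, f x = 0}.
Proof.
move=> fi f0 I0; have mf := rintegrable_measurable fi.
have : (\int[mu]_(x in setT) `|(f x)%:E| = 0)%E.
  have -> : (\int[mu]_(x in setT) `|(f x)%:E| = \int[mu]_(x in setT) (f x)%:E)%E.
    apply: ae_eq_integral => //; do ?[exact/measurable_EFinP].
      by do 2 apply: measurableT_comp => //.
    by apply: filterS f0 => x fx _ /=; rewrite ger0_norm.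
  rewrite -[LHS]fineK; last exact: integrable_fin_num.
  congr EFin; apply/eqP; rewrite eq_le I0/=; exact: Rint_ae_ge0.
move/(ae_eq_integral_abs mu measurableT) => H.
have /H : measurable_fun setT (EFin \o f) by exact/measurable_EFinP.
by apply: filterS => x /(_ I) [].
Qed.

Lemma Rint_dominated (f_ : nat -> X -> R) g : (forall n, measurable_fun setT (f_ n)) ->
  rintegrable g -> {ae mu, forall x n, `|f_ n x| <= g x} ->
  {ae mu, forall x, f_ ^~ x @ \oo --> (0 : R)} ->
  forall e, 0 < e -> exists n, `|\int[mu]_x f_ n x| < e.
Proof.
move=> mf ig fg f0 e e0.
have := @dominated_convergence _ _ _ mu setT measurableT 
  (fun n => EFin \o f_ n) (cst 0%E) (EFin \o g).
case => //.
- by move=> n; apply/measurable_EFinP.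
- apply: filterS f0 => x fx _; apply: cvg_EFin; first exact: nearW.
  exact: fx.
- by apply: filterS fg => x fx n _; rewrite /= lee_fin.
move=> _ _; rewrite integral0 => /fine_cvg /cvgrPdist_lt /(_ _ e0) [n _].
move/(_ n (leqnn n)) => h; exists n.
by rewrite -normrN; move: h; rewrite /= sub0r.
Qed.

Definition sq_integrable f := measurable_fun setT f /\ rintegrable (fun x => f x ^+ 2).

Lemma Lfun2_sq_integrable f : f \in Lfun mu 2%:E -> sq_integrable f.
Proof.
move=> fL; split; last exact: Lfun2_integrable_sqr.
by move: fL; rewrite inE => /andP[]; rewrite inE.
Qed.

Lemma sq_integrable_mul f g : sq_integrable f -> sq_integrable g -> rintegrable (fun x => f x * g x).
Proof.
move=> [mf fi] [mg gi]; apply: (@rintegrable_ae_le _ (fun x => f x ^+ 2 + g x ^+ 2)).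
- exact: measurable_funM.
- exact: rintegrableD.
- apply: aeW => x /=; rewrite ler_norml; nra.
Qed.

Lemma sq_integrableZ k f : sq_integrable f -> sq_integrable (fun x => k * f x).
Proof.
move=> [mf fi]; split; first exact: measurable_funM.
under eq_fun do rewrite exprMn; exact: rintegrableZ.
Qed.

Lemma sq_integrableD f g : sq_integrable f -> sq_integrable g -> sq_integrable (fun x => f x + g x).
Proof.
move=> sf sg; have fg := sq_integrable_mul  sf sg; case: sf sg => [mf fi] [mg gi].
split; first exact: measurable_funD.
under eq_fun do rewrite sqrrD.
apply: rintegrableD => //; apply: rintegrableD => //.
by under eq_fun do rewrite -mulr_natl; exact: rintegrableZ.
Qed.

Lemma sq_integrableB f g : sq_integrable f -> sq_integrable g -> sq_integrable (fun x => f x - g x).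
Proof.
move=> sf /(sq_integrableZ (-1)) /(sq_integrableD sf).
by under eq_fun do rewrite mulN1r.
Qed.

Lemma sq_integrable_ae_le f g : measurable_fun setT f -> sq_integrable g ->
  {ae mu, forall x, `|f x| <= `|g x|} -> sq_integrable f.
Proof.
move=> mf [mg gi] fg; split => //.
apply: (@rintegrable_ae_le _ (fun x => g x ^+ 2)) => //; first exact: measurable_funX.
apply: filterS fg => x h.
by rewrite normrX -[g x ^+ 2]real_normK ?num_real// ler_sqr ?nnegrE.
Qed.

Lemma sq_integrable_bddM (b : X -> R) (M : R) f : measurable_fun setT b -> {ae mu, forall x, `|b x| <= M} ->
  sq_integrable f -> sq_integrable (fun x => b x * f x).
Proof.
move=> mb bM sf; apply: (@sq_integrable_ae_le _ (fun x => M * f x)).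
- by apply: measurable_funM => //; case: sf.
- exact: sq_integrableZ.
- apply: filterS bM => x h; rewrite !normrM ler_wpM2r//.
  exact: le_trans (ler_norm _).
Qed.

Lemma Rint_sqr_ge0 f : 0 <= \int[mu]_x f x ^+ 2.
Proof. by apply: Rintegral_ge0 => x _; exact: sqr_ge0. Qed.

(** Young's inequality with a free weight. It stands in for Cauchy-Schwarz, so that no square root
    of an integral occurs: [e] goes to the bounded factor and [e^-1] to the small one. *)
Lemma Rint_mul_le e f g : 0 < e -> sq_integrable f -> sq_integrable g ->
  \int[mu]_x (f x * g x) <=
  e * \int[mu]_x f x ^+ 2 + e^-1 * \int[mu]_x g x ^+ 2.
Proof.
move=> e0 sf sg; have [_ fi] := sf; have [_ gi] := sg.
rewrite -!RintegralZl// -RintegralD//; [|exact: rintegrableZ..].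
apply: Rint_ae_le; [exact: sq_integrable_mul|by apply: rintegrableD; exact: rintegrableZ|].
apply: aeW => x; have ei : 0 < e^-1 by rewrite invr_gt0.
have ee : e * e^-1 = 1 by rewrite divff// gt_eqF.
have := sqr_ge0 (e * f x - g x); have := sqr_ge0 (f x); have := sqr_ge0 (g x).
move=> g2 f2 h; rewrite -(ler_pM2l e0) mulrDr [_ * (e^-1 * _)]mulrA ee; nra.
Qed.

(** The weight allows the factor of the first square to be as close to 1 as desired, which a
    contraction argument needs; elsewhere [e = 1] is enough. *)
Lemma Rint_sqrD_le e f g : 0 < e -> sq_integrable f -> sq_integrable g ->
  \int[mu]_x (f x + g x) ^+ 2 <=
  (1 + e) * \int[mu]_x f x ^+ 2 + (1 + e^-1) * \int[mu]_x g x ^+ 2.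
Proof.
move=> e0 sf sg; have [_ fi] := sf; have [_ gi] := sg.
rewrite -!RintegralZl// -RintegralD//; [|exact: rintegrableZ..].
apply: Rint_ae_le; [by have [] := sq_integrableD  sf sg|by apply: rintegrableD; exact: rintegrableZ|].
apply: aeW => x; have ei : 0 < e^-1 by rewrite invr_gt0.
have ee : e * e^-1 = 1 by rewrite divff// gt_eqF.
have := sqr_ge0 (e * f x - g x) => h; rewrite -(ler_pM2l e0) [_ * (_ + _ * _)]mulrDr.
rewrite [_ * ((1 + e^-1) * _)]mulrA [e * (1 + _)]mulrDr ee; nra.
Qed.

End square_integrable.

(** The positive part integrates to 0, and [fine] sends a possible value [-oo] to 0, so no
    integrability has to be known. *)
Lemma integral_ae_le0 d (X : measurableType d) (R : realType)
    (mu : {measure set X -> \bar R}) (f : X -> \bar R) :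
  measurable_fun setT f -> {ae mu, forall x, (f x <= 0)%E} ->
  fine (\int[mu]_x f x)%E <= 0.
Proof.
move=> mf f0; rewrite -lee_fin; suff h : (\int[mu]_x f x <= 0)%E.
  by case: (\int[mu]_x f x)%E h.
rewrite integralE (_ : \int[mu]_x f^\+ x = 0)%E; last first.
  rewrite -(@integral0 _ _ _ mu setT); apply: ae_eq_integral => //.
    exact: measurable_funepos.
  by apply: filterS f0 => x fx _ /=; rewrite funeposE; apply/max_idPr.
by rewrite sub0e oppe_le0; exact: integral_ge0.
Qed.

Section iterated_integrals.
Context d1 d2 (X : measurableType d1) (Y : measurableType d2) (R : realType).
Variables (m1 : {sigma_finite_measure set X -> \bar R})
  (m2 : {sigma_finite_measure set Y -> \bar R}).

Lemma Rint_prod_l (h : X * Y -> R) : rintegrable (m1 \x m2)%E h ->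
  \int[(m1 \x m2)%E]_p h p = \int[m2]_y \int[m1]_x h (x, y).
Proof.
move=> ih; have mG := measurable_fubini_G ih.
rewrite {1}/Rintegral -integral21_prod_meas1//; congr fine.
apply: ae_eq_integral => //.
  by apply/measurable_EFinP; apply: measurableT_comp mG.
apply: filterS (ae_integrable2 ih) => y iy _.
by rewrite /= /fubini_G /Rintegral fineK//; exact: integrable_fin_num.
Qed.

Lemma Rint_prod_le0_r (h : X * Y -> R) : rintegrable (m1 \x m2)%E h ->
  {ae m1, forall x, \int[m2]_y h (x, y) <= 0} ->
  \int[(m1 \x m2)%E]_p h p <= 0.
Proof.
move=> ih h0; rewrite /Rintegral -integral12_prod_meas1//.
apply: integral_ae_le0; first exact: (measurable_fubini_F ih).
apply: filterS2 (ae_integrable1 ih) h0 => y iy.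
rewrite /fubini_F /Rintegral -lee_fin fineK//; exact: integrable_fin_num.
Qed.

End iterated_integrals.

Section one_dimensional.
Context (R : realType).
Local Notation mR := (measurableTypeR R).

(** The first factor of [QT_measure] under a name of its own, to which finiteness can be attached as
    an instance; the two are convertible, so Fubini for finite measures applies to [QT_measure]. *)
Definition time_measure (T : R) : set mR -> \bar R :=
  mrestr (lebesgue_measure : set mR -> \bar R) (measurable_itv `[0%R, T[).

HB.instance Definition _ T := Measure.copy (time_measure T)
  (mrestr lebesgue_measure (measurable_itv `[0%R, T[)).

Variable T : R.

Lemma time_measure_fin : fin_num_fun (time_measure T).
Proof.
move=> A mA; rewrite /time_measure /= /mrestr ge0_fin_numE//.
apply: (@le_lt_trans _ _ (lebesgue_measure (`[0, T[%classic : set mR))).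
  apply: le_measure; rewrite ?inE//; exact: measurableI.
rewrite /= lebesgue_measure_itv/=; case: ifP => _; by rewrite ?ltry// EFinN oppr0 adde0 ltry.
Qed.

HB.instance Definition _ := Measure_isFinite.Build _ _ _ (time_measure T) time_measure_fin.

Lemma time_measure_ae (P : R -> Prop) : (forall t, 0 <= t < T -> P t) ->
  {ae time_measure T, forall t, P t}.
Proof.
move=> h; exists (~` `[0, T[%classic); split.
- by apply: measurableC; exact: measurable_itv.
- by rewrite /time_measure/= /mrestr setICl measure0.
- by move=> t; apply: contra_not; rewrite /= in_itv/= => /h.
Qed.

Lemma Rint_time (f : R -> R) : rintegrable (time_measure T) f ->
  \int[time_measure T]_t f t = \int[lebesgue_measure]_(t in `[0, T[) f t.
Proof.
move=> fi; rewrite /Rintegral; congr fine.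
rewrite -(@eq_measure_integral _ mR R `[0, T[%classic lebesgue_measure (time_measure T)); last first.
  by move=> A mA AT; rewrite -[LHS]/(lebesgue_measure (A `&` `[0, T[%classic)) setIidl.
rewrite [RHS]integral_mkcond; apply: ae_eq_integral => //.
- by case/integrableP: fi.
- apply/(measurable_restrictT _ _).1 => //; apply: measurable_funTS.
  by case/integrableP: fi.
- apply: time_measure_ae => t tT _; rewrite patchE ifT// inE/= in_itv/=.
  exact: tT.
Qed.

Lemma Rint_uniform (f : R -> R) : rintegrable (uniform_prob (@ltr01 R)) f ->
  \int[uniform_prob (@ltr01 R)]_t f t = \int[lebesgue_measure]_(t in `[0, 1]) f t.
Proof.
move=> fi; have mf := rintegrable_measurable fi.
rewrite /Rintegral; congr fine.
rewrite [LHS]integralE [RHS]integralE; have mf' := (measurable_EFinP _ _).2 mf.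
rewrite !integral_uniform ?subr0 ?invr1 ?mul1e//.
- exact: measurable_funeneg.
- exact: measurable_funepos.
Qed.

Lemma Rint_derivative (F f : R -> R) (a b : R) : a < b ->
  (forall t : R, is_derive t (1 : R) F (f t)) -> continuous f ->
  \int[lebesgue_measure]_(t in `[a, b]) f t = F b - F a.
Proof.
move=> ab dF cf; rewrite /Rintegral (@continuous_FTC2 _ f F)//.
- exact: continuous_subspaceT.
- have cF : continuous F.
    by move=> t; apply/differentiable_continuous/derivable1_diffP; case: (dF t).
  split; first by move=> t _; case: (dF t).
  + exact/cvg_at_right_filter/cF.
  + exact/cvg_at_left_filter/cF.
- by move=> t _; rewrite derive1E; case: (dF t).
Qed.

End one_dimensional.

Lemma bounded_rintegrable d (X : measurableType d) (R : realType)
    (mu : {measure set X -> \bar R}) (f : X -> R) (M : R) :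
  (mu setT < +oo)%E -> measurable_fun setT f ->
  {ae mu, forall x, `|f x| <= M} -> rintegrable mu f.
Proof.
move=> muT mf fM; apply: (@rintegrable_ae_le _ _ _ _ _ (cst M)) => //.
apply: measurable_bounded_integrable => //.
by exists `|M|; split; rewrite ?num_real// => y My x _ /=; rewrite ltW.
Qed.

Lemma prod_measure_fin d1 d2 (X : measurableType d1) (Y : measurableType d2)
    (R : realType) (m1 : {finite_measure set X -> \bar R})
    (m2 : {finite_measure set Y -> \bar R}) : ((m1 \x m2)%E setT < +oo)%E.
Proof.
have := product_measure1E m1 m2 (@measurableT _ X) (@measurableT _ Y).
rewrite setXTT /= => ->; rewrite -ge0_fin_numE ?mule_ge0//.
by rewrite fin_numM// fin_num_measure.
Qed.

Lemma Rintegral_le0 d (X : measurableType d) (R : realType)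
    (mu : {measure set X -> \bar R}) (f : X -> R) : (forall x, f x <= 0) ->
  \int[mu]_x f x <= 0.
Proof.
move=> f0; rewrite /Rintegral -lee_fin.
suff h : (\int[mu]_x (f x)%:E <= 0)%E by case: (\int[mu]_x _)%E h.
rewrite integralE (eq_integral (cst 0%E)); last first.
  by move=> x xT; rewrite (@le0_funeposE _ _ setT)// => y _; rewrite lee_fin.
by rewrite integral0 sub0e oppe_le0; exact: integral_ge0.
Qed.

(** * Integration on the torus and on the space-time cylinder *)

Section torus.
Context (R : realType).

Definition upd n (x : n.-tuple R) (i : 'I_n) (s : R) : n.-tuple R :=
  [tuple if j == i then s else tnth x j | j < n].

Lemma tnth_upd n (x : n.-tuple R) i s j :
  tnth (upd x i s) j = if j == i then s else tnth x j.
Proof. by rewrite tnth_mktuple. Qed.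

Lemma upd_cons0 n (x : n.-tuple R) a s :
  upd [tuple of a :: x] ord0 s = [tuple of s :: x].
Proof.
apply: eq_from_tnth => j; rewrite tnth_upd.
have [->//|] := eqVneq j ord0.
by case: (unliftP ord0 j) => [k ->|->]//= _; rewrite !tnthS.
Qed.

Lemma upd_consS n (x : n.-tuple R) a s i :
  upd [tuple of a :: x] (lift ord0 i) s = [tuple of a :: upd x i s].
Proof.
apply: eq_from_tnth => j; rewrite tnth_upd.
case: (unliftP ord0 j) => [k ->|->]//=.
by rewrite !tnthS tnth_upd (inj_eq lift_inj).
Qed.

Lemma torus_fin n : (torus_measure R n setT < +oo)%E.
Proof. by rewrite probability_setT ltry. Qed.

(** Induction on the dimension: when [i] is a later coordinate the head is frozen and the induction
    hypothesis bounds the inner integral; when [i] is the head, it is integrated first. Working with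
    a sign instead of an iterated-integral formula keeps partial integrals out of the induction. *)
Lemma Rint_torus_le0 n (h : n.-tuple R -> R) (i : 'I_n) (M : R) :
  measurable_fun setT h -> (forall x, `|h x| <= M) ->
  (forall x, \int[lebesgue_measure]_(s in `[0, 1]) h (upd x i s) <= 0) ->
  \int[torus_measure R n]_x h x <= 0.
Proof.
elim: n h i => [h []//|n IH h i mh hM hs].
have mc := @measurable_tuple_cons R n.
have mhc : measurable_fun setT (h \o @tuple_cons R n) by exact: measurableT_comp.
pose m1 : probability (measurableTypeR R) R := uniform_prob (@ltr01 R).
pose m2 := torus_measure R n.
have ihc : rintegrable (m1 \x m2)%E (h \o @tuple_cons R n).
  apply: (@bounded_rintegrable _ _ _ _ _ M) => //; last by apply: aeW => x /=.
  exact: prod_measure_fin.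
have -> : \int[torus_measure R n.+1]_x h x = \int[(m1 \x m2)%E]_x h (tuple_cons x).
  rewrite /Rintegral; congr fine.
  rewrite [LHS]integral_pushforward//.
  exact/measurable_EFinP.
case: (unliftP ord0 i) hs => [j ->|->] hs.
- apply: (Rint_prod_le0_r ihc); apply: aeW => s.
  apply: (IH (fun y => h (tuple_cons (s, y))) j).
  + exact: (measurableT_comp mhc (pair1_measurable s)).
  + by move=> x.
  + by move=> x; have := hs [tuple of s :: x]; under eq_Rintegral do rewrite upd_consS.
- rewrite (Rint_prod_l ihc).
  apply: Rintegral_le0 => y.
  rewrite Rint_uniform; last first.
    apply: (@bounded_rintegrable _ _ _ _ _ M) => //.
    + by rewrite -ge0_fin_numE// fin_num_measure.
    + by apply: (measurableT_comp mhc); exact: pair2_measurable.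
    + by apply: aeW => s; exact: hM.
  have := hs [tuple of 0 :: y].
  by under eq_Rintegral do rewrite upd_cons0.
Qed.

(** Along the [i]-th coordinate, the points of [0, 1] outside [0, 1[ reduce to the null set {1}, so
    the preceding lemma applies to the indicator. The half-open cell matters later, where 0 and 1
    are the same point of the circle. *)
Lemma torus_ae_coord n (i : 'I_n) :
  {ae torus_measure R n, forall x, 0 <= tnth x i < 1}.
Proof.
pose A : set (n.-tuple R) := (fun x => tnth x i) @^-1` (~` `[0, 1[%classic).
have mA : measurable A.
  rewrite -[A]setTI; apply: (@measurable_tnth _ _ n i) => //.
  by apply: measurableC; exact: measurable_itv.
exists A; split => //.
have : \int[torus_measure R n]_x \1_A x <= 0.
  apply: (@Rint_torus_le0 _ _ i 1).
  - exact: measurable_indic.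
  - by move=> x; rewrite indicE ger0_norm// lern1 leq_b1.
  - move=> x; rewrite /Rintegral.
    rewrite (_ : (fun s => _) = (fun s => (\1_(~` `[0, 1[%classic) s)%:E)); last first.
      apply/funext => s; congr (_%:E); rewrite !indicE; congr (nat_of_bool _)%:R.
      by apply/idP/idP; rewrite !inE /A/= tnth_upd eqxx.
    rewrite integral_indic//; last by apply: measurableC; exact: measurable_itv.
    rewrite (_ : _ `&` _ = [set 1]).
      have := @lebesgue_measure_set1 R 1; rewrite /= => ->.
      by rewrite lexx.
     apply/seteqP; split => s /=; rewrite !in_itv/=.
      by case=> /negP; rewrite negb_and -!ltNge -!leNgt; move=> /orP[|] ? /andP[? ?]; apply/eqP; rewrite eq_le; apply/andP; split; lra.
    by move=> ->; rewrite lexx ler01 ltxx.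
rewrite /Rintegral integral_indic// setIT => h.
apply/eqP; rewrite eq_le measure_ge0 andbT.
rewrite -[X in (X <= _)%E]fineK; last exact: fin_num_measure.
by rewrite lee_fin.
Qed.

Lemma torus_ae n (P : n.-tuple R -> Prop) :
  (forall x, (forall i, 0 <= tnth x i < 1) -> P x) ->
  {ae torus_measure R n, forall x, P x}.
Proof.
move=> hP; have : {ae torus_measure R n, forall x, forall i, 0 <= tnth x i < 1}.
  apply: (@filter_forall _ _ (fun i (x : n.-tuple R) => is_true (0 <= tnth x i < 1))) => i.
  exact: torus_ae_coord.
exact: filterS.
Qed.

End torus.

Section space_time.
Context (R : realType) (T : R) (n : nat).
Local Notation Q := (QT_measure T n).
Local Notation dom := (fun p : R * n.-tuple R => 0 <= p.1 < T).

Lemma QT_fin : (Q setT < +oo)%E.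
Proof. exact: (@prod_measure_fin _ _ _ _ _ (time_measure T) (torus_measure R n)). Qed.

Lemma QT_setX (A : set (measurableTypeR R)) (B : set (n.-tuple R)) :
  measurable A -> measurable B ->
  Q (A `*` B) = (time_measure T A * torus_measure R n B)%E.
Proof.
exact: (@product_measure1E _ _ _ _ _ (time_measure T) (torus_measure R n)).
Qed.

Lemma QT_ae_time (P : R * n.-tuple R -> Prop) :
  (forall t x, 0 <= t < T -> P (t, x)) -> {ae Q, forall p, P p}.
Proof.
move=> h; exists ((~` `[0, T[%classic) `*` setT); split.
- by apply: measurableX => //; apply: measurableC; exact: measurable_itv.
- rewrite QT_setX//; last by apply: measurableC; exact: measurable_itv.
  by rewrite /time_measure/= /mrestr setICl measure0 mul0e.
- move=> [t x] /=; apply: contra_notP => /= h'; apply: h.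
  by apply: contrapT => tT; apply: h'; split => //; rewrite in_itv.
Qed.

Lemma QT_ae_space (P : n.-tuple R -> Prop) :
  {ae torus_measure R n, forall x, P x} -> {ae Q, forall p, P p.2}.
Proof.
move=> [N [mN N0 NP]]; exists (setT `*` N); split.
- exact: measurableX.
- by rewrite QT_setX// N0 mule0.
- by move=> [t x] /= Px; split => //; exact: NP.
Qed.

Lemma QT_aeS (P P' : R * n.-tuple R -> Prop) : (forall p, P p -> P' p) ->
  {ae Q, forall p, P p} -> {ae Q, forall p, P' p}.
Proof. exact: (@filterS _ _ (ae_filter_ringOfSetsType Q)). Qed.

Lemma QT_aeS2 (P P' P'' : R * n.-tuple R -> Prop) :
  (forall p, P p -> P' p -> P'' p) ->
  {ae Q, forall p, P p} -> {ae Q, forall p, P' p} -> {ae Q, forall p, P'' p}.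
Proof. exact: (@filterS2 _ _ (ae_filter_ringOfSetsType Q)). Qed.

Lemma QT_ae (P : R * n.-tuple R -> Prop) :
  (forall t x, 0 <= t < T -> (forall i, 0 <= tnth x i < 1) -> P (t, x)) ->
  {ae Q, forall p, P p}.
Proof.
move=> h; have h1 : {ae Q, forall p, dom p} by exact: QT_ae_time.
have h2 : {ae Q, forall p, forall i, 0 <= tnth p.2 i < 1}.
  exact: (QT_ae_space (torus_ae (P := fun x => forall i, 0 <= tnth x i < 1) _)).
by apply: QT_aeS2 h1 h2 => -[t x] /=; exact: h.
Qed.

Lemma QT_bounded_rintegrable (f : R * n.-tuple R -> R) (M : R) :
  measurable_fun setT f -> (forall t x, 0 <= t < T -> `|f (t, x)| <= M) ->
  rintegrable Q f.
Proof.
by move=> mf fM; apply: (bounded_rintegrable (M := M)) QT_fin mf _; exact: QT_ae_time.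
Qed.

Lemma QT_bounded_sq_integrable (f : R * n.-tuple R -> R) (M : R) :
  measurable_fun setT f -> (forall t x, 0 <= t < T -> `|f (t, x)| <= M) ->
  sq_integrable Q f.
Proof.
move=> mf fM; split => //; apply: (QT_bounded_rintegrable (M := M ^+ 2)).
  exact: measurable_funX.
move=> t x tT; rewrite normrX lerXn2r ?nnegrE//; first exact: le_trans (fM t x tT).
exact: fM.
Qed.

Lemma Rint_QT_space_le0 (h : R * n.-tuple R -> R) (i : 'I_n) : rintegrable Q h ->
  (forall t, 0 <= t < T -> exists M, forall x, `|h (t, x)| <= M) ->
  (forall t x, 0 <= t < T ->
     \int[lebesgue_measure]_(s in `[0, 1]) h (t, upd x i s) <= 0) ->
  \int[Q]_p h p <= 0.
Proof.
move=> ih hM hs; apply: (@Rint_prod_le0_r _ _ _ _ _ (time_measure T) (torus_measure R n)) => //.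
apply: time_measure_ae => t tT; have [M tM] := hM t tT.
apply: (@Rint_torus_le0 _ _ _ i M) => //; last by move=> x; exact: hs.
apply: (measurableT_comp (rintegrable_measurable ih)); exact: pair1_measurable.
Qed.

Lemma Rint_QT_time_derivative (H h : R * n.-tuple R -> R) (M : R) : 0 < T ->
  measurable_fun setT h -> (forall t x, 0 <= t < T -> `|h (t, x)| <= M) ->
  (forall x (t : R), is_derive t (1 : R) (fun s : R => H (s, x)) (h (t, x))) ->
  (forall x, continuous (fun t => h (t, x))) ->
  \int[Q]_p h p = \int[torus_measure R n]_x (H (T, x) - H (0, x)).
Proof.
move=> T0 mh hM dH ch; have ih := QT_bounded_rintegrable mh hM.
rewrite (@Rint_prod_l _ _ _ _ _ (time_measure T) (torus_measure R n))//.
apply: eq_Rintegral => x _; rewrite Rint_time; last first.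
  apply: (bounded_rintegrable (M := M)).
  - by rewrite -ge0_fin_numE// fin_num_measure.
  - exact: (measurableT_comp mh (pair2_measurable x)).
  - by apply: time_measure_ae => t tT; exact: hM.
rewrite Rintegral_itv_bndo_bndc ?(Rint_derivative T0 (dH x) (ch x))//.
apply: measurable_bounded_integrable => //.
- by rewrite /= lebesgue_measure_itv/=; case: ifP; rewrite ?ltry// -EFinD ltry.
- exact: measurable_funTS (measurableT_comp mh (pair2_measurable x)).
- exists `|M|; split; rewrite ?num_real// => y My t /=; rewrite in_itv/= => tT.
  by rewrite (le_trans (hM t x tT))// (le_trans (ler_norm _))// ltW.
Qed.

End space_time.

(** * Polynomials converging to a step function (Brosowski-Deutsch) *)

Section threshold.
Context (R : realType).
Implicit Types x y s u : R.

Lemma bernoulli_ge u k : 0 <= u <= 1 -> 1 - k%:R * u <= (1 - u) ^+ k.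
Proof.
move=> u01; elim: k => [|k IH]; first by rewrite mul0r subr0 expr0.
rewrite exprSr -natr1.
apply: (@le_trans _ _ ((1 - k%:R * u) * (1 - u))); last by apply: ler_wpM2r => //; lra.
have : 0 <= k%:R * u ^+ 2 by rewrite mulr_ge0 ?sqr_ge0.
by nra.
Qed.

(** Bernoulli's inequality for [1 + u], combined with [(1 - u) (1 + u) <= 1]. *)
Lemma bernoulli_inv_ge u k : 0 <= u <= 1 -> (1 - u) ^+ k * (1 + k%:R * u) <= 1.
Proof.
move=> u01; have h : 1 + k%:R * u <= (1 + u) ^+ k.
  elim: k => [|k IH]; first by rewrite mul0r addr0 expr0.
  rewrite exprSr -natr1.
  apply: (@le_trans _ _ ((1 + k%:R * u) * (1 + u))); last by apply: ler_wpM2r => //; lra.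
  have : 0 <= k%:R * u ^+ 2 by rewrite mulr_ge0 ?sqr_ge0.
  by nra.
apply: (@le_trans _ _ ((1 - u) ^+ k * (1 + u) ^+ k)).
  by rewrite ler_wpM2l// exprn_ge0//; lra.
by rewrite -exprMn exprn_ile1//; nra.
Qed.

(** With [s] the square root of [x], [n s ^ n] is at most the geometric sum [(1 - s ^ n) / (1 - s)],
    whence [n x ^ n <= s ^ n / (1 - s)]. *)
Lemma cvg_mulrn_expr x : 0 <= x < 1 -> n%:R * x ^+ n @[n --> \oo] --> 0.
Proof.
move=> x01; pose s := Num.sqrt x.
have s0 : 0 <= s by exact: sqrtr_ge0.
have xs : x = s * s by rewrite -expr2 sqr_sqrtr//; lra.
have s1 : s < 1 by nra.
have ns n : n%:R * s ^+ n * (1 - s) <= 1 - s ^+ n.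
  elim: n => [|n IH]; first by rewrite mul0r mul0r expr0 subrr.
  rewrite exprS -natr1.
  have : s ^+ n <= 1 by rewrite exprn_ile1// ltW.
  have : 0 <= s ^+ n by rewrite exprn_ge0.
  move: IH; set a := s ^+ n; set b := n%:R * a => IH a0 a1.
  rewrite mulrDl mul1r (_ : n%:R * (s * a) = s * b); last by rewrite /b; ring.
  have : s * (b * (1 - s)) <= s * (1 - a) by rewrite ler_wpM2l.
  have : s * a * (1 - s) <= 1 - s by rewrite ler_piMl//; [lra|rewrite mulr_ile1//; lra].
  by nra.
apply: (squeeze_cvgr (f := fun=> 0) (h := fun n => (1 - s)^-1 * s ^+ n)).
- apply: nearW => n; rewrite mulr_ge0 ?exprn_ge0//=; last by lra.
  rewrite ler_pdivlMl ?subr_gt0// xs exprMn.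
  have : 0 <= s ^+ n by rewrite exprn_ge0.
  by have := ns n; set a := s ^+ n; nra.
- exact: cvg_cst.
- rewrite -[X in _ --> X](mulr0 (1 - s)^-1); apply: cvgM; first exact: cvg_cst.
  by apply: cvg_expr; rewrite ger0_norm.
Qed.

(* The extra factor [n] in the exponent makes the limit at [y = 1/2] equal to [0]
   instead of [exp (-1)]. *)
Lemma cvg_threshold y : 0 <= y <= 1 ->
  (1 - y ^+ n) ^+ (n * 2 ^ n) @[n --> \oo] --> ((y < 2^-1)%R%:R : R).
Proof.
move=> y01; have yn n : 0 <= y ^+ n <= 1.
  by rewrite exprn_ge0 ?exprn_ile1//; lra.
have dn n : (n * 2 ^ n)%:R * y ^+ n = n%:R * (2 * y) ^+ n.
  by rewrite natrM natrX exprMn; ring.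
(* Below 1/2 Bernoulli gives the lower bound [1 - n (2 y) ^ n] with [2 y < 1]. From 1/2 on, the
   inverse inequality gives the upper bound [1 / (1 + n (2 y) ^ n) <= 1 / (n + 1)]. *)
case: ltP => y2.
- apply: (squeeze_cvgr (f := fun n => 1 - n%:R * (2 * y) ^+ n) (h := fun=> 1)).
  + apply: nearW => n; rewrite -dn bernoulli_ge//=.
    by rewrite exprn_ile1//; have := yn n; lra.
  + rewrite -[X in _ --> X]subr0; apply: cvgB; first exact: cvg_cst.
    by apply: cvg_mulrn_expr; lra.
  + exact: cvg_cst.
- apply: (squeeze_cvgr (f := fun=> 0) (h := harmonic)).
  + apply: nearW => n; rewrite exprn_ge0 /=; last by have := yn n; lra.
    rewrite -[leRHS]mul1r ler_pdivlMr//.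
    apply: le_trans (bernoulli_inv_ge (n * 2 ^ n) (yn n)).
    rewrite ler_wpM2l ?exprn_ge0//; first by have := yn n; lra.
    rewrite dn -natr1 addrC lerD2l ler_peMr// exprn_ege1//.
    by lra.
  + exact: cvg_cst.
  + exact: cvg_harmonic.
Qed.

End threshold.

(** The sum is the integer part of [y], in layer-cake form: with [y] a function, it becomes a finite
    sum of indicators of superlevel sets. *)
Lemma sum_indic_floor (R : realType) (m : nat) (y : R) : 0 <= y <= m%:R ->
  `|y - \sum_(k < m) (k.+1%:R <= y)%R%:R| <= 1.
Proof.
move=> /andP[y0 ym].
have hi n : n%:R <= y -> \sum_(k < n) (k.+1%:R <= y)%R%:R = n%:R :> R.
  move=> ny; rewrite (eq_bigr (fun=> 1)) ?sumr_const ?card_ord// => k _.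
  by rewrite (le_trans _ ny)// ler_nat.
suff /(_ m ym) : forall n : nat, y <= n%:R ->
    y - 1 <= \sum_(k < n) (k.+1%:R <= y)%R%:R <= y.
  by move=> /andP[h1 h2]; rewrite ler_norml; apply/andP; split; lra.
elim=> [|n IH] yn; first by rewrite big_ord0; lra.
rewrite big_ord_recr/=; have [ny|ny] := leP y n%:R.
  have /IH : y <= n%:R by [].
  have [ny'|] := leP n.+1%:R y; last by rewrite addr0.
  by move: (le_trans ny' ny); rewrite ler_nat ltnn.
rewrite (hi n (ltW ny)); move: yn; rewrite -natr1 => yn.
by have [ny'|ny'] := leP (n%:R + 1) y; rewrite /= ?addr0; lra.
Qed.

(** * Density in weighted L2 spaces *)

Section weighted_density.
Context d (X : measurableType d) (R : realType) (mu : {measure set X -> \bar R}).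
Implicit Types f g v : X -> R.

Definition ae_bdd f := measurable_fun setT f /\
  exists M, {ae mu, forall x, `|f x| <= M}.

Lemma ae_bdd_pos f : ae_bdd f -> exists2 M, 0 < M & {ae mu, forall x, `|f x| <= M}.
Proof.
move=> [_ [M fM]]; exists (`|M| + 1); first by rewrite ltr_wpDl.
apply: filterS fM => x h; rewrite (le_trans h)// (le_trans (ler_norm _))//.
by rewrite lerDl.
Qed.

Lemma ae_bddD f g : ae_bdd f -> ae_bdd g -> ae_bdd (fun x => f x + g x).
Proof.
move=> [mf [M fM]] [mg [N gN]]; split; first exact: measurable_funD.
exists (M + N); apply: filterS2 fM gN => x fx gx.
by rewrite (le_trans (ler_normD _ _))// lerD.
Qed.

Lemma ae_bddM f g : ae_bdd f -> ae_bdd g -> ae_bdd (fun x => f x * g x).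
Proof.
move=> [mf [M fM]] [mg [N gN]]; split; first exact: measurable_funM.
exists (M * N); apply: filterS2 fM gN => x fx gx.
by rewrite normrM ler_pM.
Qed.

Lemma ae_bddZ k f : ae_bdd f -> ae_bdd (fun x => k * f x).
Proof.
move=> [mf [M fM]]; split; first exact: measurable_funM.
exists (`|k| * M); apply: filterS fM => x fx.
by rewrite normrM ler_wpM2l.
Qed.

Lemma ae_bddB f g : ae_bdd f -> ae_bdd g -> ae_bdd (fun x => f x - g x).
Proof.
move=> bf /(ae_bddZ (-1)) /(ae_bddD bf).
by under eq_fun do rewrite mulN1r.
Qed.

Lemma ae_bdd_indic (A : set X) : measurable A -> ae_bdd \1_A.
Proof.
move=> mA; split; first exact: measurable_indic.
exists 1; apply: aeW => x; rewrite indicE ger0_norm// lern1; exact: leq_b1.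
Qed.

Variables (rho : X -> R) (V : (X -> R) -> Prop).
Hypothesis rho_ge0 : forall x, 0 <= rho x.
Hypothesis rho_rintegrable : rintegrable mu rho.
Hypothesis V_bdd : forall f, V f -> ae_bdd f.
Hypothesis V1 : V (fun=> 1).
Hypothesis VZ : forall k f, V f -> V (fun x => k * f x).
Hypothesis VD : forall f g, V f -> V g -> V (fun x => f x + g x).
Hypothesis VM : forall f g, V f -> V g -> V (fun x => f x * g x).

Definition weighted_sq f := \int[mu]_x (rho x * f x ^+ 2).

(* Only bounded functions are considered: they are square integrable for any
   integrable weight [rho], and the weight [z ^ 2] is needed later. *)
Definition wclosure f := ae_bdd f /\
  forall e, 0 < e -> exists2 v, V v & weighted_sq (fun x => f x - v x) < e.

Lemma rintegrable_w f : ae_bdd f -> rintegrable mu (fun x => rho x * f x).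
Proof.
move=> [mf [M fM]]; apply: (@rintegrable_ae_le _ _ _ _ _ (fun x => M * rho x)).
- by apply: measurable_funM => //; exact: rintegrable_measurable rho_rintegrable.
- exact: rintegrableZ.
- apply: filterS fM => x fx.
  by rewrite normrM (ger0_norm (rho_ge0 x)) mulrC ler_wpM2r//.
Qed.

Lemma rintegrable_weighted_sq f : ae_bdd f -> rintegrable mu (fun x => rho x * f x ^+ 2).
Proof. by move=> bf; apply: rintegrable_w; under eq_fun do rewrite expr2; exact: ae_bddM. Qed.

Lemma weighted_sqD f g : ae_bdd f -> ae_bdd g ->
  weighted_sq (fun x => f x + g x) <= 2 * weighted_sq f + 2 * weighted_sq g.
Proof.
move=> bf bg; have fi := rintegrable_weighted_sq bf; have gi := rintegrable_weighted_sq bg.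
rewrite /weighted_sq -!RintegralZl// -RintegralD//; [|exact: rintegrableZ..].
apply: Rint_ae_le; [exact/rintegrable_weighted_sq/ae_bddD|by apply: rintegrableD; exact: rintegrableZ|].
apply: aeW => x; rewrite -[leRHS]mulrDr ?mulrA.
have := sqr_ge0 (f x - g x) => h; have := rho_ge0 x; nra.
Qed.

Lemma weighted_sqM f g M : ae_bdd f -> ae_bdd g -> {ae mu, forall x, `|f x| <= M} ->
  weighted_sq (fun x => f x * g x) <= M ^+ 2 * weighted_sq g.
Proof.
move=> bf bg fM; have gi := rintegrable_weighted_sq bg.
rewrite /weighted_sq -RintegralZl//.
apply: Rint_ae_le; [exact/rintegrable_weighted_sq/ae_bddM|exact: rintegrableZ|].
apply: filterS fM => x fx; rewrite exprMn mulrCA.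
apply: ler_wpM2r; first by apply: mulr_ge0 => //; exact: sqr_ge0.
by rewrite -[f x ^+ 2]real_normK ?num_real// lerXn2r ?nnegrE// (le_trans _ fx).
Qed.

Lemma wclosure_V v : V v -> wclosure v.
Proof.
move=> Vv; split => [|e e0]; first exact: V_bdd.
exists v => //; rewrite /weighted_sq.
under eq_Rintegral do rewrite subrr expr0n mulr0.
by rewrite Rintegral_cst// mul0r.
Qed.

Lemma wclosure_approx f : ae_bdd f ->
  (forall e, 0 < e -> exists2 g, wclosure g & weighted_sq (fun x => f x - g x) < e) -> wclosure f.
Proof.
move=> bf h; split => // e e0.
have e4 : 0 < e / 4 by lra.
have [g [bg /(_ _ e4)[v Vv gv]] fg] := h _ e4.
exists v => //.
have := weighted_sqD (ae_bddB bf bg) (ae_bddB bg (V_bdd Vv)).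
under [X in X <= _]eq_Rintegral do rewrite subrKA; move=> /le_lt_trans; apply; lra.
Qed.

Lemma wclosure_lim (f_ : nat -> X -> R) f M : (forall n, wclosure (f_ n)) ->
  ae_bdd f -> {ae mu, forall x n, `|f_ n x| <= M} ->
  {ae mu, forall x, f_ ^~ x @ \oo --> f x} -> wclosure f.
Proof.
move=> clf bf fM flim; apply: wclosure_approx => // e e0.
have [N N0 fN] := ae_bdd_pos bf.
have [||||n] := @Rint_dominated _ _ _ mu
  (fun n x => rho x * (f x - f_ n x) ^+ 2) (fun x => rho x * (N + M) ^+ 2) _ _ _ _ e e0.
- by move=> n; apply: rintegrable_measurable; apply: rintegrable_weighted_sq; apply: ae_bddB => //; case: (clf n).
- by under eq_fun do rewrite mulrC; exact: rintegrableZ.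
- apply: filterS2 fM fN => x fx Nx n.
  rewrite ger0_norm; last by apply: mulr_ge0 => //; exact: sqr_ge0.
  apply: ler_wpM2l => //.
  rewrite -real_normK ?num_real// lerXn2r ?nnegrE//.
    by rewrite addr_ge0 ?(le_trans _ Nx)// (le_trans _ (fx 0%N)).
  by rewrite (le_trans (ler_normB _ _))// lerD.
- apply: filterS flim => x fx.
  have h0 : f x - f_ n x @[n --> \oo] --> 0.
    by rewrite -(subrr (f x)); apply: cvgB => //; exact: cvg_cst.
  have h1 := cvgM (cvg_cst (rho x)) (cvgM h0 h0).
  by rewrite !mulr0 in h1; exact: h1.
- move=> h; exists (f_ n) => //; exact: le_lt_trans (ler_norm _) h.
Qed.

Lemma wclosureD f g : wclosure f -> wclosure g -> wclosure (fun x => f x + g x).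
Proof.
move=> [bf cf] [bg cg]; split => [|e e0]; first exact: ae_bddD.
have e4 : 0 < e / 4 by lra.
have [v Vv fv] := cf _ e4; have [w Vw gw] := cg _ e4.
exists (fun x => v x + w x); first exact: VD.
have := weighted_sqD (ae_bddB bf (V_bdd Vv)) (ae_bddB bg (V_bdd Vw)).
under [X in X <= _]eq_Rintegral do rewrite addrACA -opprD.
by move=> /le_lt_trans; apply; lra.
Qed.

(** From [f g - v w = g (f - v) + v (g - w)]. Approximants are not uniformly bounded, so [w] is
    chosen after [v], with a tolerance depending on the bound of [v]. *)
Lemma wclosureM f g : wclosure f -> wclosure g -> wclosure (fun x => f x * g x).
Proof.
move=> [bf cf] [bg cg]; split => [|e e0]; first exact: ae_bddM.
have [M M0 gM] := ae_bdd_pos bg.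
have e1 : 0 < e / (4 * M ^+ 2) by rewrite divr_gt0// mulr_gt0// exprn_gt0.
have [v Vv fv] := cf _ e1.
have [K K0 vK] := ae_bdd_pos (V_bdd Vv).
have e2 : 0 < e / (4 * K ^+ 2) by rewrite divr_gt0// mulr_gt0// exprn_gt0.
have [w Vw gw] := cg _ e2.
exists (fun x => v x * w x); first exact: VM.
have bfv := ae_bddB bf (V_bdd Vv); have bgw := ae_bddB bg (V_bdd Vw).
have := weighted_sqD (ae_bddM bg bfv) (ae_bddM (V_bdd Vv) bgw).
rewrite (_ : (fun x => g x * (f x - v x) + v x * (g x - w x)) =
  (fun x => f x * g x - v x * w x)); last by apply/funext => x; ring.
have := weighted_sqM bg bfv gM; have := weighted_sqM (V_bdd Vv) bgw vK.
move: fv gw; rewrite !ltr_pdivlMr ?mulr_gt0 ?exprn_gt0//; lra.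
Qed.

Lemma wclosureZ k f : wclosure f -> wclosure (fun x => k * f x).
Proof. by apply: wclosureM; rewrite -[k]mulr1; exact/wclosure_V/VZ. Qed.

Lemma VX f n : V f -> V (fun x => f x ^+ n).
Proof.
move=> Vf; elim: n => [|n IH]; first by under eq_fun do rewrite expr0.
by under eq_fun do rewrite exprS; exact: VM.
Qed.

(** These sets are shown below to be stable under complement and countable union. Density is thus
    reduced to generators of the sigma-algebra, without topology on the space. *)
Definition wclosure_set (A : set X) := measurable A /\ wclosure \1_A.

(** An affine change of [v], scaled by a bound [B] of [v - c], yields [y] in [0, 1] for which
    [v < c] reads [y < 1/2]. The threshold polynomials in [y] stay in the algebra [V], are bounded
    by 1 and converge to the indicator. *)
Lemma wclosure_set_lt v (c : R) : V v -> wclosure_set [set x | v x < c].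
Proof.
move=> Vv; have [mv _] := V_bdd Vv.
have mA : measurable [set x | v x < c].
  by rewrite -[X in measurable X]setTI; exact: (measurable_fun_ltr mv (measurable_cst c)).
split => //.
have Vc : V (fun x => v x - c) by apply: VD => //; rewrite -[- c]mulr1; exact: VZ.
have [B B0 vB] := ae_bdd_pos (V_bdd Vc).
pose y x := (2 * B)^-1 * (v x - c) + 2^-1.
have Vy : V y by apply: VD; [exact: VZ|rewrite -[2^-1]mulr1; exact: VZ].
have y01 : {ae mu, forall x, 0 <= y x <= 1}.
  apply: filterS vB => x; rewrite ler_norml /y => /andP[h1 h2].
  have B2 : 0 < (2 * B)^-1 by rewrite invr_gt0; lra.
  have BB : (2 * B)^-1 * B = 2^-1 by field; rewrite gt_eqF.
  have := ler_wpM2l (ltW B2) h1; have := ler_wpM2l (ltW B2) h2.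
  by rewrite mulrN BB => *; apply/andP; split; lra.
apply: (@wclosure_lim (fun n x => (1 - y x ^+ n) ^+ (n * 2 ^ n)) _ 1).
- move=> n; apply: wclosure_V; apply: VX; apply: VD => //.
  rewrite (_ : (fun _ => _) = (fun x => -1 * y x ^+ n)); last by apply/funext => x; rewrite mulN1r.
  by apply: VZ; exact: VX.
- exact: ae_bdd_indic.
- apply: filterS y01 => x h n; have : 0 <= y x ^+ n <= 1.
    by rewrite exprn_ge0 ?exprn_ile1//; lra.
  by move=> ?; rewrite ger0_norm ?exprn_ge0 ?exprn_ile1//; lra.
- apply: filterS y01 => x /cvg_threshold.
  suff -> : (y x < 2^-1)%R = (x \in [set x | v x < c]) by [].
  rewrite /y gtrDr pmulr_rlt0 ?invr_gt0 ?mulr_gt0// subr_lt0.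
  by apply/idP/idP; rewrite inE.
Qed.

Lemma wclosure_setC A : wclosure_set A -> wclosure_set (~` A).
Proof.
move=> [mA cA]; split; first exact: measurableC.
have := wclosureD (wclosure_V V1) (wclosureZ (-1) cA).
rewrite (_ : (fun x => 1 + -1 * \1_A x) = \1_(~` A))//.
by apply/funext => x; rewrite !indicE in_setC; case: (x \in A); rewrite /=; ring.
Qed.

Lemma wclosure_setI A B : wclosure_set A -> wclosure_set B -> wclosure_set (A `&` B).
Proof.
move=> [mA cA] [mB cB]; split; first exact: measurableI.
by rewrite indicI; exact: wclosureM.
Qed.

Lemma wclosure_setU A B : wclosure_set A -> wclosure_set B -> wclosure_set (A `|` B).
Proof.
move=> /wclosure_setC cA /wclosure_setC cB.
by rewrite -[A]setCK -[B]setCK -setCI; exact/wclosure_setC/wclosure_setI.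
Qed.

Lemma wclosure_set0 : wclosure_set set0.
Proof.
split => //; have := wclosure_V (VZ 0 V1); congr wclosure.
by apply/funext => x; rewrite indic0 mul0r.
Qed.

Lemma wclosure_set_bigcup (F : nat -> set X) : (forall n, wclosure_set (F n)) ->
  wclosure_set (\bigcup_n F n).
Proof.
move=> cF; have mF : measurable (\bigcup_n F n).
  by apply: bigcup_measurable => n _; case: (cF n).
split => //; pose G n := \big[setU/set0]_(i < n) F i.
have cG n : wclosure_set (G n).
  by apply: (big_ind wclosure_set) => //; [exact: wclosure_set0|exact: wclosure_setU].
apply: (@wclosure_lim (fun n => \1_(G n)) _ 1).
- by move=> n; case: (cG n).
- exact: ae_bdd_indic.
- apply: aeW => x n; rewrite indicE ger0_norm// lern1; exact: leq_b1.
- apply: aeW => x; apply: cvg_near_cst.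
  have [[k _ Fkx]|nFx] := pselect ((\bigcup_n F n) x).
    exists k.+1 => // n /= kn; rewrite !indicE !mem_set//; first by exists k.
    by rewrite /G -bigcup_mkord; exists k.
  apply: nearW => n; rewrite !indicE !memNset//.
  by rewrite /G -bigcup_mkord => -[k _ Fkx]; apply: nFx; exists k.
Qed.

Hypothesis V_gen : forall A, measurable A -> wclosure_set A.

(** After a shift making [f] nonnegative, rounding down to multiples of [1 / (n + 1)] costs at most
    [1 / (n + 1)] uniformly and leaves a finite combination of indicators. *)
Lemma wclosure_bounded f : ae_bdd f -> wclosure f.
Proof.
move=> bf; have [M M0 fM] := ae_bdd_pos bf; have [mf _] := bf.
pose h x := f x + M.
have bc (c : R) : ae_bdd (fun=> c) by split => //; exists `|c|; exact: aeW.
have bh : ae_bdd h by exact: ae_bddD.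
have h0 : {ae mu, forall x, 0 <= h x <= 2 * M}.
  by apply: filterS fM => x; rewrite ler_norml /h => /andP[? ?]; apply/andP; split; lra.
suff : wclosure h.
  move=> /wclosureD /(_ (wclosureZ (- M) (wclosure_V V1))); congr wclosure.
  by apply/funext => x; rewrite /h; ring.
apply: wclosure_approx => // e e0.
pose W := weighted_sq (fun=> 1).
have W0 : 0 <= W by apply: Rintegral_ge0 => x _; rewrite mulr_ge0 ?sqr_ge0.
(* The squared rounding error is at most [W / (n + 1) ^ 2], which this choice puts below [e]. *)
have [n nW] : exists n : nat, W / e < n.+1%:R.
  by exists (Num.truncn (W / e)); exact: truncnS_gt.
have n0 : 0 < n.+1%:R :> R by rewrite ltr0n.
pose m := (Num.truncn (n.+1%:R * (2 * M))).+1.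
have hm x : h x <= 2 * M -> n.+1%:R * h x <= m%:R.
  move=> hx; apply/ltW/le_lt_trans/truncnS_gt; rewrite ler_wpM2l//; exact: ltW.
pose A (k : nat) := [set x | k.+1%:R <= n.+1%:R * h x].
have mA k : measurable (A k).
  rewrite -[X in measurable X]setTI.
  apply: (measurable_fun_ler (measurable_cst _)) => //.
  by apply: measurable_funM => //; case: bh.
pose S x : R := \sum_(k < m) \1_(A k) x.
have cS : wclosure S.
  suff H k : wclosure (fun x => \sum_(j < k) \1_(A j) x) by exact: H.
  elim: k => [|k IH].
    under eq_fun do rewrite big_ord0.
    have := wclosure_V (VZ 0 V1); congr wclosure; apply/funext => x; exact: mul0r.
  under eq_fun do rewrite big_ord_recr/=; apply: wclosureD => //.
  by case: (V_gen (mA k)).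
exists (fun x => n.+1%:R^-1 * S x); first exact: wclosureZ.
have bS : ae_bdd (fun x => h x - n.+1%:R^-1 * S x).
  by apply: ae_bddB => //; apply: ae_bddZ; case: cS.
have hS : {ae mu, forall x, `|h x - n.+1%:R^-1 * S x| <= n.+1%:R^-1}.
  apply: filterS h0 => x /andP[hx0 /hm hxm].
  have -> : h x - n.+1%:R^-1 * S x = n.+1%:R^-1 * (n.+1%:R * h x - S x).
    by field; rewrite addrC natr1 gt_eqF.
  rewrite normrM ger0_norm ?invr_ge0// ler_piMr ?invr_ge0//.
  have y0 : 0 <= n.+1%:R * h x by rewrite mulr_ge0.
  have -> : S x = \sum_(k < m) (k.+1%:R <= n.+1%:R * h x)%R%:R.
    apply: eq_bigr => k _; rewrite indicE; congr (nat_of_bool _)%:R.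
    by apply/idP/idP; rewrite inE.
  by apply: sum_indic_floor; rewrite y0.
have := weighted_sqM bS (bc 1) hS; rewrite -/W.
under [X in X <= _]eq_Rintegral do rewrite mulr1.
move=> /le_lt_trans; apply.
rewrite expr2 -mulrA ltr_pdivrMl//.
move: nW; rewrite ltr_pdivrMr// => nW.
have : n.+1%:R^-1 * W <= W.
  by rewrite ler_piMl// invf_le1// ler1n.
by move=> /le_lt_trans; exact.
Qed.

End weighted_density.

(** Truncation: [f] is replaced by 0 where it exceeds [n], at a cost controlled by dominated
    convergence, and the bounded remainder is approximated for the weight 1. *)
Lemma sq_integrable_dense d (X : measurableType d) (R : realType)
    (mu : {measure set X -> \bar R}) (V : (X -> R) -> Prop) f :
  rintegrable mu (fun=> 1) -> (forall v, V v -> ae_bdd mu v) ->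
  (forall g, ae_bdd mu g -> wclosure mu (fun=> 1) V g) ->
  sq_integrable mu f -> (forall e, 0 < e ->
    exists2 v, V v & \int[mu]_x (f x - v x) ^+ 2 < e).
Proof.
move=> i1 Vb cV [mf fi] e e0.
pose A (n : nat) := [set x | `|f x| <= n%:R].
have mA n : measurable (A n).
  rewrite -[X in measurable X]setTI.
  by apply: measurable_fun_ler => //; exact: measurableT_comp.
pose fn n x := f x * \1_(A n) x.
have bfn n : ae_bdd mu (fn n).
  split; first exact: measurable_funM.
  exists n%:R; apply: aeW => x; rewrite /fn indicE.
  by case: (boolP (x \in A n)) => [|_]; [rewrite mulr1 inE|rewrite mulr0 normr0].
have ffn n x : f x - fn n x = f x * (x \notin A n)%:R.
  by rewrite /fn indicE; case: (x \in A n); rewrite /= ?mulr1 ?mulr0 ?subr0 ?subrr.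
have sq n x : (f x - fn n x) ^+ 2 <= f x ^+ 2.
  rewrite ffn exprMn ler_piMr ?sqr_ge0//.
  by case: (x \notin A n); rewrite /= ?expr1n ?expr0n.
have sf : sq_integrable mu f by [].
have sfn n : sq_integrable mu (fun x => f x - fn n x).
  apply: (sq_integrable_ae_le _ sf); first by apply: measurable_funB => //; case: (bfn n).
  apply: aeW => x; rewrite -ler_sqr ?nnegrE// !real_normK ?num_real//.
have [|||||n] := @Rint_dominated _ _ _ mu (fun n x => (f x - fn n x) ^+ 2)
  (fun x => f x ^+ 2) _ _ _ _ (e / 4) _.
- by move=> n; case: (sfn n) => _ /rintegrable_measurable.
- by [].
- by apply: aeW => x n; rewrite ger0_norm ?sqr_ge0.
- apply: aeW => x; apply: cvg_near_cst; exists (Num.truncn `|f x|).+1 => // n /= xn.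
  rewrite ffn mem_set ?mulr0 ?expr0n//= /A/=.
  by rewrite (le_trans (ltW (truncnS_gt _)))// ler_nat.
- lra.
rewrite ger0_norm ?Rint_sqr_ge0// => fne.
have [_ /(_ (e / 4))[|v Vv vn]] := cV _ (bfn n); first by lra.
exists v => //.
have bv := Vb _ Vv.
have sfv : sq_integrable mu (fun x => fn n x - v x).
  have bb := ae_bddB (bfn n) bv.
  split; first by case: bb.
  by have := rintegrable_weighted_sq (rho := fun=> 1) (fun=> ler01) i1 bb; under eq_fun do rewrite mul1r.
have := Rint_sqrD_le ltr01 (sfn n) sfv.
under [X in X <= _]eq_Rintegral do rewrite subrKA.
move=> /le_lt_trans; apply; rewrite invr1.
have -> : \int[mu]_x (fn n x - v x) ^+ 2 = weighted_sq mu (fun=> 1) (fun x => fn n x - v x).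
  by apply: eq_Rintegral => x _; rewrite mul1r.
lra.
Qed.

(** * Trigonometric sums with smooth coefficients in time *)

Section smooth_time_functions.
Context (R : realType).
Implicit Types (f g : R -> R) (s t : R).

(** The classical function that is flat at 0; the powers of [s^-1] are included so that the family
    is closed under differentiation up to linear combinations. *)
Definition bump (j : nat) (dl s : R) : R :=
  if 0 < s then s^-1 ^+ j * expR (- dl * s^-1) else 0.

Lemma bump_ge0 j dl s : 0 <= bump j dl s.
Proof.
rewrite /bump; case: ifP => // s0.
by rewrite mulr_ge0 ?expR_ge0// exprn_ge0// invr_ge0 ltW.
Qed.

(** The exponential beats powers: [(x / n) ^ n <= expR x] for [x = dl / s] and [n = j + 2]. A
    quadratic bound is what differentiability at 0 requires. *)
Lemma bump_le_sqr j dl : 0 < dl ->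
  exists2 C, 0 <= C & forall s, bump j dl s <= C * s ^+ 2.
Proof.
move=> d0; pose n := j.+2; pose C := (n%:R / dl) ^+ n.
have C0 : 0 <= C by rewrite exprn_ge0// divr_ge0// ltW.
exists C => // s; rewrite /bump; case: ifPn => [s0|_]; last by rewrite mulr_ge0 ?sqr_ge0.
have n0 : 0 < n%:R :> R by rewrite ltr0n.
set y := s^-1; have y0 : 0 < y by rewrite invr_gt0.
have h1 : (dl * y / n%:R) ^+ n <= expR (dl * y).
  have -> : dl * y = n%:R * (dl * y / n%:R) by field; rewrite gt_eqF.
  rewrite expRM_natl [_ * (_ / _)]mulrC mulfVK ?gt_eqF//.
  rewrite lerXn2r ?nnegrE ?expR_ge0//.
    by rewrite divr_ge0 ?mulr_ge0// ltW.
  by apply: le_trans (expR_ge1Dx _); rewrite lerDr.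
have h2 : y ^+ n <= C * expR (dl * y).
  have -> : y ^+ n = C * (dl * y / n%:R) ^+ n.
    by rewrite /C -exprMn; congr (_ ^+ _); field; rewrite !gt_eqF.
  exact: ler_wpM2l.
rewrite mulNr expRN -(ler_pM2r (expR_gt0 (dl * y))).
rewrite -mulrA mulVf ?gt_eqF ?expR_gt0// mulr1.
rewrite -(ler_pM2r (exprn_gt0 2 y0)) -exprD addn2.
apply: le_trans h2 _; rewrite (_ : C * s ^+ 2 * _ * _ = C * expR (dl * y) * (s * y) ^+ 2); last by ring.
by rewrite divff ?gt_eqF// expr1n mulr1.
Qed.

Lemma bump_le0 j dl s : s <= 0 -> bump j dl s = 0.
Proof. by rewrite /bump leNgt; case: ifP. Qed.

Lemma is_derive_bump j dl s : 0 < dl -> is_derive s (1 : R) (bump j dl)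
  (- j%:R * bump j.+1 dl s + dl * bump j.+2 dl s).
Proof.
move=> d0; have [s0|s0|s0] := ltrgtP s 0.
- rewrite !bump_le0 ?ltW// !mulr0 addr0.
  apply: (@near_eq_is_derive _ _ _ (cst 0)) => //.
  near=> x; rewrite bump_le0//; apply: ltW; near: x.
  exact: lt_nbhsl.
- rewrite /bump s0.
  have D : is_derive s (1 : R) (fun s : R => s^-1) (- s ^- 2).
    have := @is_deriveV _ id s 1 1 (lt0r_neq0 s0) (is_derive_id _ _).
    by rewrite /GRing.scale/= mulr1.
  have DX : is_derive s (1 : R) (fun s => s^-1 ^+ j) (- j%:R * s^-1 ^+ j.+1).
    elim: j => [|j IH].
      rewrite mulr0n oppr0 mul0r; exact: is_derive_cst.
    under eq_fun do rewrite exprS.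
    have := @is_deriveM _ _ _ _ _ _ _ _ D IH.
    move=> h; apply: is_derive_eq; rewrite /GRing.scale/= -exprVn -natr1 !exprS.
    ring.
  have DE : is_derive s (1 : R) (fun s => expR (- dl * s^-1)) (dl * s^-1 ^+ 2 * expR (- dl * s^-1)).
    apply: is_derive_eq; rewrite /GRing.scale/= -exprVn; ring.
  apply: (@near_eq_is_derive _ _ _ (fun s => s^-1 ^+ j * expR (- dl * s^-1))).
  + near=> x; rewrite /bump ifT//; near: x; exact: lt_nbhsr.
  + have := @is_deriveM _ _ _ _ _ _ _ _ DX DE.
    move=> h; apply: is_derive_eq; rewrite /GRing.scale/= !exprS; ring.
(* At 0 the difference quotient is [bump j dl z / z], of size at most [C |z|] by the quadratic
   bound; Caratheodory's criterion then gives the derivative 0. *)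
- rewrite s0 !bump_le0// !mulr0 addr0.
  have [C C0 bC] := bump_le_sqr j d0.
  apply/is_derive1_caratheodory; exists (fun z => bump j dl z / z); split.
  - move=> z; rewrite (@bump_le0 j dl 0)// !subr0.
    have [->|z0] := eqVneq z 0; first by rewrite mulr0 (@bump_le0 j dl 0).
    by rewrite mulfVK.
  - rewrite /prop_for /continuous_at (@bump_le0 j dl 0)// mul0r.
    have C1 : 0 < C + 1 by lra.
    apply/cvgr0Pnorm_le => e e0; near=> z.
    have zC : `|z| <= e / (C + 1).
      near: z; exists (e / (C + 1)); first by rewrite /= divr_gt0.
      by move=> x; rewrite /= sub0r normrN => /ltW.
    have [->|z0] := eqVneq z 0; first by rewrite bump_le0// mul0r normr0 ltW.
    rewrite normrM normfV ger0_norm ?bump_ge0// ler_pdivrMr ?normr_gt0//.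
    apply: le_trans (bC z) _; rewrite -real_normK ?num_real// expr2 mulrA.
    rewrite ler_wpM2r//; move: zC; rewrite ler_pdivlMr// => zC.
    by have := normr_ge0 z; nra.
  - by rewrite bump_le0// mul0r.
Unshelve. all: by end_near. Qed.

(** A syntactic class generated by the time factors that the proof builds. As it is stable under
    differentiation, smoothness of every order follows by iterating one lemma. *)
Inductive smooth1 : (R -> R) -> Prop :=
| smooth1_cst c : smooth1 (fun=> c)
| smooth1_id : smooth1 (fun t => t)
| smooth1_exp b : smooth1 (fun t => expR (b * t))
| smooth1_bump j dl tau : 0 < dl -> smooth1 (fun t => bump j dl (tau - t))
| smooth1D f g : smooth1 f -> smooth1 g -> smooth1 (fun t => f t + g t)
| smooth1M f g : smooth1 f -> smooth1 g -> smooth1 (fun t => f t * g t).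

Lemma smooth1_derivative f : smooth1 f ->
  exists2 g, smooth1 g & forall t, is_derive t (1 : R) f (g t).
Proof.
elim=> {f} [c||b|j dl tau d0|f g _ [f' sf' df] _ [g' sg' dg]|
  f g sf [f' sf' df] sg [g' sg' dg]].
- by exists (fun=> 0); [exact: smooth1_cst|move=> t; exact: is_derive_cst].
- by exists (fun=> 1); [exact: smooth1_cst|move=> t; exact: is_derive_id].
- exists (fun t => b * expR (b * t)).
    by apply: smooth1M; [exact: smooth1_cst|exact: smooth1_exp].
  by move=> t; apply: is_derive_eq; rewrite /GRing.scale/=; ring.
- exists (fun t => j%:R * bump j.+1 dl (tau - t) + - dl * bump j.+2 dl (tau - t)).
    by apply: smooth1D; apply: smooth1M;
      [exact: smooth1_cst|exact: smooth1_bump|exact: smooth1_cst|exact: smooth1_bump].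
  move=> t; have D := is_derive_bump j (tau - t) d0.
  have D' : is_derive t (1 : R) (fun t => tau - t) (-1).
    by apply: is_derive_eq; rewrite add0r mul1r.
  have := @is_derive1_comp _ (bump j dl) (fun t => tau - t) t _ (-1) D D'.
  by move=> h; apply: is_derive_eq; ring.
- by exists (fun t => f' t + g' t); [exact: smooth1D|move=> t; exact: is_deriveD].
- exists (fun t => f' t * g t + f t * g' t).
    by apply: smooth1D; exact: smooth1M.
  move=> t; have Df := df t; have Dg := dg t; apply: is_derive_eq.
  by rewrite /GRing.scale/=; ring.
Qed.

Lemma smooth1_is_derive f t : smooth1 f -> is_derive t (1 : R) f (derive1 f t).
Proof.
by move=> /smooth1_derivative[g _ /(_ t)[dr _]]; rewrite derive1E; exact: derivableP.
Qed.

Lemma smooth1_derive1 f : smooth1 f -> smooth1 (derive1 f).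
Proof.
move=> /smooth1_derivative[g sg df]; rewrite (_ : (derive1 f) = g)//.
by apply/funext => t; rewrite derive1E; case: (df t).
Qed.

Lemma smooth1_continuous f : smooth1 f -> continuous f.
Proof.
move=> sf t; apply/differentiable_continuous/derivable1_diffP.
by case: (smooth1_is_derive t sf).
Qed.

End smooth_time_functions.

Lemma cosD2pi_int (R : realType) (x : R) (k : int) : cos (x + 2 * pi * k%:~R) = cos x.
Proof.
have h (y : R) (n : nat) : cos (y + 2 * pi * n%:R) = cos y.
  have -> : 2 * pi * n%:R = (pi *+ 2) *+ n :> R by rewrite -[RHS]mulr_natr -[pi *+ 2]mulr_natr; ring.
  by rewrite periodicn//; exact: cosD2pi.
case: (intP k) => [|n|n]; first by rewrite mulr0 addr0.
  by rewrite -pmulrn h.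
rewrite -[in RHS](subrK (2 * pi * n.+1%:R) x) h.
by congr cos; rewrite mulrNz -pmulrn mulrN.
Qed.

Lemma continuous_bounded_on (R : realType) (g : R -> R) (a b : R) : continuous g ->
  exists K, forall y, a <= y <= b -> `|g y| <= K.
Proof.
move=> cg; have cs : {within `[a, b], continuous g} by exact: continuous_subspaceT.
have /compact_bounded[K [_ Kb]] := continuous_compact cs (@segment_compact _ a b).
exists (`|K| + 1) => t tT; apply: Kb.
  by rewrite (le_lt_trans (ler_norm _))// ltrDl.
by exists t => //=; rewrite in_itv.
Qed.

Section trigonometric_sums.
Context (R : realType) (N : nat).
Implicit Types (x : 'I_N -> R) (t s : R) (k : 'I_N -> int).

(* A list of terms [(f, k, th)] encodes the sum of the functions
   [f t * cos (2 pi k . x + th)]. *)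
Record term := Term { tfun : R -> R; tfreq : 'I_N -> int; tphase : R }.
Implicit Types (a b : term) (l m : seq term).

Definition phase k x : R := \sum_i 2 * pi * (k i)%:~R * x i.

Definition wave a t x := tfun a t * cos (phase (tfreq a) x + tphase a).

Definition wave_sum l t x : R := \sum_(a <- l) wave a t x.

Fixpoint all_terms (P : (R -> R) -> Prop) l : Prop :=
  if l is a :: l' then P (tfun a) /\ all_terms P l' else True.

Lemma all_terms_cat P l m : all_terms P l -> all_terms P m -> all_terms P (l ++ m).
Proof. by elim: l => //= a l IH [Pa Pl] Pm; split => //; exact: IH. Qed.

Lemma all_terms_map P P' (F : term -> term) l :
  (forall a, P (tfun a) -> P' (tfun (F a))) ->
  all_terms P l -> all_terms P' (map F l).
Proof. by move=> PF; elim: l => //= a l IH [Pa Pl]; split; [exact: PF|exact: IH]. Qed.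

Lemma all_terms_imp (P P' : (R -> R) -> Prop) l : (forall f, P f -> P' f) ->
  all_terms P l -> all_terms P' l.
Proof. by move=> PP; elim: l => //= a l IH [Pa Pl]; split; [exact: PP|exact: IH]. Qed.

Lemma wave_sum_cat l m t x : wave_sum (l ++ m) t x = wave_sum l t x + wave_sum m t x.
Proof. by rewrite /wave_sum big_cat. Qed.

Lemma wave_sum_cons a l t x : wave_sum (a :: l) t x = wave a t x + wave_sum l t x.
Proof. by rewrite /wave_sum big_cons. Qed.

Lemma wave_sum_nil t x : wave_sum [::] t x = 0.
Proof. by rewrite /wave_sum big_nil. Qed.

Lemma wave_sum_map F l t x : wave_sum (map F l) t x = \sum_(a <- l) wave (F a) t x.
Proof. by rewrite /wave_sum big_map. Qed.

Definition mulT (g : R -> R) a := Term (fun t => g t * tfun a t) (tfreq a) (tphase a).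

Lemma wave_sum_mulT g l t x : wave_sum (map (mulT g) l) t x = g t * wave_sum l t x.
Proof.
by rewrite wave_sum_map /wave_sum mulr_sumr; apply: eq_bigr => a _; rewrite /wave/= mulrA.
Qed.

Definition dtT a := Term (derive1 (tfun a)) (tfreq a) (tphase a).

(** Since [- sin y = cos (y + pi / 2)], a space derivative is again a cosine with a shifted phase;
    this is why terms carry a phase instead of coming in sine and cosine pairs. *)
Definition dxT (i : 'I_N) a :=
  Term (fun t => 2 * pi * (tfreq a i)%:~R * tfun a t) (tfreq a) (tphase a + pi / 2).

Definition eigenvalue_of k : R := \sum_i (2 * pi * (k i)%:~R) ^+ 2.

Definition lapT a :=
  Term (fun t => - eigenvalue_of (tfreq a) * tfun a t) (tfreq a) (tphase a).

Lemma wave_sum_lapT l t x :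
  wave_sum (map lapT l) t x = \sum_i wave_sum (map (dxT i) (map (dxT i) l)) t x.
Proof.
under eq_bigr do rewrite -map_comp wave_sum_map.
rewrite wave_sum_map exchange_big/=; apply: eq_bigr => a _.
rewrite /wave/= /eigenvalue_of mulNr mulr_suml -sumrN mulr_suml.
apply: eq_bigr => i _.
have -> : phase (tfreq a) x + (tphase a + pi / 2 + pi / 2) =
  phase (tfreq a) x + tphase a + pi by field.
by rewrite cosDpi expr2; ring.
Qed.

Lemma phaseD k x y : phase k (fun i => x i + y i) = phase k x + phase k y.
Proof. by rewrite /phase -big_split/=; apply: eq_bigr => i _; rewrite mulrDr. Qed.

Lemma phaseZ k c x : phase k (fun i => c * x i) = c * phase k x.
Proof. by rewrite /phase mulr_sumr; apply: eq_bigr => i _; rewrite mulrCA. Qed.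

Lemma phase_delta k (i : 'I_N) : phase k (fun j => (j == i)%:R) = 2 * pi * (k i)%:~R.
Proof.
rewrite /phase (bigD1 i)//= eqxx mulr1 big1 ?addr0// => j /negPf ->.
by rewrite mulr0.
Qed.

Lemma is_derive_wave_sum_time l x t : all_terms (@smooth1 R) l ->
  is_derive t (1 : R) (fun s => wave_sum l s x) (wave_sum (map dtT l) t x).
Proof.
elim: l => [_|a l IH [sa sl]] /=.
  under eq_fun do rewrite wave_sum_nil; rewrite wave_sum_nil; exact: is_derive_cst.
under eq_fun do rewrite wave_sum_cons; rewrite wave_sum_cons.
have D1 := IH sl; have D2 := smooth1_is_derive t sa.
by apply: is_derive_eq; rewrite /wave /GRing.scale/=; ring.
Qed.

Lemma is_derive_wave_sum_dir l t (f : R -> R) x y s : 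
  is_derive s (1 : R) (fun h => wave_sum l t (fun i => x i + h * y i))
  (\sum_(a <- l) phase (tfreq a) y * (tfun a t * cos (phase (tfreq a) (fun i => x i + s * y i) + tphase a + pi / 2))).
Proof.
elim: l => [|a l IH] /=.
  under eq_fun do rewrite wave_sum_nil; rewrite big_nil; exact: is_derive_cst.
under eq_fun do rewrite wave_sum_cons; rewrite big_cons.
apply: is_deriveD.
rewrite /wave; under eq_fun do rewrite phaseD phaseZ.
by apply: is_derive_eq; rewrite /GRing.scale/= phaseD phaseZ cosDpihalf; ring.
Qed.

Lemma is_derive_wave_sum_upd l t (x : N.-tuple R) i s :
  is_derive s (1 : R) (fun h => wave_sum l t (tnth (upd x i h)))
    (wave_sum (map (dxT i) l) t (tnth (upd x i s))).
Proof.
have updE h : tnth (upd x i h) = (fun j => (if j == i then 0 else tnth x j) + h * (j == i)%:R).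
  by apply/funext => j; rewrite tnth_upd; case: eqP; rewrite ?mulr1 ?mulr0 ?addr0 ?add0r.
under eq_fun do rewrite updE; rewrite updE.
have := is_derive_wave_sum_dir l t (fun=> 0) (fun j => if j == i then 0 else tnth x j) (fun j => (j == i)%:R) s.
congr is_derive; rewrite wave_sum_map; apply: eq_bigr => a _.
by rewrite phase_delta /wave/=; rewrite !mulrA addrA.
Qed.

Lemma wave_sum_periodic l t x (i : 'I_N) :
  wave_sum l t (fun j => x j + (j == i)%:R) = wave_sum l t x.
Proof.
apply: eq_bigr => a _; rewrite /wave phaseD phase_delta addrAC.
by rewrite cosD2pi_int.
Qed.

Lemma wave_sum_upd10 l t (x : N.-tuple R) i : wave_sum l t (tnth (upd x i 1)) = wave_sum l t (tnth (upd x i 0)).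
Proof.
rewrite -(wave_sum_periodic l t (tnth (upd x i 0)) i); congr wave_sum.
by apply/funext => j; rewrite !tnth_upd; case: eqP; rewrite ?add0r ?addr0.
Qed.

Definition wave_sumQ l (p : R * N.-tuple R) := wave_sum l p.1 (tnth p.2).

Lemma measurable_wave_sumQ l : all_terms (fun f => continuous f) l ->
  measurable_fun setT (wave_sumQ l).
Proof.
elim: l => [_|a l IH [ca lc]] /=.
  by rewrite /wave_sumQ; under eq_fun do rewrite wave_sum_nil; exact: measurable_cst.
rewrite /wave_sumQ; under eq_fun do rewrite wave_sum_cons.
apply: measurable_funD; last exact: IH.
apply: measurable_funM.
  by apply: measurableT_comp => //; exact: continuous_measurable_fun.
apply: measurableT_comp; first exact: continuous_measurable_fun (@continuous_cos R).
apply: measurable_funD => //.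
apply: measurable_sum => i; apply: measurable_funM => //.
by apply: (measurableT_comp (@measurable_tnth _ _ N i)).
Qed.

Lemma wave_sum_bounded l (T : R) : all_terms (fun f => continuous f) l ->
  exists M, forall t x, 0 <= t <= T -> `|wave_sum l t x| <= M.
Proof.
elim: l => [_|a l IH [ca lc]] /=.
  by exists 0 => t x _; rewrite wave_sum_nil normr0.
have [M lM] := IH lc.
have [K aK] := continuous_bounded_on 0 T ca.
exists (K + M) => t x tT; rewrite wave_sum_cons (le_trans (ler_normD _ _))// lerD ?lM//.
rewrite /wave normrM -[leRHS]mulr1 ler_pM ?aK// ler_norml.
by rewrite cos_geN1 cos_le1.
Qed.

End trigonometric_sums.

Lemma is_derive_line (R : realType) (V : normedModType R) (f : V -> R) (p v : V) (d : R) :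
  is_derive (0 : R) (1 : R) (fun h : R => f (h *: v + p)) d -> is_derive p v f d.
Proof.
have E : (fun h : R => h^-1 *: ((f \o shift p) (h *: v) - f p)) =
  (fun h : R => h^-1 *: (((fun h : R => f (h *: v + p)) \o shift (0 : R)) (h *: (1 : R)) - f ((0 : R) *: v + p))).
  apply/funext => h /=; rewrite scale0r add0r addr0; congr (_ *: (f (_ *: _ + _) - _)).
  by rewrite /GRing.scale/= mulr1.
by case; rewrite /derivable /derive -E => cf df; split.
Qed.

(** * Trigonometric sums as test functions *)

Section test_functions_of_sums.
Context (R : realType) (N : nat) (T : R).
Implicit Types (l : seq (term R N)) (p v : R * 'rV[R]_N).

Definition wave_sumR l p : R := wave_sum l p.1 (p.2 ord0).

(** [is_Ck] asks for derivatives in every space-time direction, and the product rule turns one term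
    into two. *)
Definition dirT v (a : term R N) : seq (term R N) :=
  [:: Term (fun t => v.1 * derive1 (tfun a) t) (tfreq a) (tphase a);
      Term (fun t => phase (tfreq a) (v.2 ord0) * tfun a t) (tfreq a) (tphase a + pi / 2)].

Definition dirS v l := flatten (map (dirT v) l).

Lemma smooth1_dirS v l : all_terms (@smooth1 R) l -> all_terms (@smooth1 R) (dirS v l).
Proof.
elim: l => //= a l IH [sa sl]; split; last split; last exact: IH.
- by apply: smooth1M; [exact: smooth1_cst|exact: smooth1_derive1].
- by apply: smooth1M; [exact: smooth1_cst|].
Qed.

Lemma is_derive_wave_sumR l p v : all_terms (@smooth1 R) l ->
  is_derive p v (wave_sumR l) (wave_sumR (dirS v l) p).
Proof.
move=> sl; apply: is_derive_line.
have E h : wave_sumR l (h *: v + p) =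
    wave_sum l (h * v.1 + p.1) (fun i => p.2 ord0 i + h * v.2 ord0 i).
  rewrite /wave_sumR; congr (wave_sum _ _ _); apply/funext => i.
  by rewrite /= !mxE addrC.
under eq_fun do rewrite E.
rewrite /wave_sumR /dirS; elim: l sl {E} => [_|a l IH [sa sl]] /=.
  by under eq_fun do rewrite wave_sum_nil; rewrite wave_sum_nil; exact: is_derive_cst.
under eq_fun do rewrite wave_sum_cons; rewrite !wave_sum_cons addrA.
apply: is_deriveD; last exact: IH.
have sf := smooth1_is_derive (0 * v.1 + p.1) sa.
have D : is_derive (0 : R) (1 : R) (fun h => h * v.1 + p.1) v.1.
  by apply: is_derive_eq; rewrite /GRing.scale/=; ring.
have Df := @is_derive1_comp _ (tfun a) (fun h => h * v.1 + p.1) 0 _ _ sf D.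
have Dc : is_derive (0 : R) (1 : R)
  (fun h => cos (phase (tfreq a) (fun i => p.2 ord0 i + h * v.2 ord0 i) + tphase a))
  (- phase (tfreq a) (v.2 ord0) * sin (phase (tfreq a) (p.2 ord0) + tphase a)).
  under eq_fun do rewrite phaseD phaseZ.
  by apply: is_derive_eq; rewrite /GRing.scale/= mul0r addr0; ring.
have := @is_deriveM _ _ _ _ _ _ _ _ Df Dc.
congr is_derive; rewrite /wave /GRing.scale/= phaseD phaseZ !mul0r add0r addr0 addrA.
by rewrite cosDpihalf; ring.
Qed.

Lemma derive_wave_sumR l v : all_terms (@smooth1 R) l -> 'D_v (wave_sumR l) = wave_sumR (dirS v l).
Proof. by move=> sl; apply/funext => p; case: (is_derive_wave_sumR p v sl). Qed.

Lemma continuous_wave_sumR l : all_terms (@smooth1 R) l -> continuous (wave_sumR l).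
Proof.
elim: l => [_|a l IH [sa sl]] p.
  rewrite /wave_sumR; under eq_fun do rewrite wave_sum_nil; exact: cvg_cst.
have E : wave_sumR (a :: l) = (fun q => wave a q.1 (q.2 ord0) + wave_sumR l q).
  by apply/funext => q; rewrite /wave_sumR wave_sum_cons.
rewrite E; apply: cvgD; last exact: IH.
apply: cvgM.
  apply: (continuous_comp (@cvg_fst _ _ _ _ _)); exact: smooth1_continuous.
apply: continuous_cvg; first exact: continuous_cos.
apply: cvgD; last exact: cvg_cst.
rewrite /phase; apply: cvg_big => [|i _]; first exact: add_continuous.
apply: cvgM; first exact: cvg_cst.
apply: (@continuous_comp _ _ _ snd (fun y : 'rV[R]_N => y ord0 i)); first exact: cvg_snd.
exact: coord_continuous.
Qed.

Lemma is_Ck_wave_sumR k l : all_terms (@smooth1 R) l -> is_Ck k (wave_sumR l).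
Proof.
elim: k l => [|k IH] l sl /=; first exact: continuous_wave_sumR.
split; first exact: continuous_wave_sumR.
move=> v; split; first by move=> p; case: (is_derive_wave_sumR p v sl).
by rewrite derive_wave_sumR//; apply: IH; exact: smooth1_dirS.
Qed.

Definition time_test (f : R -> R) :=
  smooth1 f /\ exists2 tau, tau < T & forall t, tau <= t -> f t = 0.

Definition test_terms l := all_terms time_test l.

Lemma all_test_smooth l : test_terms l -> all_terms (@smooth1 R) l.
Proof. by apply: all_terms_imp => f []. Qed.

Lemma test_wave_sumR l : test_terms l -> test_function T (wave_sumR l).
Proof.
move=> tl; have sl := all_test_smooth tl; split.
- by move=> k; exact: is_Ck_wave_sumR.
- move=> t x i; rewrite /wave_sumR/= -[RHS](wave_sum_periodic _ _ _ i); congr wave_sum.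
  by apply/funext => j; rewrite !mxE eqxx.
- elim: l tl {sl} => [_|a l IH [[_ [tau tT tau0]] /IH[tau' tT' tau0']]].
    by exists (T - 1); [lra|move=> t x _; rewrite /wave_sumR wave_sum_nil].
  exists (Num.max tau tau'); first by rewrite gt_max tT.
  move=> t x; rewrite ge_max => /andP[h h'].
  have := tau0' t x h'; rewrite /wave_sumR/= wave_sum_cons => ->.
  by rewrite /wave tau0// mul0r addr0.
Qed.

Lemma dt_wave_sumR l : all_terms (@smooth1 R) l -> dt (wave_sumR l) = wave_sumR (map (@dtT R N) l).
Proof.
move=> sl; rewrite /dt derive_wave_sumR//; apply/funext => p.
rewrite /wave_sumR /dirS; elim: l {sl} => [|a l IH] /=; first by rewrite !wave_sum_nil.
have p0 : phase (tfreq a) ((0 : 'rV[R]_N) ord0) = 0.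
  by rewrite /phase big1// => i _; rewrite mxE mulr0.
by rewrite !wave_sum_cons IH /wave/= mul1r p0 !mul0r add0r.
Qed.

Lemma dx_wave_sumR i l : all_terms (@smooth1 R) l -> dx i (wave_sumR l) = wave_sumR (map (dxT i) l).
Proof.
move=> sl; rewrite /dx derive_wave_sumR//; apply/funext => p.
rewrite /wave_sumR /dirS; elim: l {sl} => [|a l IH] /=; first by rewrite !wave_sum_nil.
rewrite !wave_sum_cons IH /wave/= !mul0r add0r; congr (_ * _ * _ + _).
rewrite -phase_delta; congr phase; apply/funext => j.
by rewrite mxE eqxx.
Qed.

Lemma smooth1_dxT i l : all_terms (@smooth1 R) l -> all_terms (@smooth1 R) (map (dxT i) l).
Proof. by apply: all_terms_map => a sa; apply: smooth1M => //; exact: smooth1_cst. Qed.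

Lemma laplacian_wave_sumR l : all_terms (@smooth1 R) l ->
  laplacian (wave_sumR l) = wave_sumR (map (@lapT R N) l).
Proof.
move=> sl; apply/funext => p; rewrite /laplacian /wave_sumR wave_sum_lapT.
by apply: eq_bigr => i _; rewrite dx_wave_sumR// dx_wave_sumR//; exact: smooth1_dxT.
Qed.

Lemma wave_sumR_row l t (x : N.-tuple R) : wave_sumR l (t, row_of x) = wave_sumQ l (t, x).
Proof.
by rewrite /wave_sumR /wave_sumQ /=; congr wave_sum; apply/funext => i; rewrite mxE.
Qed.

Lemma test_terms_end l (x : N.-tuple R) : test_terms l -> wave_sumQ l (T, x) = 0.
Proof.
rewrite /wave_sumQ/=; elim: l => [|a m IH] /=; first by rewrite wave_sum_nil.
move=> [[_ [tau tT h]] /IH]; rewrite wave_sum_cons => ->.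
by rewrite /wave h ?ltW// mul0r addr0.
Qed.

Lemma test_terms_dxT i l : test_terms l -> test_terms (map (dxT i) l).
Proof.
apply: all_terms_map => a [sa [tau tT h]]; split.
  by apply: smooth1M => //; exact: smooth1_cst.
by exists tau => // t /h /= ->; rewrite mulr0.
Qed.

End test_functions_of_sums.

Section closure_sets.
Context d (X : measurableType d) (R : realType) (mu : {measure set X -> \bar R}).
Variables (rho : X -> R) (V : (X -> R) -> Prop).
Hypothesis rho_ge0 : forall x, 0 <= rho x.
Hypothesis rho_rintegrable : rintegrable mu rho.
Hypothesis V_bdd : forall f, V f -> ae_bdd mu f.
Hypothesis V1 : V (fun=> 1).
Hypothesis VZ : forall k f, V f -> V (fun x => k * f x).
Hypothesis VD : forall f g, V f -> V g -> V (fun x => f x + g x).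
Hypothesis VM : forall f g, V f -> V g -> V (fun x => f x * g x).

(** The constant sequence converges almost everywhere to the modified indicator. Needed because
    half-spaces of the torus are obtained only up to null sets. *)
Lemma wclosure_set_ae A B : wclosure_set mu rho V A -> measurable B ->
  {ae mu, forall x, A x <-> B x} -> wclosure_set mu rho V B.
Proof.
move=> [mA cA] mB AB; split => //.
apply: (@wclosure_lim _ _ _ _ _ _ rho_ge0 rho_rintegrable V_bdd (fun=> \1_A) _ 1) => //.
- exact: ae_bdd_indic.
- apply: aeW => x n; rewrite indicE ger0_norm// lern1; exact: leq_b1.
- apply: filterS AB => x AB.
  have -> : \1_B x = \1_A x :> R.
    by rewrite !indicE; congr (nat_of_bool _)%:R; apply/idP/idP; rewrite !inE => /AB.
  exact: cvg_cst.
Qed.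

Lemma wclosure_set_preimage d' (Y : measurableType d') (phi : X -> Y) (G : set (set Y)) :
  (@measurable _ Y `<=` <<s G >>) -> (forall A, G A -> wclosure_set mu rho V (phi @^-1` A)) ->
  forall A, measurable A -> wclosure_set mu rho V (phi @^-1` A).
Proof.
move=> mG hG A /mG; move: A; apply: smallest_sub; last exact: hG.
split.
- by rewrite preimage_set0; exact: wclosure_set0.
- by move=> A cA; rewrite setTD preimage_setC; exact: wclosure_setC.
- by move=> F cF; rewrite preimage_bigcup; exact: wclosure_set_bigcup.
Qed.

Lemma wclosure_set_preimage_real (phi : X -> R) :
  (forall a, wclosure_set mu rho V [set x | a < phi x]) ->
  forall A, measurable A -> wclosure_set mu rho V (phi @^-1` A).
Proof.
move=> h; apply: (@wclosure_set_preimage _ R phi (@RGenOInfty.G R)).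
  move=> A mA; have E := RGenOInfty.measurableE R.
  by change ((@RGenOInfty.G R).-sigma.-measurable A); rewrite -E; exact: mA.
move=> A [a ->]; have := h a; congr (wclosure_set _ _ _).
by apply/seteqP; split => x /=; rewrite in_itv/= andbT.
Qed.

End closure_sets.

(** * Density of trigonometric sums with exponential time factors *)

Section exponential_sums.
Context (R : realType) (N : nat) (T : R).
Local Notation X := (R * N.-tuple R)%type.
Local Notation Q := (QT_measure T N).

(** This class is stable under products, separates times, and makes the differential equation of
    each Fourier mode explicitly solvable. The sums built on it serve as right-hand sides and inside
    coefficients, not as test functions: a nonzero exponential does not vanish near [T]. *)
Definition exponential (f : R -> R) := exists c b, f = fun t => c * expR (b * t).

Lemma exponential_smooth f : exponential f -> smooth1 f.
Proof.
by move=> [c [b ->]]; apply: smooth1M; [exact: smooth1_cst|exact: smooth1_exp].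
Qed.

Lemma exponentialM f g : exponential f -> exponential g ->
  exponential (fun t => f t * g t).
Proof.
move=> [c [b ->]] [c' [b' ->]]; exists (c * c'), (b + b').
by apply/funext => t; rewrite mulrDl expRD; ring.
Qed.

Lemma exponentialZ k f : exponential f -> exponential (fun t => k * f t).
Proof. by move=> [c [b ->]]; exists (k * c), b; apply/funext => t; rewrite mulrA. Qed.

Definition exp_wave_sum (v : X -> R) := exists2 l : seq (term R N),
  all_terms exponential l & v = wave_sumQ l.

Lemma all_exponential_continuous (l : seq (term R N)) : all_terms exponential l ->
  all_terms (fun f => continuous f) l.
Proof.
by apply: all_terms_imp => f /exponential_smooth; exact: smooth1_continuous.
Qed.

Lemma wave_sumQ_bdd (l : seq (term R N)) : all_terms (fun f => continuous f) l ->
  ae_bdd Q (wave_sumQ l).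
Proof.
move=> lc; split; first exact: measurable_wave_sumQ.
have [M hM] := wave_sum_bounded T lc; exists M; apply: QT_ae_time => t x /andP[t0 tT].
by apply: hM; rewrite t0 ltW.
Qed.

Lemma exp_wave_sum_bdd v : exp_wave_sum v -> ae_bdd Q v.
Proof. by move=> [l el ->]; exact/wave_sumQ_bdd/all_exponential_continuous. Qed.

Lemma exp_wave_sum_1 : exp_wave_sum (fun=> 1).
Proof.
exists [:: Term (fun t => 1 * expR (0 * t)) (fun=> 0) 0].
  by split => //; exists 1, 0.
apply/funext => p; rewrite /wave_sumQ wave_sum_cons wave_sum_nil /wave/= mul0r expR0 mul1r mul1r.
by rewrite /phase big1 ?add0r ?cos0 ?addr0// => i _; rewrite mulr0 mul0r.
Qed.

Lemma exp_wave_sum_Z k v : exp_wave_sum v -> exp_wave_sum (fun p => k * v p).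
Proof.
move=> [l el ->]; exists (map (mulT (fun=> k)) l).
  by apply: all_terms_map el => a; exact: exponentialZ.
by apply/funext => p; rewrite /wave_sumQ wave_sum_mulT.
Qed.

Lemma exp_wave_sum_D v w : exp_wave_sum v -> exp_wave_sum w -> exp_wave_sum (fun p => v p + w p).
Proof.
move=> [l el ->] [m em ->]; exists (l ++ m); first exact: all_terms_cat.
by apply/funext => p; rewrite /wave_sumQ wave_sum_cat.
Qed.

(** The product-to-sum formula for two cosines, which makes the sums an algebra. *)
Definition prodT (a b : term R N) : seq (term R N) :=
  [:: Term (fun t => 2^-1 * (tfun a t * tfun b t))
        (fun i => tfreq a i + tfreq b i) (tphase a + tphase b);
      Term (fun t => 2^-1 * (tfun a t * tfun b t))
        (fun i => tfreq a i - tfreq b i) (tphase a - tphase b)].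

Lemma wave_sum_prodT a b t (x : 'I_N -> R) : wave_sum (prodT a b) t x = wave a t x * wave b t x.
Proof.
rewrite !wave_sum_cons wave_sum_nil addr0 /wave/=.
have -> : phase (fun i => tfreq a i + tfreq b i) x + (tphase a + tphase b) =
  (phase (tfreq a) x + tphase a) + (phase (tfreq b) x + tphase b).
  rewrite addrACA; congr (_ + _); rewrite /phase -big_split/=; apply: eq_bigr => i _.
  by rewrite rmorphD/=; ring.
have -> : phase (fun i => tfreq a i - tfreq b i) x + (tphase a - tphase b) =
  (phase (tfreq a) x + tphase a) - (phase (tfreq b) x + tphase b).
  rewrite opprD addrACA; congr (_ + _); rewrite /phase -sumrB; apply: eq_bigr => i _.
  by rewrite rmorphB/=; ring.
by rewrite cosB cosD; field.
Qed.

Lemma exp_wave_sum_M v w : exp_wave_sum v -> exp_wave_sum w -> exp_wave_sum (fun p => v p * w p).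
Proof.
move=> [l el ->] [m em ->]; elim: l el => [_|a l IH [ea el]].
  by exists [::] => //; apply/funext => p; rewrite /wave_sumQ !wave_sum_nil mul0r.
have [n en En] := IH el.
exists (flatten (map (prodT a) m) ++ n).
  apply: all_terms_cat => //; elim: m em {En IH} => //= b m IHm [eb em].
  have e2 : exponential (fun t => 2^-1 * (tfun a t * tfun b t)).
    by apply: exponentialZ; exact: exponentialM.
  by split => //; split => //; exact: IHm.
apply/funext => p; rewrite /wave_sumQ wave_sum_cat wave_sum_cons mulrDl.
move/(congr1 (fun f => f p)): En; rewrite /wave_sumQ => ->; congr (_ + _).
elim: m {em IH} => [|b m IHm]; first by rewrite /= !wave_sum_nil mulr0.
by rewrite -[flatten _]/(prodT a b ++ flatten (map (prodT a) m)) wave_sum_cat wave_sum_prodT wave_sum_cons mulrDr IHm.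
Qed.

Section generation.
Variable rho : X -> R.
Hypothesis rho_ge0 : forall p, 0 <= rho p.
Hypothesis rho_rintegrable : rintegrable Q rho.
Local Notation clV := (wclosure_set Q rho exp_wave_sum).

Let wclosure_set_lt' := @wclosure_set_lt _ _ _ Q rho exp_wave_sum rho_ge0 rho_rintegrable exp_wave_sum_bdd exp_wave_sum_1 exp_wave_sum_Z exp_wave_sum_D exp_wave_sum_M.
Let wclosure_set_ae' := @wclosure_set_ae _ _ _ Q rho exp_wave_sum rho_ge0 rho_rintegrable exp_wave_sum_bdd.
Let wclosure_set0' := @wclosure_set0 _ _ _ Q rho exp_wave_sum exp_wave_sum_bdd exp_wave_sum_1 exp_wave_sum_Z.
Let wclosure_setC' := @wclosure_setC _ _ _ Q rho exp_wave_sum rho_ge0 rho_rintegrable exp_wave_sum_bdd exp_wave_sum_1 exp_wave_sum_Z exp_wave_sum_D exp_wave_sum_M.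
Let wclosure_setI' := @wclosure_setI _ _ _ Q rho exp_wave_sum rho_ge0 rho_rintegrable exp_wave_sum_bdd exp_wave_sum_M.
Let wclosure_set_bigcup' := @wclosure_set_bigcup _ _ _ Q rho exp_wave_sum rho_ge0 rho_rintegrable exp_wave_sum_bdd exp_wave_sum_1 exp_wave_sum_Z exp_wave_sum_D exp_wave_sum_M.

(** As [exp (- t)] is strictly decreasing, the half-line is a sublevel set of a single term of
    frequency 0. *)
Lemma exp_wave_sum_time a : clV [set p | a < p.1].
Proof.
pose v := wave_sumQ [:: @Term R N (fun t => 1 * expR (-1 * t)) (fun=> 0) 0].
have Vv : exp_wave_sum v by eexists; last reflexivity; split => //; exists 1, (-1).
have := @wclosure_set_lt' v (expR (- a)) Vv.
congr (wclosure_set _ _ _ _); apply/seteqP.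
have E p : v p = expR (- p.1).
  rewrite /v /wave_sumQ wave_sum_cons wave_sum_nil /wave/= mul1r mulN1r.
  rewrite /phase big1 ?add0r ?cos0 ?addr0 ?mulr1// => i _; by rewrite mulr0 mul0r.
by split => p /=; rewrite E ltr_expR ltrN2.
Qed.

(** A coordinate is not a periodic function, so the half-space is recovered, up to a null set, as a
    sublevel set of one cosine. Levels outside [0, 1[ give the whole space or the empty set. *)
Lemma exp_wave_sum_space i a : clV [set p | a < tnth p.2 i].
Proof.
have mA : measurable [set p : X | a < tnth p.2 i].
  rewrite -[X in measurable X]setTI; apply: measurable_fun_ltr => //.
  by apply: (measurableT_comp (@measurable_tnth _ _ N i)).
have [a0|a0] := ltP a 0.
  apply: (@wclosure_set_ae' setT) => //.
    by rewrite -setC0; exact: wclosure_setC' wclosure_set0'.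
  apply: QT_ae => t x _ x01; split => // _ /=.
  by have /andP[x0 _] := x01 i; exact: lt_le_trans x0.
have [a1|a1] := leP 1 a.
  apply: (@wclosure_set_ae' set0) => //.
  apply: QT_ae => t x _ x01; split => //= ax.
  by have /andP[_ x1] := x01 i; move: (lt_le_trans (lt_trans ax x1) a1); rewrite ltxx.
(* The cosine peaks at [(1 + a) / 2], the midpoint of the arc from [a] to 1, and takes the value
   [cos (pi (1 - a))] at both ends of it. *)
pose v := wave_sumQ [:: @Term R N (fun t => -1 * expR (0 * t)) (fun j => (j == i)%:R)
  (- (pi * (1 + a)))].
have Vv : exp_wave_sum v by eexists; last reflexivity; split => //; exists (-1), 0.
apply: (@wclosure_set_ae' [set p | v p < - cos (pi * (1 - a))]) => //.
  exact: wclosure_set_lt'.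
apply: QT_ae => t x _ /(_ i); set s := tnth x i => /andP[s0 s1] /=; rewrite -/s.
(* On [0 <= s < 1] the condition [a < s] defines an arc of the circle, via
   [cos (A - B) - cos (A + B) = 2 sin A sin B] with [A = pi (s - a)] and
   [B = pi (1 - s)]. *)
have -> : v (t, x) = - cos (pi * (s - a) - pi * (1 - s)).
  rewrite /v /wave_sumQ wave_sum_cons wave_sum_nil /wave/= mul0r expR0 addr0 mulr1 mulN1r.
  congr (- cos _); rewrite /phase (bigD1 i)//= eqxx big1 ?addr0.
    by rewrite -/s /= (_ : 1%:~R = 1 :> R)//; ring.
  by move=> j /negPf ->; rewrite mulr0 mul0r.
rewrite (_ : pi * (1 - a) = pi * (s - a) + pi * (1 - s)); last by ring.
rewrite ltrN2 cosB cosD ltrD2l.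
have pi0 := pi_gt0 R.
have [->|s0'] := eqVneq s 0.
  by rewrite subr0 mulr1 sinpi mulr0 oppr0 ltxx; split => // h; move: (lt_le_trans h a0); rewrite ltxx.
have sB : 0 < sin (pi * (1 - s)).
  apply: sin_gt0_pi; rewrite mulr_gt0 ?subr_gt0//= gtr_pMr//.
  by have : 0 < s by [rewrite lt_neqAle eq_sym s0']; lra.
have -> : (- (sin (pi * (s - a)) * sin (pi * (1 - s))) <
     sin (pi * (s - a)) * sin (pi * (1 - s))) = (0 < sin (pi * (s - a))).
  rewrite -subr_gt0 opprK -mulr2n pmulrn_lgt0// pmulr_lgt0//.
have [as_|sa|sa] := ltrgtP a s.
- split => // _; apply: sin_gt0_pi; rewrite mulr_gt0 ?subr_gt0//= gtr_pMr//; lra.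
- split => //; rewrite -[s - a]opprB mulrN sinN oppr_gt0 => h.
  have : 0 < sin (pi * (a - s)).
    by apply: sin_gt0_pi; rewrite mulr_gt0 ?subr_gt0//= gtr_pMr//; lra.
  by rewrite ltNge (ltW h).
- by rewrite sa subrr mulr0 sin0 ltxx.
Qed.

(** Rectangles generate the product sigma-algebra, coordinates that of tuples, and open half-lines
    that of the reals; each stage uses that approximable sets form a sigma-algebra. *)
Lemma exp_wave_sum_measurable A : measurable A -> clV A.
Proof.
have pre := @wclosure_set_preimage _ _ _ Q rho exp_wave_sum rho_ge0 rho_rintegrable exp_wave_sum_bdd exp_wave_sum_1 exp_wave_sum_Z exp_wave_sum_D exp_wave_sum_M.
have preR := @wclosure_set_preimage_real _ _ _ Q rho exp_wave_sum rho_ge0 rho_rintegrable exp_wave_sum_bdd exp_wave_sum_1 exp_wave_sum_Z exp_wave_sum_D exp_wave_sum_M.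
have c1 B : measurable B -> clV (fst @^-1` B) by apply: preR; exact: exp_wave_sum_time.
have ci i B : measurable B -> clV ((fun p : X => tnth p.2 i) @^-1` B).
  by apply: preR; exact: exp_wave_sum_space.
have c2 B : measurable B -> clV (snd @^-1` B).
  apply: (pre _ _ snd (\big[setU/set0]_(i < N) preimage_set_system setT
      (fun x => @tnth N R x i) measurable)) => //.
  move=> C; rewrite -bigcup_seq/= => -[i _ [D mD <-]].
  by rewrite setTI; exact: ci.
rewrite measurable_prod_measurableType; move: A; apply: smallest_sub.
  split.
  - exact: wclosure_set0'.
  - by move=> A cA; rewrite setTD; exact: wclosure_setC'.
  - by move=> F cF; exact: wclosure_set_bigcup'.
move=> _ [B mB [C mC <-]].
by rewrite -[B `*` C]/(fst @^-1` B `&` snd @^-1` C); apply: wclosure_setI'; [exact: c1|exact: c2].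
Qed.

Lemma exp_wave_sum_dense f : ae_bdd Q f -> wclosure Q rho exp_wave_sum f.
Proof.
exact: (@wclosure_bounded _ _ _ Q rho exp_wave_sum rho_ge0 rho_rintegrable exp_wave_sum_bdd exp_wave_sum_1 exp_wave_sum_Z exp_wave_sum_D exp_wave_sum_M (@exp_wave_sum_measurable)).
Qed.

End generation.

End exponential_sums.

(** * Integration by parts *)

Section tame_functions.
Context (R : realType) (N : nat) (T : R).
Local Notation X := (R * N.-tuple R)%type.
Local Notation Q := (QT_measure T N).
Implicit Types (h g : X -> R) (l : seq (term R N)).

(** What integration by parts consumes: continuity along time and along each coordinate separately,
    and a bound on the closed interval [0, T], since traces at both ends are integrated over the
    torus. *)
Record tame h : Prop := Tame {
  tame_measurable : measurable_fun setT h;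
  tame_bounded : exists M, forall t x, 0 <= t <= T -> `|h (t, x)| <= M;
  tame_time : forall x, continuous (fun t => h (t, x));
  tame_space : forall t x i, continuous (fun s => h (t, upd x i s)) }.

Lemma tameD h g : tame h -> tame g -> tame (fun p => h p + g p).
Proof.
move=> [mh [M hM] th sh] [mg [K gK] tg sg]; split.
- exact: measurable_funD.
- exists (M + K) => t x tT; rewrite (le_trans (ler_normD _ _))// lerD//; [exact: hM|exact: gK].
- by move=> x t; apply: cvgD; [exact: th|exact: tg].
- by move=> t x i s; apply: cvgD; [exact: sh|exact: sg].
Qed.

Lemma tameM h g : tame h -> tame g -> tame (fun p => h p * g p).
Proof.
move=> [mh [M hM] th sh] [mg [K gK] tg sg]; split.
- exact: measurable_funM.
- exists (M * K) => t x tT; rewrite normrM ler_pM//; [exact: hM|exact: gK].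
- by move=> x t; apply: cvgM; [exact: th|exact: tg].
- by move=> t x i s; apply: cvgM; [exact: sh|exact: sg].
Qed.

Lemma tame_comp (f : R -> R) h : continuous f -> tame h -> tame (fun p => f (h p)).
Proof.
move=> cf [mh [M hM] th sh]; split.
- by apply: measurableT_comp => //; exact: continuous_measurable_fun.
- have [K fK] := continuous_bounded_on (- M) M cf.
  by exists K => t x tT; apply: fK; rewrite -ler_norml hM.
- by move=> x t; apply: (@continuous_comp _ _ _ (fun t => h (t, x)) f); [exact: th|exact: cf].
- by move=> t x i s; apply: (@continuous_comp _ _ _ (fun s => h (t, upd x i s)) f); [exact: sh|exact: cf].
Qed.

Lemma tame_fun_time (f : R -> R) : continuous f -> tame (fun p => f p.1).
Proof.
move=> cf; split.
- by apply: (measurableT_comp (continuous_measurable_fun cf)).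
- have [K fK] := continuous_bounded_on 0 T cf.
  by exists K => t x tT; exact: fK.
- by move=> x; exact: cf.
- by move=> t x i s /=; apply: cst_continuous.
Qed.

Lemma tame_cst (c : R) : tame (fun=> c).
Proof. by apply: (@tame_fun_time (fun=> c)); exact: cst_continuous. Qed.

Lemma tameZ k h : tame h -> tame (fun p => k * h p).
Proof. by apply: tameM; exact: tame_cst. Qed.

Lemma tameN h : tame h -> tame (fun p => - h p).
Proof. by move=> /(tameZ (-1)); under eq_fun do rewrite mulN1r. Qed.

Lemma tame_rintegrable h : tame h -> rintegrable Q h.
Proof.
move=> [mh [M hM] _ _]; apply: (QT_bounded_rintegrable (M := M)) => // t x /andP[t0 tT].
by apply: hM; rewrite t0 ltW.
Qed.

Lemma tame_sq_integrable h : tame h -> sq_integrable Q h.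
Proof.
move=> [mh [M hM] _ _]; apply: (QT_bounded_sq_integrable (M := M)) => // t x /andP[t0 tT].
by apply: hM; rewrite t0 ltW.
Qed.

Lemma tame_wave_sumQ l : all_terms (@smooth1 R) l -> tame (wave_sumQ l).
Proof.
move=> sl; have cl : all_terms (fun f => continuous f) l.
  by apply: all_terms_imp sl => f; exact: smooth1_continuous.
split.
- exact: measurable_wave_sumQ.
- by have [M hM] := wave_sum_bounded T cl; exists M => t x; exact: hM.
- move=> x t; apply/differentiable_continuous/derivable1_diffP.
  by case: (is_derive_wave_sum_time (tnth x) t sl).
- move=> t x i s; apply/differentiable_continuous/derivable1_diffP.
  by case: (is_derive_wave_sum_upd l t x i s).
Qed.

Lemma tame_torus h t : tame h -> 0 <= t <= T ->
  sq_integrable (torus_measure R N) (fun x => h (t, x)).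
Proof.
move=> [mh [M hM] _ _] tT.
have mt : measurable_fun setT (fun x => h (t, x)).
  exact: (measurableT_comp mh (pair1_measurable t)).
split => //; apply: (bounded_rintegrable (M := M ^+ 2)) (torus_fin R N) _ _.
  exact: measurable_funX.
apply: aeW => x; rewrite normrX lerXn2r ?nnegrE//; last exact: hM.
exact: le_trans (hM t x tT).
Qed.

(** By periodicity each slice integrates to 0. The slicing lemma yields one sign only, so it is
    applied to [f] and to [- f]. *)
Lemma Rint_QT_space_derivative F f (i : 'I_N) : tame f ->
  (forall t x s, is_derive s (1 : R) (fun s : R => F (t, upd x i s)) (f (t, upd x i s))) ->
  (forall t x, F (t, upd x i 1) = F (t, upd x i 0)) ->
  \int[Q]_p f p = 0.
Proof.
have aux (F1 f1 : X -> R) : tame f1 ->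
    (forall t x s, is_derive s (1 : R) (fun s : R => F1 (t, upd x i s)) (f1 (t, upd x i s))) ->
    (forall t x, F1 (t, upd x i 1) = F1 (t, upd x i 0)) ->
    \int[Q]_p f1 p <= 0.
  move=> tf dF pF; apply: (Rint_QT_space_le0 (i := i)).
  - exact: tame_rintegrable.
  - move=> t /andP[t0 tT]; have [M hM] := tame_bounded tf; exists M => x.
    by apply: hM; rewrite t0 ltW.
  - move=> t x _; rewrite (Rint_derivative ltr01 (dF t x)) ?pF ?subrr//.
    exact: (tame_space tf).
move=> tf dF pF; apply/eqP; rewrite eq_le (aux F)//=.
have := aux (fun p => - F p) (fun p => - f p) (tameN tf).
have -> : \int[Q]_p - f p = - \int[Q]_p f p.
  rewrite -mulN1r -RintegralZl//; last exact: tame_rintegrable.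
  by under [RHS]eq_Rintegral do rewrite mulN1r.
rewrite oppr_le0; apply; last by move=> t x; rewrite pF.
Qed.

Lemma Rint_QT_time F f : 0 < T -> tame f ->
  (forall x t, is_derive t (1 : R) (fun s : R => F (s, x)) (f (t, x))) ->
  \int[Q]_p f p = \int[torus_measure R N]_x (F (T, x) - F (0, x)).
Proof.
move=> T0 tf dF; have [M hM] := tame_bounded tf.
apply: (Rint_QT_time_derivative (M := M)) => //.
- exact: tame_measurable tf.
- by move=> t x /andP[t0 tT]; apply: hM; rewrite t0 ltW.
- exact: (tame_time tf).
Qed.

Lemma smooth1_map_dtT l : all_terms (@smooth1 R) l ->
  all_terms (@smooth1 R) (map (@dtT R N) l).
Proof. by apply: all_terms_map => a; exact: smooth1_derive1. Qed.

Lemma smooth1_map_lapT l : all_terms (@smooth1 R) l ->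
  all_terms (@smooth1 R) (map (@lapT R N) l).
Proof. by apply: all_terms_map => a sa; apply: smooth1M => //; exact: smooth1_cst. Qed.

Lemma wave_sum_dtT_dxT l i t (x : 'I_N -> R) : all_terms (@smooth1 R) l ->
  wave_sum (map (@dtT R N) (map (dxT i) l)) t x = wave_sum (map (dxT i) (map (@dtT R N) l)) t x.
Proof.
elim: l => [//|a l IH [sa sl]] /=; rewrite !wave_sum_cons IH//; congr (_ + _).
rewrite /wave/=; congr (_ * _).
have Df := smooth1_is_derive t sa.
have D : is_derive t (1 : R) (fun t => 2 * pi * (tfreq a i)%:~R * tfun a t)
  (2 * pi * (tfreq a i)%:~R * derive1 (tfun a) t).
  by apply: is_derive_eq; rewrite /GRing.scale/=; ring.
by rewrite derive1E; case: D.
Qed.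

(** Integrating by parts in space and then in time, each direction contributes minus half the
    increment of the squared norm of [d_i phi] between 0 and [T]. The end value vanishes, so what
    remains is half the squared norm at time 0. *)
Lemma Rint_dt_lap_ge0 l : 0 < T -> test_terms T l ->
  0 <= \int[Q]_p (wave_sumQ (map (@dtT R N) l) p * wave_sumQ (map (@lapT R N) l) p).
Proof.
move=> T0 tl; have sl := all_test_smooth tl.
have tdt : tame (wave_sumQ (map (@dtT R N) l)) by exact/tame_wave_sumQ/smooth1_map_dtT.
have H i : 0 <= \int[Q]_p (wave_sumQ (map (@dtT R N) l) p * wave_sumQ (map (dxT i) (map (dxT i) l)) p).
  have sx := smooth1_dxT i sl.
  have tx : tame (wave_sumQ (map (dxT i) l)) by exact: tame_wave_sumQ.
  have txx : tame (wave_sumQ (map (dxT i) (map (dxT i) l))) by exact/tame_wave_sumQ/smooth1_dxT.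
  have ttx : tame (wave_sumQ (map (dxT i) (map (@dtT R N) l))).
    exact/tame_wave_sumQ/smooth1_dxT/smooth1_map_dtT.
  have S : \int[Q]_p (wave_sumQ (map (@dtT R N) l) p * wave_sumQ (map (dxT i) (map (dxT i) l)) p +
      wave_sumQ (map (dxT i) (map (@dtT R N) l)) p * wave_sumQ (map (dxT i) l) p) = 0.
    apply: (@Rint_QT_space_derivative
      (fun p => wave_sumQ (map (@dtT R N) l) p * wave_sumQ (map (dxT i) l) p) _ i).
    - by apply: tameD; exact: tameM.
    - move=> t x s.
      have D1 := is_derive_wave_sum_upd (map (@dtT R N) l) t x i s.
      have D2 := is_derive_wave_sum_upd (map (dxT i) l) t x i s.
      have := @is_deriveM _ _ _ _ _ _ _ _ D1 D2.
      by congr is_derive; rewrite /GRing.scale/= /wave_sumQ/=; ring.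
    - by move=> t x; rewrite /wave_sumQ/= !(wave_sum_upd10 _ t x i).
  have E : \int[Q]_p (wave_sumQ (map (dxT i) (map (@dtT R N) l)) p * wave_sumQ (map (dxT i) l) p) <= 0.
    have D0 x t : is_derive t (1 : R)
        (fun s => 2^-1 * wave_sumQ (map (dxT i) l) (s, x) ^+ 2)
        (wave_sumQ (map (dxT i) (map (@dtT R N) l)) (t, x) * wave_sumQ (map (dxT i) l) (t, x)).
      have D := is_derive_wave_sum_time (tnth x) t sx.
      rewrite /wave_sumQ/=; apply: is_derive_eq.
      by rewrite /GRing.scale/= wave_sum_dtT_dxT//; field.
    have := @Rint_QT_time (fun p => 2^-1 * wave_sumQ (map (dxT i) l) p ^+ 2) _ T0 (tameM ttx tx) D0; rewrite /= => ->.
    apply: Rintegral_le0 => x.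
    rewrite (test_terms_end x (test_terms_dxT i tl)).
    rewrite expr0n/= mulr0 sub0r oppr_le0 mulr_ge0 ?sqr_ge0// invr_ge0//.
  move: S; rewrite RintegralD//; [|by apply: tame_rintegrable; exact: tameM..].
  by move=> /eqP; rewrite addr_eq0 => /eqP ->; rewrite oppr_ge0.
have tam i : tame (fun p => wave_sumQ (map (@dtT R N) l) p * wave_sumQ (map (dxT i) (map (dxT i) l)) p).
  by apply: tameM => //; apply: tame_wave_sumQ; do 2 apply: smooth1_dxT.
have K (r : seq 'I_N) : tame (fun p => \sum_(i <- r)
      wave_sumQ (map (@dtT R N) l) p * wave_sumQ (map (dxT i) (map (dxT i) l)) p) /\
    0 <= \int[Q]_p \sum_(i <- r)
      wave_sumQ (map (@dtT R N) l) p * wave_sumQ (map (dxT i) (map (dxT i) l)) p.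
  elim: r => [|i r [IH1 IH2]].
    split; first by under eq_fun do rewrite big_nil; exact: tame_cst.
    by under eq_Rintegral do rewrite big_nil; exact: Rintegral_ge0.
  split; first by under eq_fun do rewrite big_cons; exact: tameD.
  under eq_Rintegral do rewrite big_cons.
  by rewrite RintegralD ?addr_ge0//; exact: tame_rintegrable.
have [_] := K (index_enum 'I_N).
by under eq_Rintegral do rewrite -mulr_sumr -wave_sum_lapT.
Qed.

End tame_functions.

(** * Density of the range of the parabolic operator *)

Section parabolic_range.
Context (R : realType) (N : nat) (T : R).
Hypothesis T0 : 0 < T.
Local Notation X := (R * N.-tuple R)%type.
Local Notation Q := (QT_measure T N).
Implicit Types (m S : X -> R) (l : seq (term R N)).

Definition dtQ l := wave_sumQ (map (@dtT R N) l).
Definition lapQ l := wave_sumQ (map (@lapT R N) l).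
Definition parabolic m l (p : X) := dtQ l p + m p * lapQ l p.

Lemma dtQ_cat l l' p : dtQ (l ++ l') p = dtQ l p + dtQ l' p.
Proof. by rewrite /dtQ map_cat /wave_sumQ wave_sum_cat. Qed.

Lemma lapQ_cat l l' p : lapQ (l ++ l') p = lapQ l p + lapQ l' p.
Proof. by rewrite /lapQ map_cat /wave_sumQ wave_sum_cat. Qed.

Lemma parabolic_cat m l l' p : parabolic m (l ++ l') p = parabolic m l p + parabolic m l' p.
Proof. by rewrite /parabolic dtQ_cat lapQ_cat; ring. Qed.

Lemma tame_dtQ l : test_terms T l -> tame T (dtQ l).
Proof. by move=> /all_test_smooth ?; exact/tame_wave_sumQ/smooth1_map_dtT. Qed.

Lemma tame_lapQ l : test_terms T l -> tame T (lapQ l).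
Proof. by move=> /all_test_smooth ?; exact/tame_wave_sumQ/smooth1_map_lapT. Qed.

Lemma sq_integrable_parabolic m l : ae_bdd Q m -> test_terms T l -> sq_integrable Q (parabolic m l).
Proof.
move=> [mm [M mM]] tl; apply: sq_integrableD; first exact/tame_sq_integrable/tame_dtQ.
by apply: (sq_integrable_bddM mm mM); exact/tame_sq_integrable/tame_lapQ.
Qed.

Lemma Rint_lap_le_heat c l : 0 <= c -> test_terms T l ->
  c ^+ 2 * \int[Q]_p lapQ l p ^+ 2 <= \int[Q]_p parabolic (fun=> c) l p ^+ 2.
Proof.
move=> c0 tl; have td := tame_dtQ tl; have tp := tame_lapQ tl.
have i1 := tame_rintegrable (tameM td td); have i2 := tame_rintegrable (tameM td tp).
have i3 := tame_rintegrable (tameM tp tp).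
have -> : \int[Q]_p parabolic (fun=> c) l p ^+ 2 =
  \int[Q]_p (dtQ l p * dtQ l p) + (2 * c * \int[Q]_p (dtQ l p * lapQ l p) +
  c ^+ 2 * \int[Q]_p (lapQ l p * lapQ l p)).
  have j2 := rintegrableZ (2 * c) i2; have j3 := rintegrableZ (c ^+ 2) i3.
  have j23 := rintegrableD j2 j3.
  rewrite -!RintegralZl// -RintegralD// -RintegralD//.
  by apply: eq_Rintegral => p _; rewrite /parabolic; ring.
have -> : \int[Q]_p lapQ l p ^+ 2 = \int[Q]_p (lapQ l p * lapQ l p).
  by apply: eq_Rintegral => p _; rewrite expr2.
rewrite addrA lerDr addr_ge0//.
  by under eq_Rintegral do rewrite -expr2; exact: Rint_sqr_ge0.
by rewrite mulr_ge0// ?mulr_ge0//; exact: Rint_dt_lap_ge0.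
Qed.

(** Pairing the operator with [lapQ l] bounds [al |lapQ|^2] from above. Young's weight [2 / al]
    leaves [(al / 2) |lapQ|^2] to be absorbed. The resulting constant depends on [al] alone, which
    is decisive when [m] varies. *)
Lemma Rint_lap_le m l al : ae_bdd Q m -> 0 < al -> {ae Q, forall p, al <= m p} ->
  test_terms T l ->
  \int[Q]_p lapQ l p ^+ 2 <= 4 / al ^+ 2 * \int[Q]_p parabolic m l p ^+ 2.
Proof.
move=> bm al0 alm tl; have td := tame_dtQ tl; have tp := tame_lapQ tl.
have sp := sq_integrable_parabolic bm tl; have sl := tame_sq_integrable tp.
have [mm [M mM]] := bm.
have im := sq_integrable_mul (sq_integrable_bddM mm mM sl) sl.
have i2 := tame_rintegrable (tameM td tp).
have h1 : al * \int[Q]_p lapQ l p ^+ 2 <= \int[Q]_p (m p * lapQ l p * lapQ l p).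
  have [_ is2] := sl; rewrite -RintegralZl//; apply: Rint_ae_le => //.
    exact: rintegrableZ.
  by apply: QT_aeS alm => p h; rewrite -mulrA -expr2 ler_wpM2r ?sqr_ge0.
have h2 : \int[Q]_p (parabolic m l p * lapQ l p) =
    \int[Q]_p (dtQ l p * lapQ l p) + \int[Q]_p (m p * lapQ l p * lapQ l p).
  rewrite -RintegralD//; apply: eq_Rintegral => p _; rewrite /parabolic; ring.
have h3 := Rint_dt_lap_ge0 T0 tl.
have e0 : 0 < 2 / al by rewrite divr_gt0.
have := Rint_mul_le e0 sp sl; rewrite h2 invf_div.
set A := \int[Q]_p parabolic m l p ^+ 2 in |- *; set B := \int[Q]_p lapQ l p ^+ 2 in h1 *.
move: h3; rewrite -/(dtQ l) -/(lapQ l) => h3 h4.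
have h5 : al / 2 * B <= 2 / al * A by lra.
have -> : 4 / al ^+ 2 * A = (al / 2)^-1 * (2 / al * A) by field; rewrite gt_eqF.
by rewrite ler_pdivlMl ?divr_gt0.
Qed.

Definition in_range m S := forall e, 0 < e ->
  exists2 l, test_terms T l & \int[Q]_p (S p - parabolic m l p) ^+ 2 < e.

Lemma in_rangeD m S S' : ae_bdd Q m -> sq_integrable Q S -> sq_integrable Q S' ->
  in_range m S -> in_range m S' -> in_range m (fun p => S p + S' p).
Proof.
move=> bm sS sS' hS hS' e e0; have e4 : 0 < e / 4 by lra.
have [l tl lS] := hS _ e4; have [l' tl' lS'] := hS' _ e4.
exists (l ++ l'); first exact: all_terms_cat.
have := Rint_sqrD_le ltr01 (sq_integrableB sS (sq_integrable_parabolic bm tl)) (sq_integrableB sS' (sq_integrable_parabolic bm tl')).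
under [X in X <= _]eq_Rintegral do rewrite addrACA -opprD -parabolic_cat.
by move=> /le_lt_trans; apply; rewrite invr1; lra.
Qed.

Lemma in_range_closure m S : ae_bdd Q m -> sq_integrable Q S ->
  (forall e, 0 < e -> exists S', [/\ sq_integrable Q S', in_range m S' &
    \int[Q]_p (S p - S' p) ^+ 2 < e]) -> in_range m S.
Proof.
move=> bm sS h e e0; have e4 : 0 < e / 4 by lra.
have [S' [sS' rS' SS']] := h _ e4; have [l tl lS'] := rS' _ e4.
exists l => //.
have := Rint_sqrD_le ltr01 (sq_integrableB sS sS') (sq_integrableB sS' (sq_integrable_parabolic bm tl)).
under [X in X <= _]eq_Rintegral do rewrite subrKA.
by move=> /le_lt_trans; apply; rewrite invr1; lra.
Qed.

Section contraction.
Variables (m : X -> R) (al M : R).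
Hypotheses (mm : measurable_fun setT m) (al0 : 0 < al).
Hypothesis mb : {ae Q, forall p, al <= m p <= M}.
Hypothesis alM : al <= M.
Hypothesis heat : forall S, sq_integrable Q S -> in_range (fun=> M) S.

Let bm : ae_bdd Q m.
Proof.
split => //; exists M; apply: QT_aeS mb => p /andP[h1 h2].
by rewrite ger0_norm// (le_trans (ltW al0)).
Qed.

Let M0 : 0 < M. Proof. exact: lt_le_trans alM. Qed.

Variable k : R.
Hypotheses (kM : k * M = M - al) (k01 : 0 <= k < 1).

Local Notation k' := (((1 + k) / 2) ^+ 2).

(* [S - parabolic m l] differs from [S - parabolic M l] by [(M - m) lapQ l], and
   [M ^ 2 * |lapQ l| ^ 2 <= |parabolic M l| ^ 2] while [M - m <= k * M] with [k < 1]. *)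
Lemma parabolic_step S q : sq_integrable Q S -> 0 < q -> exists2 l, test_terms T l &
  \int[Q]_p (S p - parabolic m l p) ^+ 2 <= k' * \int[Q]_p S p ^+ 2 + q.
Proof.
move=> sS q0.
have /andP[k0 k1] := k01.
(* Chosen so that [(1 + e) k <= (1 + k) / 2]: splitting squares twice loses a factor [(1 + e) ^ 2]
   and still leaves a contraction. *)
pose e := (1 - k) / 2; have e0 : 0 < e by rewrite /e; lra.
(* [D] is the total coefficient with which the residual of the constant-coefficient problem enters
   the final bound. *)
pose D := (1 + e^-1) + (1 + e) * (k ^+ 2 * (1 + e^-1)).
have ei0 : 0 < e^-1 by rewrite invr_gt0.
have D0 : 0 < D.
  rewrite /D ltr_pwDl//; first by lra.
  by rewrite !mulr_ge0 ?sqr_ge0//; lra.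
have qD : 0 < q / D by rewrite divr_gt0.
have [l tl lS] := heat sS qD.
exists l => //.
have bc : ae_bdd Q (fun=> M) by split => //; exists `|M|; exact: aeW.
have sL := sq_integrable_parabolic bc tl; have sl := tame_sq_integrable (tame_lapQ tl).
have bd := ae_bddB bc bm.
have [md [K dK]] := bd.
have sd := sq_integrable_bddM md dK sl.
have sSL := sq_integrableB sS sL.
have h1 : \int[Q]_p (S p - parabolic m l p) ^+ 2 <=
    (1 + e) * \int[Q]_p ((M - m p) * lapQ l p) ^+ 2 +
    (1 + e^-1) * \int[Q]_p (S p - parabolic (fun=> M) l p) ^+ 2.
  have := Rint_sqrD_le e0 sd sSL.
  congr (_ <= _); apply: eq_Rintegral => p _; rewrite /parabolic; ring.
have h2 : \int[Q]_p ((M - m p) * lapQ l p) ^+ 2 <= k ^+ 2 * (M ^+ 2 * \int[Q]_p lapQ l p ^+ 2).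
  have [_ is2] := sl; rewrite mulrA -RintegralZl//; apply: Rint_ae_le.
  - by have [] := sd.
  - exact: rintegrableZ.
  - apply: QT_aeS mb => p /andP[h1' h2']; rewrite exprMn ler_wpM2r ?sqr_ge0//.
    rewrite -exprMn lerXn2r ?nnegrE//.
    + by rewrite subr_ge0.
    + by rewrite mulr_ge0// ltW.
    + by rewrite kM lerD2l lerN2.
have h3 := Rint_lap_le_heat (ltW M0) tl.
have h4 : \int[Q]_p parabolic (fun=> M) l p ^+ 2 <=
   (1 + e) * \int[Q]_p S p ^+ 2 + (1 + e^-1) * \int[Q]_p (S p - parabolic (fun=> M) l p) ^+ 2.
  have sSLN := sq_integrableZ (-1) sSL.
  have := Rint_sqrD_le e0 sS sSLN.
  have -> : \int[Q]_p (S p + -1 * (S p - parabolic (fun=> M) l p)) ^+ 2 =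
    \int[Q]_p parabolic (fun=> M) l p ^+ 2.
    by apply: eq_Rintegral => p _; congr (_ ^+ 2); ring.
  have -> : \int[Q]_p (-1 * (S p - parabolic (fun=> M) l p)) ^+ 2 =
    \int[Q]_p (S p - parabolic (fun=> M) l p) ^+ 2.
    by apply: eq_Rintegral => p _; ring.
  by [].
move: lS h1 h2 h3 h4.
set A1 := \int[Q]_p (S p - parabolic m l p) ^+ 2.
set A2 := \int[Q]_p ((M - m p) * lapQ l p) ^+ 2.
set A3 := \int[Q]_p (S p - parabolic (fun=> M) l p) ^+ 2.
set A4 := M ^+ 2 * _; set A5 := \int[Q]_p parabolic (fun=> M) l p ^+ 2.
set A6 := \int[Q]_p S p ^+ 2 => lS h1 h2 h3 h4.
have k2 := sqr_ge0 k.
have h5 : A2 <= k ^+ 2 * ((1 + e) * A6 + (1 + e^-1) * A3).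
  apply: le_trans h2 _; rewrite ler_wpM2l//; exact: le_trans h4.
have h6 : A1 <= (1 + e) ^+ 2 * k ^+ 2 * A6 + D * A3.
  apply: le_trans h1 _; have := ler_wpM2l (_ : 0 <= 1 + e) h5.
  move=> /(_ _); rewrite /D => h; have := h (ltW _); nra.
have h7 : D * A3 <= q by rewrite -ler_pdivlMl// mulrC; exact: ltW.
have h8 : (1 + e) ^+ 2 * k ^+ 2 <= k'.
  rewrite -exprMn lerXn2r ?nnegrE//; [..|rewrite /e; nra].
  - by rewrite mulr_ge0//; lra.
  - by lra.
have A60 : 0 <= A6 by exact: Rint_sqr_ge0.
by have := ler_wpM2r A60 h8; lra.
Qed.

(** A Neumann iteration: the step is applied to the current residual, and concatenating the lists
    adds the corrections. Half of the tolerance [q] is reserved for the new error; the other half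
    covers the earlier ones, which only get multiplied by [K < 1]. *)
Lemma parabolic_dense_aux S : sq_integrable Q S -> in_range m S.
Proof.
move=> sS; have := parabolic_step; set K := k' => pstep.
have /andP[k0 k1] := k01.
have /andP[K0 K1] : 0 <= K < 1.
  by rewrite /K sqr_ge0/= expr_lt1//; lra.
have I0 := Rint_sqr_ge0 Q S.
have step n q : 0 < q -> exists2 l, test_terms T l &
    \int[Q]_p (S p - parabolic m l p) ^+ 2 <= K ^+ n * \int[Q]_p S p ^+ 2 + q.
  elim: n q => [|n IH] q q0.
    exists [::] => //; rewrite expr0 mul1r.
    rewrite (_ : \int[Q]_p _ = \int[Q]_p S p ^+ 2) ?lerDl ?ltW//.
    by apply: eq_Rintegral => p _; rewrite /parabolic /dtQ /lapQ /wave_sumQ !wave_sum_nil mulr0 addr0 subr0.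
  have q2 : 0 < q / 2 by lra.
  have [l tl lS] := IH _ q2.
  have [l' tl' l'S] := pstep _ _ (sq_integrableB sS (sq_integrable_parabolic bm tl)) q2.
  exists (l ++ l'); first exact: all_terms_cat.
  under eq_Rintegral do rewrite parabolic_cat opprD addrA.
  apply: le_trans l'S _; rewrite exprS -mulrA.
  have h := ler_wpM2l K0 lS.
  have : K * (q / 2) <= q / 2 by rewrite ler_piMl// ltW.
  by rewrite mulrDr in h; lra.
move=> e e0.
have [n kn] : exists n, K ^+ n * \int[Q]_p S p ^+ 2 < e / 2.
  have : K ^+ n * \int[Q]_p S p ^+ 2 @[n --> \oo] --> 0.
    rewrite -[X in _ --> X](mul0r (\int[Q]_p S p ^+ 2)); apply: cvgM; last exact: cvg_cst.
    by apply: cvg_expr; rewrite ger0_norm; lra.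
  move/cvgrPdist_lt => /(_ (e / 2)) []; first by lra.
  move=> n _ /(_ n (leqnn n)) /=; rewrite sub0r normrN => h.
  by exists n; exact: le_lt_trans (ler_norm _) h.
have e4 : 0 < e / 2 by lra.
have [l tl lS] := step n _ e4.
by exists l => //; apply: le_lt_trans lS _; lra.
Qed.

End contraction.

Lemma parabolic_dense m al M S : measurable_fun setT m -> 0 < al -> al <= M ->
  {ae Q, forall p, al <= m p <= M} ->
  (forall S, sq_integrable Q S -> in_range (fun=> M) S) -> sq_integrable Q S -> in_range m S.
Proof.
move=> mm al0 alM mb heat; have M0 : 0 < M by exact: lt_le_trans alM.
apply: (parabolic_dense_aux mm al0 mb alM heat (k := 1 - al / M)).
  by rewrite mulrBl mul1r mulfVK ?gt_eqF.
by rewrite subr_ge0 ler_pdivrMr// mul1r alM/= ltrBlDr ltrDl divr_gt0.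
Qed.

End parabolic_range.

(** * Constant coefficients: one Fourier mode at a time *)

Section heat_range.
Context (R : realType) (N : nat) (T : R).
Hypothesis T0 : 0 < T.
Local Notation X := (R * N.-tuple R)%type.
Local Notation Q := (QT_measure T N).

(** The constant 5 comes from [y <= exp y] and [y ^ 2 <= 4 (1 + y / 2) ^ 2 <= 4 exp y]. The first
    bound provides domination, the second one convergence as [y] tends to 0. *)
Lemma expR_poly_le (y : R) : 0 <= y ->
  (y + y ^+ 2) * expR (- y) <= 5 /\ (y + y ^+ 2) * expR (- y) <= y + y ^+ 2.
Proof.
move=> y0; have y2 := sqr_ge0 y; split; last first.
  by rewrite ler_piMr ?addr_ge0// expR_le1 oppr_le0.
rewrite expRN ler_pdivrMr ?expR_gt0//.
have h1 := expR_ge1Dx y.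
have h2 : (1 + y / 2) ^+ 2 <= expR y.
  have -> : expR y = expR (y / 2) ^+ 2.
    by rewrite -expRM_natl; congr expR; field.
  rewrite lerXn2r ?nnegrE ?expR_ge0//; last exact: expR_ge1Dx.
  by rewrite addr_ge0// divr_ge0.
by rewrite expr2 in h2; rewrite expr2; nra.
Qed.

(* [exp (- d / (T - d - t))], extended by [0] to [t >= T - d]. *)
Definition cutoff (d t : R) := bump 0 d (T - d - t).

Lemma smooth1_cutoff d : 0 < d -> smooth1 (cutoff d).
Proof. exact: smooth1_bump. Qed.

Lemma is_derive_cutoff d t : 0 < d ->
  is_derive t (1 : R) (cutoff d) (- (d * bump 2 d (T - d - t))).
Proof.
move=> d0; have D := is_derive_bump 0 (T - d - t) d0.
have D' : is_derive t (1 : R) (fun t => T - d - t) (-1).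
  by apply: is_derive_eq; ring.
have := @is_derive1_comp _ (bump 0 d) (fun t => T - d - t) t _ (-1) D D'.
by congr is_derive; rewrite oppr0 mul0r add0r mulrN1.
Qed.

Lemma cutoff_sub1 d t : 0 < d -> `|cutoff d t - 1| <= 1.
Proof.
move=> d0; rewrite /cutoff /bump; case: ifPn => [s0|_]; last by rewrite sub0r normrN normr1.
rewrite expr0 mul1r ler_norml; have := expR_ge0 (- d / (T - d - t)).
have : expR (- d / (T - d - t)) <= 1.
  by rewrite expR_le1 mulNr oppr_le0 divr_ge0// ltW.
by move=> *; apply/andP; split; lra.
Qed.

Lemma cutoff_sub1_small d t : 0 < d -> 0 < T - d - t ->
  `|cutoff d t - 1| <= d / (T - d - t).
Proof.
move=> d0 s0; rewrite /cutoff /bump s0 expr0 mul1r distrC ger0_norm.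
  by have := expR_ge1Dx (- d / (T - d - t)); rewrite mulNr; lra.
by rewrite subr_ge0 expR_le1 mulNr oppr_le0 divr_ge0// ltW.
Qed.

(** With [s = T - d - t] and [y = d / s], the product is [(y + y ^ 2) exp (- y)]: the factor [T - t]
    makes the bound uniform in [d]. *)
Lemma cutoff_derive_bound d t : 0 < d ->
  0 <= d * bump 2 d (T - d - t) * (T - t) <= 5 \/ T <= t.
Proof.
move=> d0; have [|h] := leP T t; [by right|left].
apply/andP; split.
  by rewrite mulr_ge0 ?subr_ge0 ?(ltW h)// mulr_ge0 ?bump_ge0// ltW.
rewrite /bump; case: ifPn => [s0|_]; last by rewrite mulr0 mul0r.
set s := T - d - t in s0 *; have -> : T - t = s + d by rewrite /s; ring.
have y0 : 0 <= d / s by rewrite divr_ge0// ltW.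
have [h5 _] := expR_poly_le y0; apply: (le_trans _ h5); rewrite mulNr le_eqVlt; apply/orP; left.
by apply/eqP; field; rewrite gt_eqF.
Qed.

Lemma cutoff_derive_small d t : 0 < d -> 0 < T - d - t ->
  d * bump 2 d (T - d - t) * (T - t) <= d / (T - d - t) + (d / (T - d - t)) ^+ 2.
Proof.
move=> d0 s0; rewrite /bump s0.
set s := T - d - t in s0 *; have -> : T - t = s + d by rewrite /s; ring.
have y0 : 0 <= d / s by rewrite divr_ge0// ltW.
have [_ h] := expR_poly_le y0; apply: (le_trans _ h); rewrite mulNr le_eqVlt; apply/orP; left.
by apply/eqP; field; rewrite gt_eqF.
Qed.

Variables (c : R) (k : 'I_N -> int) (th C b : R).
Let f (t : R) := C * expR (b * t).
Let lam := c * eigenvalue_of R k.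

Lemma exp_primitive (g : R) : exists2 E, smooth1 E &
  forall t, is_derive t (1 : R) E (expR (g * t)).
Proof.
(* The case [g = 0] is the resonance, where the exponent of the source equals the rate of the
   mode. *)
have [->|g0] := eqVneq g 0.
  exists id; first exact: smooth1_id.
  by move=> t; rewrite mul0r expR0; exact: is_derive_id.
exists (fun t => g^-1 * expR (g * t)).
  by apply: smooth1M; [exact: smooth1_cst|exact: smooth1_exp].
move=> t; apply: is_derive_eq; rewrite /GRing.scale/=.
by field.
Qed.

(* The bound by [T - t] compensates the blow-up of the derivative of the cutoff. *)
Lemma backward_ode : exists P, [/\ smooth1 P, P T = 0,
  (forall t, is_derive t (1 : R) P (lam * P t + f t)) &
  exists K, forall t, 0 <= t <= T -> `|P t| <= K * (T - t)].
Proof.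
have [E sE dE] := exp_primitive (b - lam).
(* Variation of constants, with [E - E T] in order to vanish at [T]. The rate is [+ lam] because the
   Laplacian multiplies the mode by minus its eigenvalue. *)
pose P t := C * (expR (lam * t) * (E t + - E T)).
have sP : smooth1 P.
  by apply: smooth1M; [exact: smooth1_cst|]; apply: smooth1M; [exact: smooth1_exp|];
    apply: smooth1D => //; exact: smooth1_cst.
have dP t : is_derive t (1 : R) P (lam * P t + f t).
  have D := dE t; apply: is_derive_eq; rewrite /GRing.scale/= /P /f.
  have -> : b * t = lam * t + (b - lam) * t by ring.
  by rewrite expRD; ring.
exists P; split => //; first by rewrite /P subrr !mulr0.
have cP := smooth1_continuous sP.
have cdP : continuous (fun t => lam * P t + f t).
  have sd : smooth1 (fun t => lam * P t + f t).
    apply: smooth1D; first by apply: smooth1M => //; exact: smooth1_cst.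
    by apply: smooth1M; [exact: smooth1_cst|exact: smooth1_exp].
  exact: smooth1_continuous.
have [K hK] := continuous_bounded_on 0 T cdP.
exists K => t /andP[t0 tT].
have [|s] := @MVT_segment _ P (fun t => lam * P t + f t) t T tT (fun s _ => dP s).
  exact: continuous_subspaceT.
rewrite in_itv/= => /andP[ts sT].
have -> : P T = 0 by rewrite /P subrr !mulr0.
move=> E1; have -> : P t = - ((lam * P s + f s) * (T - t)) by rewrite -E1; ring.
rewrite normrN normrM (ger0_norm (_ : 0 <= T - t)) ?subr_ge0//.
by rewrite ler_wpM2r ?subr_ge0// hK// sT (le_trans t0).
Qed.

(** The exact solution [P] vanishes at [T] but not before, so it is multiplied by the cutoff. Up to
    sign and the cosine, the residual [r] is the cutoff derivative times [P] plus [(cutoff - 1) f];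
    it is bounded uniformly in [n] and tends to 0 at each time before [T]. *)
Lemma heat_range_wave : in_range T (fun=> c) (wave_sumQ [:: Term f k th] : X -> R).
Proof.
have [P [sP PT dP [K PK]]] := backward_ode.
pose d (n : nat) : R := n.+1%:R^-1.
have d0 n : 0 < d n by rewrite invr_gt0.
pose l n := [:: @Term R N (fun t => cutoff (d n) t * P t) k th].
have tl n : test_terms T (l n).
  split => //; split; first by apply: smooth1M => //; exact: smooth1_cutoff.
  exists (T - d n); first by rewrite ltrBlDr ltrDl.
  by move=> t tt /=; rewrite /cutoff bump_le0 ?mul0r// subr_le0.
pose r n t := - (d n * bump 2 (d n) (T - d n - t)) * P t + (cutoff (d n) t - 1) * f t.
have rE n p : wave_sumQ [:: Term f k th] p - parabolic (fun=> c) (l n) p =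
    - (r n p.1 * cos (phase k (tnth p.2) + th)).
  rewrite /parabolic /dtQ /lapQ /wave_sumQ !wave_sum_cons !wave_sum_nil /wave/= !addr0.
  have D1 := is_derive_cutoff p.1 (d0 n); have D2 := dP p.1.
  have D := @is_deriveM _ _ _ _ _ _ _ _ D1 D2.
  have -> : derive1 (fun t => cutoff (d n) t * P t) p.1 =
    cutoff (d n) p.1 * (lam * P p.1 + f p.1) + P p.1 * (- (d n * bump 2 (d n) (T - d n - p.1))).
    by rewrite derive1E; case: D.
  rewrite /r /lam; ring.
have [Kf fK] : exists Kf, forall t, 0 <= t <= T -> `|f t| <= Kf.
  apply: continuous_bounded_on; apply: smooth1_continuous.
  by apply: smooth1M; [exact: smooth1_cst|exact: smooth1_exp].
have K0 : 0 <= K.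
  have := PK 0; rewrite lexx (ltW T0) => /(_ isT); rewrite subr0 => h.
  by rewrite -(pmulr_lge0 _ T0) (le_trans _ h).
have Kf0 : 0 <= Kf by rewrite (le_trans _ (fK 0 _))// lexx ltW.
have rb n t : 0 <= t < T -> `|r n t| <= K * (d n * bump 2 (d n) (T - d n - t) * (T - t)) +
    `|cutoff (d n) t - 1| * Kf.
  move=> /andP[t0 tT]; have tT' : 0 <= t <= T by rewrite t0 ltW.
  have bp : 0 <= d n * bump 2 (d n) (T - d n - t) by rewrite mulr_ge0 ?bump_ge0// ltW.
  rewrite /r (le_trans (ler_normD _ _))//; apply: lerD.
    rewrite normrM normrN (ger0_norm bp).
    rewrite [leRHS](_ : _ = d n * bump 2 (d n) (T - d n - t) * (K * (T - t))); last by ring.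
    by rewrite ler_wpM2l// PK.
  by rewrite normrM ler_wpM2l// fK.
have rb5 n t : 0 <= t < T -> `|r n t| <= 5 * K + Kf.
  move=> tT; apply: le_trans (rb n t tT) _.
  have [/andP[_ h]|] := cutoff_derive_bound t (d0 n); last first.
    by case/andP: tT => _ /lt_le_trans /[apply]; rewrite ltxx.
  by rewrite lerD//; [rewrite mulrC ler_wpM2r|rewrite ler_piMl// cutoff_sub1].
have rc t : 0 <= t < T -> r ^~ t @ \oo --> (0 : R).
  move=> tT; apply/norm_cvg0P.
  (* Once [d n <= (T - t) / 2], the distance [T - d n - t] is at least [(T - t) / 2], so [y n]
     dominates [d n / (T - d n - t)]. *)
  pose y n := 2 / (T - t) * d n.
  have T1 : 0 < T - t by case/andP: tT; rewrite subr_gt0.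
  have T2 : 0 < (T - t) / 2 by lra.
  have ybd : \forall n \near \oo, `|r n t| <= K * (y n + y n * y n) + y n * Kf.
    near=> n.
    have dn : d n <= (T - t) / 2.
      near: n; have := @cvg_harmonic R => /cvgrPdist_le/(_ _ T2).
      by apply: filterS => n; rewrite sub0r normrN ger0_norm// invr_ge0.
    have s0 : 0 < T - d n - t by lra.
    have yn : d n / (T - d n - t) <= y n.
      rewrite ler_pdivrMr// [leRHS](_ : _ = d n * ((T - d n - t) * 2 / (T - t))).
        by rewrite ler_peMr ?(ltW (d0 n))// ler_pdivlMr// mul1r; lra.
      by rewrite /y; ring.
    have yp : 0 <= d n / (T - d n - t) by rewrite divr_ge0// ltW.
    apply: le_trans (rb n t tT) _; rewrite lerD//.
      rewrite ler_wpM2l//; apply: le_trans (cutoff_derive_small (d0 n) s0) _.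
      by rewrite expr2 lerD// ler_pM.
    by rewrite ler_wpM2r//; apply: le_trans (cutoff_sub1_small (d0 n) s0) _.
  apply: (squeeze_cvgr (f := fun=> 0) (h := fun n => K * (y n + y n * y n) + y n * Kf)).
  - by apply: filterS ybd => n ->; rewrite normr_ge0.
  - exact: cvg_cst.
  - have y0 : y n @[n --> \oo] --> 0.
      rewrite -(mulr0 (2 / (T - t))); apply: cvgM; first exact: cvg_cst.
      exact: cvg_harmonic.
    have := cvgD (cvgM (cvg_cst K) (cvgD y0 (cvgM y0 y0))) (cvgM y0 (cvg_cst Kf)).
    by rewrite mulr0 addr0 mulr0 mul0r addr0; exact.
have bc : ae_bdd Q (fun=> c) by split => //; exists `|c|; exact: aeW.
have sW : sq_integrable Q (wave_sumQ [:: @Term R N f k th]).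
  apply/tame_sq_integrable/tame_wave_sumQ; split => //.
  by apply: smooth1M; [exact: smooth1_cst|exact: smooth1_exp].
move=> e e0.
have [||||n] := @Rint_dominated _ _ _ Q
  (fun n p => (wave_sumQ [:: Term f k th] p - parabolic (fun=> c) (l n) p) ^+ 2)
  (fun=> (5 * K + Kf) ^+ 2) _ _ _ _ e e0.
- by move=> n; have [_ /rintegrable_measurable] := sq_integrableB sW (sq_integrable_parabolic bc (tl n)).
- exact/tame_rintegrable/tame_cst.
- apply: QT_ae_time => t x tT n; rewrite rE/= sqrrN exprMn normrM.
  rewrite -[leRHS]mulr1 ler_pM ?normr_ge0// normrX.
    by rewrite lerXn2r ?nnegrE// ?rb5// addr_ge0// mulr_ge0.
  by rewrite exprn_ile1// ler_norml cos_geN1 cos_le1.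
- apply: QT_ae_time => t x tT; under eq_fun do rewrite rE/= sqrrN exprMn.
  rewrite -(mul0r (cos (phase k (tnth x) + th) ^+ 2)); apply: cvgM; last exact: cvg_cst.
  by have := cvgM (rc t tT) (rc t tT); rewrite mul0r; exact.
- by move=> h; exists (l n) => //; exact: le_lt_trans (ler_norm _) h.
Unshelve. all: by end_near. Qed.

End heat_range.

(** Density reduces the source to an exponential trigonometric sum, and linearity to a single
    wave. *)
Lemma heat_dense (R : realType) (N : nat) (T : R) (c : R) (S : R * N.-tuple R -> R) :
  0 < T -> sq_integrable (QT_measure T N) S -> in_range T (fun=> c) S.
Proof.
move=> T0 sS.
have bc : ae_bdd (QT_measure T N) (fun=> c) by split => //; exists `|c|; exact: aeW.
have i1 : rintegrable (QT_measure T N) (fun=> 1) by exact/tame_rintegrable/tame_cst.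
apply: in_range_closure => // e e0.
have [v [l el ->] lS] := @sq_integrable_dense _ _ _ (QT_measure T N) (@exp_wave_sum R N) S i1 (@exp_wave_sum_bdd R N T)
  (@exp_wave_sum_dense R N T (fun=> 1) (fun=> ler01) i1) sS e e0.
exists (wave_sumQ l); split => //.
  by apply/tame_sq_integrable/tame_wave_sumQ; apply: all_terms_imp el => f; exact: exponential_smooth.
elim: l el {lS} => [_|a l IH [[C [b fE]] el]].
  move=> e' e'0; exists [::] => //.
  under eq_Rintegral do rewrite /parabolic /dtQ /lapQ /wave_sumQ !wave_sum_nil mulr0 addr0 subr0 expr0n.
  by rewrite Rintegral_cst// mul0r.
have -> : wave_sumQ (a :: l) = (fun p => wave_sumQ [:: a] p + wave_sumQ l p).
  by apply/funext => p; rewrite /wave_sumQ !wave_sum_cons wave_sum_nil addr0.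
have sl : all_terms (@smooth1 R) l by apply: all_terms_imp el => f; exact: exponential_smooth.
case: a fE => f k th /= ->.
apply: in_rangeD => //; last exact: IH.
- apply/tame_sq_integrable/tame_wave_sumQ; split => //.
  by apply: smooth1M; [exact: smooth1_cst|exact: smooth1_exp].
- exact/tame_sq_integrable/tame_wave_sumQ.
- exact: heat_range_wave.
Qed.

(** * Control of the negative part *)

Section negative_part.
Context (R : realType).
Implicit Types s : R.

Definition npart s := Num.max (- s) 0.

Lemma npart_ge0 s : 0 <= npart s.
Proof. by rewrite /npart le_max lexx orbT. Qed.

Lemma continuous_npart : continuous npart.
Proof.
have nE : npart = (fun s => 2^-1 * (`|s| - s)).
  apply/funext => s; rewrite /npart; have [s0|s0] := leP (- s) 0.
    by rewrite ger0_norm ?subrr ?mulr0// -oppr_le0.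
  by rewrite ltr0_norm -?oppr_gt0//; field.
rewrite nE => s; apply: cvgM; first exact: cvg_cst.
by apply: cvgB; [exact: norm_continuous|exact: cvg_id].
Qed.

Lemma npart_mul_ge (g s : R) : 0 <= g -> - (g * npart s) <= g * s.
Proof.
move=> g0; rewrite -mulrN ler_wpM2l// /npart lerNl.
by rewrite le_max lexx.
Qed.

End negative_part.

Section convex_majorant.
Context (R : realType) (dl : R).
Hypothesis dl0 : 0 < dl.
Implicit Types s : R.

(** A smooth regularization of the absolute value, so that [rt s - s] regularizes [2 * npart s]. *)
Definition rt s := Num.sqrt (s ^+ 2 + dl ^+ 2).

Lemma rt_arg s : 0 < s ^+ 2 + dl ^+ 2.
Proof. by rewrite ltr_wpDl ?sqr_ge0// exprn_gt0. Qed.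

Lemma rt_gt0 s : 0 < rt s. Proof. by rewrite sqrtr_gt0 rt_arg. Qed.

Lemma rt_sqr s : rt s ^+ 2 = s ^+ 2 + dl ^+ 2.
Proof. by rewrite sqr_sqrtr// ltW// rt_arg. Qed.

Lemma rt_ge s : `|s| <= rt s.
Proof.
rewrite -ler_sqr ?nnegrE ?(ltW (rt_gt0 s))// rt_sqr real_normK ?num_real//.
by rewrite lerDl sqr_ge0.
Qed.

Lemma is_derive_rt s : is_derive s (1 : R) rt (s * (rt s)^-1).
Proof.
have D1 := is_derive1_sqrt (rt_arg s).
have D2 : is_derive s (1 : R) (fun s => s ^+ 2 + dl ^+ 2) (2 * s).
  by apply: is_derive_eq; rewrite /GRing.scale/=; ring.
have := @is_derive1_comp _ Num.sqrt (fun s => s ^+ 2 + dl ^+ 2) s _ _ D1 D2.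
congr is_derive; rewrite -/(rt s); field.
by rewrite gt_eqF ?rt_gt0.
Qed.

Lemma is_derive_rtV s : is_derive s (1 : R) (fun s => (rt s)^-1) (- (rt s) ^- 2 * (s * (rt s)^-1)).
Proof. exact: (is_deriveV (lt0r_neq0 (rt_gt0 s)) (is_derive_rt s)). Qed.

(* A smooth, convex, nonincreasing majorant of [npart s ^ 2]; [eta1] and [eta2]
   are its first two derivatives. *)
Definition eta s := (rt s - s) ^+ 2.
Definition eta1 s := -2 * ((rt s - s) ^+ 2 * (rt s)^-1).
Definition eta2 s := 2 * ((rt s - s) ^+ 2 * (2 * rt s + s) * (rt s)^-1 ^+ 3).

Lemma is_derive_eta s : is_derive s (1 : R) eta (eta1 s).
Proof.
have D := is_derive_rt s; apply: is_derive_eq; rewrite /GRing.scale/= /eta1.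
by field; rewrite gt_eqF ?rt_gt0.
Qed.

Lemma is_derive_eta1 s : is_derive s (1 : R) eta1 (eta2 s).
Proof.
have D := is_derive_rt s; have D' := is_derive_rtV s.
apply: is_derive_eq; rewrite /GRing.scale/= /eta2.
by field; rewrite gt_eqF ?rt_gt0.
Qed.

Lemma continuous_of_derive (f g : R -> R) :
  (forall t : R, is_derive t (1 : R) f (g t)) -> continuous f.
Proof. by move=> h t; apply/differentiable_continuous/derivable1_diffP; case: (h t). Qed.

Lemma continuous_eta : continuous eta.
Proof. exact: continuous_of_derive is_derive_eta. Qed.

Lemma continuous_eta1 : continuous eta1.
Proof. exact: continuous_of_derive is_derive_eta1. Qed.

Lemma continuous_eta2 : continuous eta2.
Proof.
have c1 : continuous rt by exact: continuous_of_derive is_derive_rt.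
have c2 : continuous (fun s => (rt s)^-1) by exact: continuous_of_derive is_derive_rtV.
move=> s; rewrite /eta2; apply: cvgM; first exact: cvg_cst.
apply: cvgM; first apply: cvgM.
- by apply: cvgM; apply: cvgB; [exact: c1|exact: cvg_id|exact: c1|exact: cvg_id].
- by apply: cvgD; [apply: cvgM; [exact: cvg_cst|exact: c1]|exact: cvg_id].
- by apply: cvgM; [exact: c2|apply: cvgM; exact: c2].
Qed.

Lemma eta1_le0 s : eta1 s <= 0.
Proof. by rewrite /eta1 mulNr oppr_le0 mulr_ge0// mulr_ge0 ?sqr_ge0// invr_ge0 ltW ?rt_gt0. Qed.

Lemma eta2_ge0 s : 0 <= eta2 s.
Proof.
have := rt_ge s; rewrite ler_norml => /andP[h1 h2].
rewrite /eta2 mulr_ge0// mulr_ge0 ?exprn_ge0 ?invr_ge0 ?(ltW (rt_gt0 s))//.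
by rewrite mulr_ge0 ?sqr_ge0//; have := rt_gt0 s; lra.
Qed.

(** The ratio [(rt s - s) / rt s] is at most 2. This bound lets the product of [eta1] with the
    residual be absorbed by [eta]. *)
Lemma eta1_sqr s : eta1 s ^+ 2 <= 16 * eta s.
Proof.
have := rt_ge s; rewrite ler_norml => /andP[h1 h2]; have r0 := rt_gt0 s.
have h : (rt s - s) * (rt s)^-1 <= 2 by rewrite ler_pdivrMr//; lra.
have h0 : 0 <= (rt s - s) * (rt s)^-1 by rewrite divr_ge0//; lra.
have -> : eta1 s ^+ 2 = 4 * ((rt s - s) * (rt s)^-1) ^+ 2 * eta s.
  by rewrite /eta1 /eta; ring.
apply: ler_wpM2r; first exact: sqr_ge0.
by move: h h0; set y := _ * _^-1 => h h0; rewrite expr2; nra.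
Qed.

Lemma npart_sqr s : npart s ^+ 2 <= eta s.
Proof.
have r0 := rt_gt0 s; rewrite /npart /eta; have [h|h] := leP (- s) 0.
  by rewrite expr0n sqr_ge0.
by rewrite lerXn2r ?nnegrE//; lra.
Qed.

Lemma eta0 : eta 0 = dl ^+ 2.
Proof. by rewrite /eta subr0 rt_sqr expr0n/= add0r. Qed.

End convex_majorant.

(** Here [y], [n2], [z], [q] stand for [eta], [npart ^ 2], [eta1] and the parabolic operator at one
    point. As [z S >= 0], Young gives [z q >= - (y + 4 (S - q) ^ 2)]. The growth rate [ka] pays for
    this: one unit of [ka a y] absorbs [a y], and the remaining [(ka - 1) a y >= (L + lo) y] absorbs
    [da y] and leaves [lo y]. *)
Lemma energy_pointwise (R : realType) (lo hi a da L ka E ET y n2 z S q : R) :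
  0 < lo -> lo <= a -> a <= hi -> `|da| <= L -> 1 <= ka -> (ka - 1) * lo = L + lo ->
  1 <= E -> E <= ET -> 0 <= y -> n2 <= y -> z <= 0 -> z ^+ 2 <= 16 * y -> S <= 0 ->
  lo * n2 <= E * (ka * a * y + da * y + a * (z * q)) + 4 * ET * hi * (S - q) ^+ 2.
Proof.
move=> lo0 al ah; rewrite ler_norml => /andP[da1 _] ka0 ka1 E1 EET y0 ny z0 zy S0.
have a0 : 0 <= a by exact: le_trans (ltW lo0) al.
set r := S - q; have r2 := sqr_ge0 r.
have h1 : - (y + 4 * r ^+ 2) <= z * q.
  have -> : z * q = z * S - z * r by rewrite /r; ring.
  have h : 0 <= z * S by rewrite mulr_le0.
  have := sqr_ge0 (z / 4 - 2 * r).
  have -> : (z / 4 - 2 * r) ^+ 2 = z ^+ 2 / 16 - z * r + 4 * r ^+ 2 by field.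
  lra.
have h2 : lo * y <= (ka - 1) * a * y + da * y.
  rewrite -mulrDl ler_wpM2r//.
  have : (ka - 1) * lo <= (ka - 1) * a by rewrite ler_wpM2l// subr_ge0.
  lra.
have h3 := ler_wpM2l a0 h1.
have h4 : lo * y - 4 * a * r ^+ 2 <= ka * a * y + da * y + a * (z * q) by lra.
have E0 : 0 <= E by lra.
have h5 := ler_wpM2l E0 h4.
have h6 : lo * n2 <= E * (lo * y).
  apply: (@le_trans _ _ (lo * y)); first by rewrite ler_wpM2l// ltW.
  by rewrite ler_peMl// mulr_ge0// ltW.
have h7 : E * (4 * a * r ^+ 2) <= 4 * ET * hi * r ^+ 2.
  rewrite [leRHS](_ : _ = ET * (4 * hi * r ^+ 2)); last by ring.
  apply: ler_pM => //; first by rewrite mulr_ge0// mulr_ge0.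
  by rewrite ler_wpM2r// ler_wpM2l.
by rewrite mulrBr in h5; lra.
Qed.

(** * Energy estimate for the negative part *)

Section energy_estimate.
Context (R : realType) (N : nat) (T : R).
Hypothesis T0 : 0 < T.
Local Notation X := (R * N.-tuple R)%type.
Local Notation Q := (QT_measure T N).
Implicit Types (l : seq (term R N)).

(** Integration by parts gives minus the integral of [g eta2 |grad phi|^2], with [eta2 >= 0] by
    convexity; the weight [g] depends on time only and so creates no extra term. *)
Lemma Rint_lap_convex l (dl : R) (g : R -> R) : test_terms T l -> 0 < dl ->
  continuous g -> (forall t, 0 <= g t) ->
  \int[Q]_p (g p.1 * eta1 dl (wave_sumQ l p) * lapQ l p) <= 0.
Proof.
move=> tl d0 cg g0; have sl := all_test_smooth tl.
have tg : tame T (fun p : X => g p.1) by exact: tame_fun_time.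
have tp : tame T (wave_sumQ l) by exact: tame_wave_sumQ.
have t1 := tame_comp (continuous_eta1 d0) tp.
have t2 := tame_comp (continuous_eta2 d0) tp.
have tx i : tame T (wave_sumQ (map (dxT i) l)) by exact/tame_wave_sumQ/smooth1_dxT.
have txx i : tame T (wave_sumQ (map (dxT i) (map (dxT i) l))).
  by apply: tame_wave_sumQ; do 2 apply: smooth1_dxT.
pose h i p := g p.1 * eta1 dl (wave_sumQ l p) * wave_sumQ (map (dxT i) (map (dxT i) l)) p.
have th i : tame T (h i) by apply: tameM => //; exact: tameM.
have hi i : \int[Q]_p h i p <= 0.
  pose f p := g p.1 * (eta2 dl (wave_sumQ l p) * (wave_sumQ (map (dxT i) l) p * wave_sumQ (map (dxT i) l) p))
    + h i p.
  have tf : tame T f.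
    apply: tameD => //; apply: tameM => //; apply: tameM => //; exact: tameM.
  have Z : \int[Q]_p f p = 0.
    apply: (@Rint_QT_space_derivative _ _ _
      (fun p => g p.1 * (eta1 dl (wave_sumQ l p) * wave_sumQ (map (dxT i) l) p)) f i tf).
      move=> t x s.
      have D1 := is_derive_wave_sum_upd l t x i s.
      have D2 := is_derive_wave_sum_upd (map (dxT i) l) t x i s.
      have D3 := @is_derive1_comp _ (eta1 dl) (fun s => wave_sum l t (tnth (upd x i s))) s _ _
        (is_derive_eta1 d0 _) D1.
      have D4 := @is_deriveM _ _ _ _ _ _ _ _ D3 D2.
      have D5 := @is_deriveZ _ _ _ _ (g t) _ _ _ D4.
      move: D5; congr is_derive; rewrite /f /h /wave_sumQ/= /GRing.scale/=; ring.
    by move=> t x; rewrite /wave_sumQ/= !(wave_sum_upd10 _ t x i).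
  rewrite -Z; apply: Rint_ae_le; [exact: tame_rintegrable|exact: tame_rintegrable|].
  apply: aeW => p; rewrite /f lerDr mulr_ge0// mulr_ge0 ?eta2_ge0//.
  by rewrite -expr2 sqr_ge0.
have K (r : seq 'I_N) : tame T (fun p => \sum_(i <- r) h i p) /\
    \int[Q]_p (\sum_(i <- r) h i p) <= 0.
  elim: r => [|i r [IH1 IH2]].
    split; first by under eq_fun do rewrite big_nil; exact: tame_cst.
    under eq_Rintegral do rewrite big_nil.
    by rewrite Rintegral_cst// mul0r.
  split; first by under eq_fun do rewrite big_cons; exact: tameD.
  under eq_Rintegral do rewrite big_cons.
  rewrite RintegralD//; [|exact: tame_rintegrable..].
  by rewrite -[X in _ <= X]addr0 lerD.
have [_] := K (index_enum 'I_N).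
congr (_ <= _); apply: eq_Rintegral => p _.
by rewrite /lapQ /wave_sumQ wave_sum_lapT -mulr_sumr.
Qed.

Lemma tame_torus_rintegrable h t : tame T h -> 0 <= t <= T ->
  rintegrable (torus_measure R N) (fun x => h (t, x)).
Proof.
move=> th tT; have [M hM] := tame_bounded th.
apply: (bounded_rintegrable (M := M)) (torus_fin R N) _ _.
  by have [] := tame_torus th tT.
by apply: aeW => x; exact: hM.
Qed.

Variables (m a da : X -> R) (lo hi : R).
Hypotheses (tm : tame T m) (ta : tame T a) (tda : tame T da).
Hypothesis ma1 : forall p, m p * a p = 1.
Hypothesis da_derive : forall x (t : R), is_derive t (1 : R) (fun s : R => a (s, x)) (da (t, x)).
Hypotheses (lo0 : 0 < lo) (a_bounds : forall p, lo <= a p <= hi).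

(* Differentiate the integral of [exp (ka t) * a * eta phi]: since [a = m ^-1], the
   Laplacian appears with the constant coefficient 1, so that no regularity of
   [m] in space is needed. *)
Lemma eta_energy : exists C1 C2, 0 < C1 /\ forall l S dl, test_terms T l ->
  sq_integrable Q S -> {ae Q, forall p, S p <= 0} -> 0 < dl ->
  lo * \int[torus_measure R N]_x npart (wave_sumQ l (0, x)) ^+ 2 +
  lo * \int[Q]_p npart (wave_sumQ l p) ^+ 2 <=
  C1 * \int[Q]_p (S p - parabolic m l p) ^+ 2 + C2 * dl ^+ 2.
Proof.
have hi0 : 0 < hi.
  have /andP[h1 h2] := a_bounds (0, [tuple 0 | _ < N]).
  by rewrite (lt_le_trans lo0)// (le_trans h1).
have [L0 dL0] := tame_bounded tda; pose L := `|L0|.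
have L_ge0 : 0 <= L by rewrite normr_ge0.
have dL t x : 0 <= t <= T -> `|da (t, x)| <= L.
  by move=> tT; rewrite (le_trans (dL0 t x tT))// ler_norm.
pose ka := 1 + (L + lo) / lo.
have ka1 : (ka - 1) * lo = L + lo by rewrite /ka; field; rewrite gt_eqF.
have ka0 : 1 <= ka by rewrite /ka lerDl divr_ge0 ?addr_ge0// ltW.
pose E t := expR (ka * t).
have cE : continuous E by exact/smooth1_continuous/smooth1_exp.
have E0 t : 0 < E t by exact: expR_gt0.
have E1 t : 0 <= t -> 1 <= E t.
  by move=> t0; rewrite -expR0 ler_expR mulr_ge0//; lra.
have ET t : t <= T -> E t <= E T by move=> tT; rewrite ler_expR ler_wpM2l//; lra.
exists (4 * E T * hi), (E T * hi); split; first by rewrite !mulr_gt0.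
move=> l S dl tl sS S0 d0; have sl := all_test_smooth tl.
have sp : sq_integrable Q (parabolic m l).
  by apply: sq_integrable_parabolic => //; split; [exact: tame_measurable tm|];
    have [M hM] := tame_bounded tm; exists M; apply: QT_ae_time => t x /andP[t0 tT];
    apply: hM; rewrite t0 ltW.
pose ph := wave_sumQ l.
have tp : tame T ph by exact: tame_wave_sumQ.
have tE : tame T (fun p : X => E p.1) by exact: tame_fun_time.
have te := tame_comp (continuous_eta d0) tp.
have te1 := tame_comp (continuous_eta1 d0) tp.
have tdt : tame T (dtQ l) by exact: tame_dtQ.
have tlp : tame T (lapQ l) by exact: tame_lapQ.
pose dH p := E p.1 * (ka * a p * eta dl (ph p) + da p * eta dl (ph p) +
  a p * (eta1 dl (ph p) * dtQ l p)).
have tdH : tame T dH.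
  apply: tameM => //; apply: tameD; first apply: tameD.
  - by apply: tameM => //; exact: tameZ.
  - exact: tameM.
  - by apply: tameM => //; exact: tameM.
have HT := @Rint_QT_time _ _ _ (fun p => E p.1 * (a p * eta dl (ph p))) dH T0 tdH.
have dHD x (t : R) : is_derive t (1 : R) (fun s : R => E s * (a (s, x) * eta dl (ph (s, x)))) (dH (t, x)).
  have D1 := is_derive_wave_sum_time (tnth x) t sl.
  have D2 := @is_derive1_comp _ (eta dl) (fun s => wave_sum l s (tnth x)) t _ _
      (is_derive_eta d0 _) D1.
  have D3 := da_derive x t.
  have D4 := @is_deriveM _ _ _ _ _ _ _ _ D3 D2.
  have DE : is_derive t (1 : R) E (ka * E t).
    by apply: is_derive_eq; rewrite /GRing.scale/= /E; ring.
  have D5 := @is_deriveM _ _ _ _ _ _ _ _ DE D4.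
  move: D5; congr is_derive; rewrite /dH /dtQ /ph /wave_sumQ/= /GRing.scale/= mulrfctE /=; ring.
have {HT dHD} HT := HT dHD.
have HL := Rint_lap_convex tl d0 cE (fun t => ltW (E0 t)).
(* [g] is [dH] with [dtQ l] replaced by the parabolic operator. Since [m a = 1], the difference is
   the term of [Rint_lap_convex], whose integral is at most 0. *)
pose g p := E p.1 * (ka * a p * eta dl (ph p) + da p * eta dl (ph p) +
  a p * (eta1 dl (ph p) * parabolic m l p)).
have tL : tame T (fun p => E p.1 * eta1 dl (ph p) * lapQ l p) by apply: tameM => //; exact: tameM.
have gE p : g p = dH p + E p.1 * eta1 dl (ph p) * lapQ l p.
  rewrite /g /dH /parabolic.
  have -> : a p * (eta1 dl (ph p) * (dtQ l p + m p * lapQ l p)) =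
    a p * (eta1 dl (ph p) * dtQ l p) + m p * a p * (eta1 dl (ph p) * lapQ l p) by ring.
  by rewrite ma1; ring.
have ig : rintegrable Q g.
  have -> : g = (fun p => dH p + E p.1 * eta1 dl (ph p) * lapQ l p) by apply/funext => p; exact: gE.
  by apply: tame_rintegrable; exact: tameD.
have Ig : \int[Q]_p g p <= \int[torus_measure R N]_x
    (E T * (a (T, x) * eta dl (ph (T, x))) - E 0 * (a (0, x) * eta dl (ph (0, x)))).
  rewrite -HT; under eq_Rintegral do rewrite gE.
  rewrite RintegralD//; [|exact: tame_rintegrable..].
  by rewrite -[X in _ <= X]addr0 lerD2l.
have sr := sq_integrableB sS sp.
have [_ ir] := sr.
have tn : tame T (fun p => npart (ph p) ^+ 2).
  apply: (@tame_comp _ _ _ (fun y => npart y ^+ 2)) => // y.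
  have cn := @continuous_npart R y.
  exact: (cvgM cn cn).
have low : lo * \int[Q]_p npart (ph p) ^+ 2 <=
   \int[Q]_p g p + 4 * E T * hi * \int[Q]_p (S p - parabolic m l p) ^+ 2.
  rewrite -!RintegralZl//; last exact: tame_rintegrable.
  rewrite -RintegralD//; last exact: rintegrableZ.
  apply: Rint_ae_le.
  - exact/rintegrableZ/tame_rintegrable.
  - by apply: rintegrableD => //; exact: rintegrableZ.
  have hT : {ae Q, forall p, 0 <= p.1 < T /\ `|da p| <= L}.
    by apply: QT_ae_time => t x /andP[t0 tT]; split; rewrite ?t0//; apply: dL; rewrite t0 ltW.
  apply: QT_aeS2 hT S0 => p [/andP[t0 tT] dap] Sp.
  have /andP[al ah] := a_bounds p.
  have e0 : 0 <= eta dl (ph p) by exact: sqr_ge0.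
  have ne := npart_sqr d0 (ph p).
  have e10 := eta1_le0 d0 (ph p).
  have e1s := eta1_sqr d0 (ph p).
  exact: (energy_pointwise (parabolic m l p) lo0 al ah dap ka0 ka1 (E1 _ t0)
    (ET _ (ltW tT)) e0 ne e10 e1s Sp).
(* At time [T] the sum vanishes and [eta 0 = dl ^ 2], the only trace of the regularization; at time
   0 the exponential weight is 1 and [a >= lo]. *)
have top : \int[torus_measure R N]_x
    (E T * (a (T, x) * eta dl (ph (T, x))) - E 0 * (a (0, x) * eta dl (ph (0, x)))) <=
    E T * hi * dl ^+ 2 - lo * \int[torus_measure R N]_x npart (ph (0, x)) ^+ 2.
  have tH : tame T (fun p => E p.1 * (a p * eta dl (ph p))).
    by apply: tameM => //; exact: tameM.
  have z0T : (0 : R) <= 0 <= T by rewrite (ltW T0) andbT.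
  have zTT : 0 <= T <= T by rewrite (ltW T0) /=.
  have i1 := tame_torus_rintegrable tH zTT; have i2 := tame_torus_rintegrable tH z0T.
  have i3 := tame_torus_rintegrable tn z0T.
  have i4 := tame_torus_rintegrable (@tame_cst R N T (E T * hi * dl ^+ 2)) z0T.
  have -> : E T * hi * dl ^+ 2 = \int[torus_measure R N]_x (E T * hi * dl ^+ 2).
    by rewrite Rintegral_cst// [X in fine X](_ : _ = 1%E) ?mulr1//; exact: probability_setT.
  rewrite -RintegralZl// -RintegralB//; last exact: rintegrableZ.
  apply: Rint_ae_le.
  - exact: rintegrableB i1 i2.
  - by apply: rintegrableB => //; exact: rintegrableZ.
  apply: aeW => x; have /andP[al ah] := a_bounds (T, x).
  have /andP[al' ah'] := a_bounds (0, x).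
  rewrite /ph test_terms_end// eta0//; apply: lerB.
    by rewrite -mulrA ler_wpM2l ?(ltW (E0 _))// ler_wpM2r ?sqr_ge0.
  rewrite {1}/E mulr0 expR0 mul1r.
  apply: ler_pM => //; [exact: ltW|exact: sqr_ge0|exact: npart_sqr].
lra.
Qed.

End energy_estimate.

(** * Coefficients with prescribed bounds *)

Section bounded_coefficient.
Context (R : realType) (A K : R).
Hypotheses (A0 : 0 < A) (K0 : 0 < K).
Implicit Types y : R.

(* A smooth function of [y] with values in [[A, A + K]]: composing it with
   trigonometric sums gives smooth coefficients bounded away from 0. *)
Definition coef y := A + K * (1 + y ^+ 2)^-1.
Definition coefV y := (1 + y ^+ 2) * (A * (1 + y ^+ 2) + K)^-1.
Definition dcoefV y := 2 * K * y * (A * (1 + y ^+ 2) + K)^-1 ^+ 2.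

Lemma one_sqr_gt0 y : 0 < 1 + y ^+ 2. Proof. by rewrite ltr_pwDl ?sqr_ge0. Qed.

Lemma coefV_den_gt0 y : 0 < A * (1 + y ^+ 2) + K.
Proof. by rewrite addr_gt0// mulr_gt0// one_sqr_gt0. Qed.

Lemma coefK y : coef y * coefV y = 1.
Proof.
rewrite /coef /coefV; field.
by rewrite !gt_eqF ?one_sqr_gt0 ?coefV_den_gt0.
Qed.

Lemma coef_bounds y : A <= coef y <= A + K.
Proof.
have h := one_sqr_gt0 y.
rewrite /coef lerDl mulr_ge0 ?invr_ge0 ?(ltW h) ?(ltW K0)//= lerD2l.
by rewrite ler_piMr ?(ltW K0)// invf_le1// lerDl sqr_ge0.
Qed.

Lemma coefV_bounds y : (A + K)^-1 <= coefV y <= A^-1.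
Proof.
have h := one_sqr_gt0 y; have d := coefV_den_gt0 y; have AK : 0 < A + K by rewrite addr_gt0.
have y2 := sqr_ge0 y.
apply/andP; split; rewrite /coefV.
  rewrite -[leLHS]mul1r ler_pdivlMr// mulrC mulrA ler_pdivrMr// mulr1.
  have : 0 <= K * y ^+ 2 by rewrite mulr_ge0// ltW.
  by lra.
by rewrite ler_pdivrMr// -(ler_pM2l A0) mulrA mulfV ?gt_eqF// mul1r lerDl ltW.
Qed.

Lemma is_derive_coefV y : is_derive y (1 : R) coefV (dcoefV y).
Proof.
have D1 : is_derive y (1 : R) (fun y => A * (1 + y ^+ 2) + K) (2 * A * y).
  by apply: is_derive_eq; rewrite /GRing.scale/=; ring.
have D2 := @is_deriveV R (fun y => A * (1 + y ^+ 2) + K) y _ _ (lt0r_neq0 (coefV_den_gt0 y)) D1.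
apply: is_derive_eq; rewrite /GRing.scale/= /dcoefV; field.
by rewrite gt_eqF ?coefV_den_gt0.
Qed.

Lemma continuous_one_sqr : continuous (fun y : R => 1 + y ^+ 2).
Proof.
apply: (@continuous_of_derive R _ (fun y => 2 * y)) => y.
by apply: is_derive_eq; rewrite /GRing.scale/=; ring.
Qed.

Lemma continuous_coef : continuous coef.
Proof.
move=> y; apply: cvgD; first exact: cvg_cst.
apply: cvgM; first exact: cvg_cst.
by apply: cvgV; [rewrite gt_eqF ?one_sqr_gt0|exact: continuous_one_sqr].
Qed.

Lemma continuous_coefV : continuous coefV.
Proof. exact: continuous_of_derive is_derive_coefV. Qed.

Lemma continuous_dcoefV : continuous dcoefV.
Proof.
have c : continuous (fun y => (A * (1 + y ^+ 2) + K)^-1).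
  move=> y; apply: cvgV; first by rewrite gt_eqF ?coefV_den_gt0.
  apply: cvgD; last exact: cvg_cst.
  by apply: cvgM; [exact: cvg_cst|exact: continuous_one_sqr].
move=> y; apply: cvgM; last exact: (cvgM (c y) (c y)).
by apply: cvgM; [exact: cvg_cst|exact: cvg_id].
Qed.

Lemma coef_lipschitz y y' : `|coef y - coef y'| <= K * `|y - y'|.
Proof.
have h := one_sqr_gt0 y; have h' := one_sqr_gt0 y'.
have -> : coef y - coef y' = K * (((y' - y) * (y + y')) / ((1 + y ^+ 2) * (1 + y' ^+ 2))).
  by rewrite /coef; field; rewrite !gt_eqF.
rewrite normrM (gtr0_norm K0) ler_wpM2l ?(ltW K0)//.
rewrite normrM normfV (gtr0_norm (mulr_gt0 h h')) normrM [`|y' - y|]distrC.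
rewrite -mulrA ler_piMr// ler_pdivrMr ?mulr_gt0// mul1r.
rewrite ler_norml; have := sqr_ge0 y; have := sqr_ge0 y'.
have := sqr_ge0 (y - 1); have := sqr_ge0 (y + 1).
have := sqr_ge0 (y' - 1); have := sqr_ge0 (y' + 1).
have : 0 <= y ^+ 2 * y' ^+ 2 by rewrite mulr_ge0 ?sqr_ge0.
by rewrite !expr2 => *; apply/andP; split; nra.
Qed.

(** Solving [A + K / (1 + w ^ 2) = y] gives [w = sqrt (K / (y - A) - 1)]. The margin [y >= 2 A]
    keeps the denominator at least [A], hence [w] bounded, and [K = 2 M] makes the radicand
    nonnegative for [y <= M]. *)
Lemma coef_inverse (M : R) : K = 2 * M -> A <= M -> exists w : R -> R,
  [/\ continuous w, (exists B, forall y, `|w y| <= B) &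
   forall y, 2 * A <= y <= M -> coef (w y) = y].
Proof.
move=> KM AM.
(* [D y] is [max y (2 A) - A]. *)
pose D y := 2^-1 * (`|y - 2 * A| + y + 2 * A) - A.
have DA y : A <= D y.
  by rewrite /D; have := ler_norm (- (y - 2 * A)); rewrite normrN; lra.
have cD : continuous D.
  move=> y; apply: cvgB; last exact: cvg_cst.
  apply: cvgM; first exact: cvg_cst.
  apply: cvgD; last exact: cvg_cst.
  apply: cvgD; last exact: cvg_id.
  apply: (@continuous_comp _ _ _ (fun y => y - 2 * A) Num.norm); last exact: norm_continuous.
  by apply: cvgB; [exact: cvg_id|exact: cvg_cst].
exists (fun y => Num.sqrt (K * (D y)^-1 - 1)); split.
- move=> y; apply: (@continuous_comp _ _ _ (fun y => K * (D y)^-1 - 1) Num.sqrt); last exact: sqrt_continuous.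
  apply: cvgB; last exact: cvg_cst.
  apply: cvgM; first exact: cvg_cst.
  by apply: cvgV; [rewrite gt_eqF// (lt_le_trans A0)|exact: cD].
- exists (Num.sqrt (K * A^-1)) => y; rewrite ger0_norm ?sqrtr_ge0// ler_wsqrtr//.
  apply: (@le_trans _ _ (K * (D y)^-1)); first by rewrite gerBl.
  by rewrite ler_wpM2l ?(ltW K0)// lef_pV2 ?posrE ?(lt_le_trans A0).
- move=> y /andP[y1 y2]; have -> : D y = y - A.
    by rewrite /D ger0_norm ?subr_ge0//; field.
  have yA : 0 < y - A by have := A0; lra.
  rewrite /coef sqr_sqrtr; last first.
    by rewrite subr_ge0 ler_pdivlMr// mul1r KM; have := A0; lra.
  by rewrite [1 + _]addrC subrK invfM invrK mulrA mulfV ?gt_eqF// mul1r addrC subrK.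
Qed.

End bounded_coefficient.

(** For [g >= 0] only the negative part of [f] can make the integral negative; Young's inequality
    then uses that this part is small. *)
Lemma Rint_mul_neg_le d (X : measurableType d) (R : realType)
    (mu : {measure set X -> \bar R}) (g f : X -> R) (e : R) :
  0 < e -> sq_integrable mu g -> sq_integrable mu f -> sq_integrable mu (fun x => npart (f x)) ->
  {ae mu, forall x, 0 <= g x} -> \int[mu]_x npart (f x) ^+ 2 <= e ^+ 2 ->
  - (\int[mu]_x (g x * f x)) <= e * \int[mu]_x g x ^+ 2 + e.
Proof.
move=> e0 sg sf sn g0 ne.
have ign := sq_integrable_mul sg sn; have igf := sq_integrable_mul sg sf.
have h : - (\int[mu]_x (g x * npart (f x))) <= \int[mu]_x (g x * f x).
  rewrite -mulN1r -RintegralZl//; apply: Rint_ae_le => //; first exact: rintegrableZ.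
  by apply: filterS g0 => x gx; rewrite mulN1r; exact: npart_mul_ge.
have := Rint_mul_le e0 sg sn.
have : e^-1 * \int[mu]_x npart (f x) ^+ 2 <= e.
  by rewrite ler_pdivrMl// -expr2.
lra.
Qed.

(** * Nonnegativity of weak solutions *)

Section nonnegativity.
Context (R : realType) (N : nat) (T : R).
Hypothesis T0 : 0 < T.
Local Notation X := (R * N.-tuple R)%type.
Local Notation Q := (QT_measure T N).
Local Notation P := (torus_measure R N).
Implicit Types (l : seq (term R N)).

(** The energy estimate with coefficient [coef], in the limit of vanishing regularization. The
    constant depends on [lv], through the time derivative of [coefV], but is uniform in [l] and
    [S]. *)
Lemma neg_part_estimate (A K : R) lv : 0 < A -> 0 < K -> all_terms (@exponential R) lv ->
  exists2 C, 0 < C & forall l S, test_terms T l ->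
  sq_integrable Q S -> {ae Q, forall p, S p <= 0} ->
  \int[P]_x npart (wave_sumQ l (0, x)) ^+ 2 + \int[Q]_p npart (wave_sumQ l p) ^+ 2 <=
  C * \int[Q]_p (S p - parabolic (fun p => coef A K (wave_sumQ lv p)) l p) ^+ 2.
Proof.
move=> A0 K0 elv.
have sv : all_terms (@smooth1 R) lv by apply: all_terms_imp elv => f; exact: exponential_smooth.
have tv : tame T (wave_sumQ lv) by exact: tame_wave_sumQ.
have tvt : tame T (wave_sumQ (map (@dtT R N) lv)) by exact/tame_wave_sumQ/smooth1_map_dtT.
have tm := tame_comp (@continuous_coef R A K) tv.
have ta := tame_comp (continuous_coefV A0 K0) tv.
have tda := tameM (tame_comp (continuous_dcoefV A0 K0) tv) tvt.
have dD x (t : R) : is_derive t (1 : R) (fun s : R => coefV A K (wave_sumQ lv (s, x)))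
    (dcoefV A K (wave_sumQ lv (t, x)) * wave_sumQ (map (@dtT R N) lv) (t, x)).
  have D1 := is_derive_wave_sum_time (tnth x) t sv.
  exact: (@is_derive1_comp _ (coefV A K) (fun s => wave_sum lv s (tnth x)) t _ _
      (is_derive_coefV A0 K0 _) D1).
have AK : 0 < (A + K)^-1 by rewrite invr_gt0 addr_gt0.
have [C1 [C2 [C10 H]]] := eta_energy T0 tm ta tda (fun p => coefK A0 K0 (wave_sumQ lv p)) dD AK
  (fun p => coefV_bounds A0 K0 (wave_sumQ lv p)).
exists ((A + K) * C1) => [|l S tl sS S0]; first by rewrite mulr_gt0// addr_gt0.
rewrite -mulrA -ler_pdivrMl ?addr_gt0//.
apply/ler_addgt0Pr => e e0.
(* With [dl <= 1] and [(|C2| + 1) dl <= e], the error [C2 dl ^ 2] is at most [e]. *)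
pose dl := Num.min 1 (e / (`|C2| + 1)).
have C20 : 0 < `|C2| + 1 by rewrite ltr_wpDl.
have dl0 : 0 < dl by rewrite lt_min ltr01 divr_gt0.
have := H l S dl tl sS S0 dl0; rewrite -mulrDr => /le_trans; apply.
rewrite lerD2l.
have d1 : dl <= 1 by rewrite ge_min lexx.
have d2 : (`|C2| + 1) * dl <= e by rewrite -ler_pdivlMl// mulrC ge_min lexx orbT.
apply: le_trans d2; rewrite expr2 mulrA.
have h : C2 * dl <= (`|C2| + 1) * dl.
  by rewrite ler_wpM2r ?(ltW dl0)// (le_trans (ler_norm _))// lerDl.
apply: le_trans (_ : (`|C2| + 1) * dl * dl <= _); first by rewrite ler_wpM2r// ltW.
by rewrite ler_piMr// mulr_ge0// ltW.
Qed.

(** Approximating [mu] itself by trigonometric sums could destroy its lower bound. Instead the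
    bounded function [w (mu)] is approximated, for the weight [z ^ 2], and [coef], which is
    Lipschitz, brings the approximation back with its bounds built in. The choice [A = al / 2] makes
    [2 A = al], as [coef_inverse] requires. *)
Lemma coef_approx (mu z : X -> R) (al M : R) : measurable_fun setT mu -> sq_integrable Q z ->
  0 < al -> al <= M -> {ae Q, forall p, al <= mu p <= M} ->
  forall e, 0 < e -> exists2 lv, all_terms (@exponential R) lv &
    \int[Q]_p (z p * (mu p - coef (al / 2) (2 * M) (wave_sumQ lv p))) ^+ 2 < e.
Proof.
move=> mmu sz al0 alM mub e e0.
have A0 : 0 < al / 2 by lra.
have M0 : 0 < 2 * M by lra.
have [|w [cw [B wB] wK]] := coef_inverse A0 M0 (M := M) erefl; first by lra.
have bw : ae_bdd Q (fun p => w (mu p)).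
  split; first by apply: measurableT_comp => //; exact: continuous_measurable_fun.
  by exists B; exact: aeW.
have [mz iz] := sz.
have rho0 (p : X) : 0 <= z p ^+ 2 by exact: sqr_ge0.
have e1 : 0 < e / (2 * M) ^+ 2 by rewrite divr_gt0// exprn_gt0.
have [_ /(_ _ e1)[v [lv elv ->] wv]] := exp_wave_sum_dense rho0 iz bw.
exists lv => //.
have bv : ae_bdd Q (wave_sumQ lv) by exact/wave_sumQ_bdd/all_exponential_continuous.
have bd := ae_bddB bw bv.
have i1 := @rintegrable_weighted_sq _ _ _ Q (fun p => z p ^+ 2) rho0 iz _ bd.
have mc : measurable_fun setT (fun p => coef (al / 2) (2 * M) (wave_sumQ lv p)).
  apply: measurableT_comp; last by case: bv.
  by apply: continuous_measurable_fun; exact: continuous_coef.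
have le1 : {ae Q, forall p, (z p * (mu p - coef (al / 2) (2 * M) (wave_sumQ lv p))) ^+ 2 <=
   (2 * M) ^+ 2 * (z p ^+ 2 * (w (mu p) - wave_sumQ lv p) ^+ 2)}.
  apply: QT_aeS mub => p mp; rewrite [leLHS]exprMn [leRHS]mulrCA.
  apply: ler_wpM2l; first exact: sqr_ge0.
  rewrite -exprMn -[leLHS]real_normK ?num_real// -[leRHS]real_normK ?num_real//.
  rewrite lerXn2r ?nnegrE// [leRHS]normrM (gtr0_norm M0).
  apply: (le_trans _ (coef_lipschitz (al / 2) M0 (w (mu p)) (wave_sumQ lv p))).
  by rewrite wK// (_ : 2 * (al / 2) = al)//; field.
have i2 := rintegrableZ ((2 * M) ^+ 2) i1.
apply: (@le_lt_trans _ _ ((2 * M) ^+ 2 * weighted_sq Q (fun p => z p ^+ 2) (fun p => w (mu p) - wave_sumQ lv p))).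
  rewrite /weighted_sq -RintegralZl//; apply: Rint_ae_le => //.
  apply: (rintegrable_ae_le _ i2).
    by apply: measurable_funX; apply: measurable_funM => //; exact: measurable_funB.
  by apply: QT_aeS le1 => p; rewrite ger0_norm ?sqr_ge0.
by rewrite -ltr_pdivlMl ?exprn_gt0// mulrC.
Qed.

(* Testing against trigonometric sums is enough for the proof. *)
Definition weak_solution (mu G z : X -> R) (z0 : N.-tuple R -> R) :=
  forall l, test_terms T l ->
  - (\int[Q]_p (z p * parabolic mu l p)) =
  \int[P]_x (z0 x * wave_sumQ l (0, x)) + \int[Q]_p (G p * wave_sumQ l p).

Lemma weak_solution_nonneg (mu G z : X -> R) (z0 : N.-tuple R -> R) (al M : R) :
  measurable_fun setT mu -> 0 < al -> al <= M -> {ae Q, forall p, al <= mu p <= M} ->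
  sq_integrable Q G -> sq_integrable P z0 -> sq_integrable Q z ->
  {ae P, forall x, 0 <= z0 x} -> {ae Q, forall p, 0 <= G p} ->
  weak_solution mu G z z0 -> {ae Q, forall p, 0 <= z p}.
Proof.
move=> mmu al0 alM mub sG sz0 sz z0_ge0 G_ge0 wz.
have M0 : 0 < M by exact: lt_le_trans alM.
pose S p := - npart (z p).
have cn := @continuous_npart R.
have sn : sq_integrable Q (fun p => npart (z p)).
  have [mz _] := sz; apply: (sq_integrable_ae_le _ sz).
    by apply: measurableT_comp => //; exact: continuous_measurable_fun.
  apply: aeW => p; rewrite (ger0_norm (npart_ge0 _)) /npart ge_max normr_ge0 andbT.
  by rewrite -normrN ler_norm.
have sS : sq_integrable Q S.
  by have := sq_integrableZ (-1) sn; under eq_fun do rewrite mulN1r.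
have S0 : {ae Q, forall p, S p <= 0} by apply: aeW => p; rewrite oppr_le0 npart_ge0.
pose I := \int[Q]_p npart (z p) ^+ 2.
have I0 : 0 <= I by exact: Rint_sqr_ge0.
have IS : \int[Q]_p (z p * S p) = I.
  apply: eq_Rintegral => p _; rewrite /S /npart.
  by have [h|h] := leP (- z p) 0; [rewrite oppr0 mulr0 expr0n|ring].
have IS2 : \int[Q]_p S p ^+ 2 = I.
  by apply: eq_Rintegral => p _; rewrite /S sqrrN.
pose Z0 := \int[P]_x z0 x ^+ 2; pose Z := \int[Q]_p z p ^+ 2; pose G2 := \int[Q]_p G p ^+ 2.
(* [B] gathers the bounds [b1] to [b4] below, each contributing one extra [e]; [2 * I + 2] bounds
   the squared norm of [parabolic m l]. [B] is fixed before [e], and hence before [m]. *)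
pose B := Z0 + G2 + Z + 4 + 4 / (al / 2) ^+ 2 * (2 * I + 2).
have bmu : ae_bdd Q mu.
  split => //; exists M; apply: QT_aeS mub => p /andP[h1 h2].
  by rewrite ger0_norm// (le_trans (ltW al0)).
have main e : 0 < e -> e <= 1 -> I <= e * B.
  move=> e0 e1.
  have ee0 : 0 < e ^+ 2 by rewrite exprn_gt0.
  have ei0 : 0 < e^-1 by rewrite invr_gt0.
  have eie2 : e^-1 * e ^+ 2 = e by rewrite expr2 mulrA mulVf ?mul1r ?gt_eqF.
  have A0 : 0 < al / 2 by lra.
  have K0 : 0 < 2 * M by lra.
  have [lv elv zmu] := coef_approx mmu sz al0 alM mub ee0.
  pose m p := coef (al / 2) (2 * M) (wave_sumQ lv p).
  have [C C0 HC] := neg_part_estimate A0 K0 elv.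
  (* The residual must be small both in itself and after multiplication by [C], which is known only
     once [lv] is fixed; [l] comes last. *)
  pose e' := Num.min (e ^+ 2) (e ^+ 2 / C).
  have e'0 : 0 < e' by rewrite lt_min ee0 divr_gt0.
  have e'1 : e' <= e ^+ 2 by rewrite ge_min lexx.
  have e'2 : C * e' <= e ^+ 2 by rewrite -ler_pdivlMl// mulrC ge_min lexx orbT.
  have bv : ae_bdd Q (wave_sumQ lv) by exact/wave_sumQ_bdd/all_exponential_continuous.
  have mm : measurable_fun setT m.
    apply: measurableT_comp; last by case: bv.
    by apply: continuous_measurable_fun; exact: continuous_coef.
  have mb : {ae Q, forall p, al / 2 <= m p <= al / 2 + 2 * M} by apply: aeW => p; exact: coef_bounds.
  have bm : ae_bdd Q m.
    split => //; exists (al / 2 + 2 * M); apply: QT_aeS mb => p /andP[h1 h2].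
    by rewrite ger0_norm// (le_trans (ltW A0)).
  have AM : al / 2 <= al / 2 + 2 * M by rewrite lerDl ltW.
  have [l tl lS] := parabolic_dense T0 mm A0 AM mb (fun S => @heat_dense R N T _ S T0) sS e'0.
  have := HC l S tl sS S0; rewrite -/m => Hn.
  have sl := all_test_smooth tl.
  have tp : tame T (wave_sumQ l) by exact: tame_wave_sumQ.
  have tlap := tame_lapQ tl.
  have spm := sq_integrable_parabolic bm tl; have spmu := sq_integrable_parabolic bmu tl.
  have se := sq_integrableB sS spm.
  have snp : sq_integrable Q (fun p => npart (wave_sumQ l p)) by exact/tame_sq_integrable/(tame_comp cn).
  have T00 : (0 : R) <= 0 <= T by rewrite lexx ltW.
  have sp0 := tame_torus tp T00.
  have snp0 := tame_torus (tame_comp cn tp) T00.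
  have [mz _] := sz.
  have sd : sq_integrable Q (fun p => z p * (mu p - m p)).
    under eq_fun do rewrite mulrC.
    have [md [K dK]] := ae_bddB bmu bm.
    exact: (sq_integrable_bddM md dK).
  have CSe : C * \int[Q]_p (S p - parabolic m l p) ^+ 2 <= e ^+ 2.
    by apply: le_trans e'2; rewrite ler_wpM2l ?ltW.
  have n0 := Rint_sqr_ge0 P (fun x => npart (wave_sumQ l (0, x))).
  have nQ := Rint_sqr_ge0 Q (fun p => npart (wave_sumQ l p)).
  have b1 : - (\int[P]_x (z0 x * wave_sumQ l (0, x))) <= e * Z0 + e.
    apply: Rint_mul_neg_le => //; apply: le_trans CSe; apply: le_trans Hn.
    by rewrite lerDl.
  have b2 : - (\int[Q]_p (G p * wave_sumQ l p)) <= e * G2 + e.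
    apply: Rint_mul_neg_le => //; first exact: tame_sq_integrable.
    by apply: le_trans CSe; apply: le_trans Hn; rewrite lerDr.
  have b3 : \int[Q]_p (z p * (S p - parabolic m l p)) <= e * Z + e.
    apply: le_trans (Rint_mul_le e0 sz se) _; rewrite lerD2l -[leRHS]eie2.
    by rewrite ler_wpM2l ?(ltW ei0)// (le_trans (ltW lS)).
  have slap := tame_sq_integrable tlap.
  have b4 : - (\int[Q]_p (z p * (mu p - m p) * lapQ l p)) <=
      e * (4 / (al / 2) ^+ 2 * (2 * I + 2)) + e.
    have sdN := sq_integrableZ (-1) sd.
    have -> : - (\int[Q]_p (z p * (mu p - m p) * lapQ l p)) =
        \int[Q]_p (lapQ l p * (-1 * (z p * (mu p - m p)))).
      rewrite -[LHS]mulN1r -RintegralZl//; last exact: sq_integrable_mul.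
      by apply: eq_Rintegral => p _; ring.
    apply: le_trans (Rint_mul_le e0 slap sdN) _; apply: lerD; last first.
      rewrite -[leRHS]eie2 ler_wpM2l ?(ltW ei0)//.
      by under eq_Rintegral do rewrite mulN1r sqrrN; exact: ltW.
    rewrite ler_wpM2l ?(ltW e0)//.
    have alm : {ae Q, forall p, al / 2 <= m p} by apply: QT_aeS mb => p /andP[].
    apply: le_trans (Rint_lap_le T0 bm A0 alm tl) _.
    have c0 : 0 <= 4 / (al / 2) ^+ 2 by rewrite divr_ge0// sqr_ge0.
    rewrite ler_wpM2l//.
    have := Rint_sqrD_le ltr01 sS (sq_integrableZ (-1) se).
    have -> : \int[Q]_p (S p + -1 * (S p - parabolic m l p)) ^+ 2 =
        \int[Q]_p parabolic m l p ^+ 2.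
      by apply: eq_Rintegral => p _; congr (_ ^+ 2); ring.
    have -> : \int[Q]_p (-1 * (S p - parabolic m l p)) ^+ 2 =
        \int[Q]_p (S p - parabolic m l p) ^+ 2.
      by apply: eq_Rintegral => p _; ring.
    have e21 : e ^+ 2 <= 1 by rewrite exprn_ile1// ltW.
    rewrite IS2 invr1; move: (le_trans (ltW lS) (le_trans e'1 e21)); clear; lra.
  (* Pointwise, [z S] is split through [parabolic mu l]: the weak formulation handles the first
     integral, the residual for [m] the second, and the coefficient error [mu - m] the third. *)
  have E : I = \int[Q]_p (z p * parabolic mu l p) + \int[Q]_p (z p * (S p - parabolic m l p))
     - \int[Q]_p (z p * (mu p - m p) * lapQ l p).
    have i1 := sq_integrable_mul sz spmu; have i2 := sq_integrable_mul sz se; have i3 := sq_integrable_mul sd slap.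
    rewrite -RintegralD// -RintegralB//; last exact: rintegrableD.
    by rewrite -IS; apply: eq_Rintegral => p _; rewrite /parabolic; ring.
  by move: (wz l tl) b1 b2 b3 b4 E; rewrite /B; clear; lra.
have B0 : 0 <= B.
  rewrite /B !addr_ge0 ?Rint_sqr_ge0// mulr_ge0 ?divr_ge0 ?sqr_ge0//.
  by rewrite addr_ge0// mulr_ge0.
have I_le0 : I <= 0.
  apply/ler_addgt0Pr => e e0; rewrite add0r.
  pose e' := Num.min 1 (e / (B + 1)).
  have B1 : 0 < B + 1 by rewrite ltr_wpDl.
  have e'0 : 0 < e' by rewrite lt_min ltr01 divr_gt0.
  have e'1 : e' <= 1 by rewrite ge_min lexx.
  apply: le_trans (main e' e'0 e'1) _.
  apply: (@le_trans _ _ (e' * (B + 1))); first by rewrite ler_wpM2l ?(ltW e'0)// lerDl.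
  by rewrite -ler_pdivlMr// ge_min lexx orbT.
have [_ isn] := sn.
have : {ae Q, forall p, npart (z p) ^+ 2 = 0}.
  by apply: Rint0_ae0 => //; apply: aeW => p; exact: sqr_ge0.
apply: QT_aeS => p /eqP; rewrite sqrf_eq0 => /eqP h.
by rewrite -oppr_le0 -h /npart le_max lexx.
Qed.

End nonnegativity.

Lemma Lfuny_ae_bdd d (X : measurableType d) (R : realType)
    (mu : {measure set X -> \bar R}) (f : X -> R) :
  f \in Lfun mu +oo%E -> ae_bdd mu f.
Proof.
rewrite inE => /andP[]; rewrite !inE/= => mf fn; split => //.
move: fn; rewrite /finite_norm unlock /Lnorm; case: ifPn => [mu0|].
  have := ess_sup_ge mu (abse \o (EFin \o f)).
  case: (ess_sup mu _) => [M| |]//= h _; [exists M|exists 0].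
    by apply: filterS h.
  by apply: filterS h => x; rewrite leeNy_eq.
rewrite -leNgt => mu0 _; exists 0, setT; split => //.
by apply/eqP; rewrite eq_le mu0 measure_ge0.
Qed.

(** * From dual to weak solutions, and the exponential change of unknown *)

Section dual_solutions.
Context (R : realType) (N : nat) (T : R).
Local Notation X := (R * N.-tuple R)%type.
Local Notation Q := (QT_measure T N).
Local Notation P := (torus_measure R N).

Lemma dual_weak_solution (mu G z : X -> R) (z0 : N.-tuple R -> R) :
  is_dual_solution T mu G z0 z -> weak_solution T mu G z z0.
Proof.
move=> [_ hz] l tl; have sl := all_test_smooth tl.
have := hz _ (test_wave_sumR tl); rewrite dt_wave_sumR// laplacian_wave_sumR//.
have -> : \int[Q]_p (z p * (wave_sumR (map (@dtT R N) l) (p.1, row_of p.2) +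
    mu p * wave_sumR (map (@lapT R N) l) (p.1, row_of p.2))) = \int[Q]_p (z p * parabolic mu l p).
  by apply: eq_Rintegral => -[t x] _; rewrite !wave_sumR_row.
have -> : \int[P]_x (z0 x * wave_sumR l (0, row_of x)) = \int[P]_x (z0 x * wave_sumQ l (0, x)).
  by apply: eq_Rintegral => x _; rewrite wave_sumR_row.
have -> : \int[Q]_p (G p * wave_sumR l (p.1, row_of p.2)) = \int[Q]_p (G p * wave_sumQ l p).
  by apply: eq_Rintegral => -[t x] _; rewrite wave_sumR_row.
by [].
Qed.

Lemma expR_ae_bdd (r : R) : ae_bdd Q (fun p => expR (r * p.1)).
Proof.
have [] : tame T (fun p : X => expR (r * p.1)).
  by apply: (@tame_fun_time _ _ _ (fun t => expR (r * t))); exact/smooth1_continuous/smooth1_exp.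
move=> mf [M hM] _ _; split => //; exists M; apply: QT_ae_time => t x /andP[t0 tT].
by apply: hM; rewrite t0 ltW.
Qed.

(** The factor [w = exp (- r t)] is moved onto the test function: [w phi] is again a test sum and
    [d_t (w phi) = w (d_t phi - r phi)]. The initial datum is unchanged since [w 0 = 1]. *)
Lemma weak_solution_expR (mu G z : X -> R) (z0 : N.-tuple R -> R) (r : R) :
  ae_bdd Q mu -> sq_integrable Q G -> sq_integrable P z0 -> sq_integrable Q z -> 0 < T ->
  weak_solution T mu G z z0 ->
  weak_solution T mu (fun p => (G p - r * z p) * expR (- r * p.1))
    (fun p => z p * expR (- r * p.1)) z0.
Proof.
move=> bmu sG sz0 sz T0 wz l tl; have sl := all_test_smooth tl.
pose w t := expR (- r * t).
have sw : smooth1 w by exact: smooth1_exp.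
pose l' := map (@mulT R N w) l.
have tl' : test_terms T l'.
  apply: all_terms_map tl => a [sa [tau tT h]]; split; first exact: smooth1M.
  by exists tau => // t /h /= ->; rewrite mulr0.
have el' p : wave_sumQ l' p = w p.1 * wave_sumQ l p by rewrite /wave_sumQ wave_sum_mulT.
have lap' p : lapQ l' p = w p.1 * lapQ l p.
  rewrite /lapQ /l' -map_comp /wave_sumQ -wave_sum_mulT -map_comp !wave_sum_map.
  by apply: eq_bigr => a _; rewrite /wave/=; ring.
have dt' p : dtQ l' p = w p.1 * (dtQ l p - r * wave_sumQ l p).
  rewrite /dtQ /l' /wave_sumQ; elim: l {tl tl' l' el' lap'} sl => [_|a l IH [sa sl]] /=.
    by rewrite !wave_sum_nil mulr0 subr0 mulr0.
  rewrite !wave_sum_cons IH// /wave/=.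
  have D1 := smooth1_is_derive p.1 sa.
  have D : is_derive p.1 (1 : R) (fun t => w t * tfun a t)
     (w p.1 * (derive1 (tfun a) p.1 - r * tfun a p.1)).
    by apply: is_derive_eq; rewrite /GRing.scale/= /w; ring.
  have -> : derive1 (fun t => w t * tfun a t) p.1 =
     w p.1 * (derive1 (tfun a) p.1 - r * tfun a p.1) by rewrite derive1E; case: D.
  ring.
have := wz l' tl'.
have bw : ae_bdd Q (fun p => w p.1) by exact: expR_ae_bdd.
have [mw [K wK]] := bw.
have spm := sq_integrable_parabolic bmu tl.
have sev : sq_integrable Q (wave_sumQ l) by exact/tame_sq_integrable/tame_wave_sumQ.
have szw := sq_integrable_bddM mw wK sz; have sGw := sq_integrable_bddM mw wK sG.
have i1 := sq_integrable_mul szw spm; have i2 := sq_integrable_mul szw sev; have i3 := sq_integrable_mul sGw sev.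
have -> : \int[P]_x (z0 x * wave_sumQ l' (0, x)) = \int[P]_x (z0 x * wave_sumQ l (0, x)).
  by apply: eq_Rintegral => x _; rewrite el' /w/= mulr0 expR0 mul1r.
have -> : \int[Q]_p (z p * parabolic mu l' p) =
    \int[Q]_p (w p.1 * z p * parabolic mu l p) - r * \int[Q]_p (w p.1 * z p * wave_sumQ l p).
  rewrite -RintegralZl// -RintegralB//; last exact: rintegrableZ.
  by apply: eq_Rintegral => p _; rewrite /parabolic dt' lap'; ring.
have -> : \int[Q]_p (G p * wave_sumQ l' p) = \int[Q]_p (w p.1 * G p * wave_sumQ l p).
  by apply: eq_Rintegral => p _; rewrite el'; ring.
have -> : \int[Q]_p (z p * expR (- r * p.1) * parabolic mu l p) =
    \int[Q]_p (w p.1 * z p * parabolic mu l p).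
  by apply: eq_Rintegral => p _; rewrite /w; ring.
have -> : \int[Q]_p ((G p - r * z p) * expR (- r * p.1) * wave_sumQ l p) =
    \int[Q]_p (w p.1 * G p * wave_sumQ l p) - r * \int[Q]_p (w p.1 * z p * wave_sumQ l p).
  rewrite -RintegralZl// -RintegralB//; last exact: rintegrableZ.
  by apply: eq_Rintegral => p _; rewrite /w; ring.
lra.
Qed.

End dual_solutions.

Theorem proposition2 (R : realType) (N : nat) (T : R)
    (hN : (1 <= N)%N) (hT : 0 < T)
    (mu G z : R * N.-tuple R -> R) (z0 : N.-tuple R -> R)
    (hmu : mu \in Lfun (QT_measure T N) +oo%E)
    (hmu_lb : positively_lower_bounded T mu)
    (hG : G \in Lfun (QT_measure T N) 2%:E)
    (hz0 : z0 \in Lfun (torus_measure R N) 2%:E)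
    (hz : is_dual_solution T mu G z0 z) :
  ({ae torus_measure R N, forall x, 0 <= z0 x} ->
   {ae QT_measure T N, forall p, 0 <= G p} ->
   {ae QT_measure T N, forall p, 0 <= z p}) /\
  (forall r : R,
   {ae QT_measure T N, forall p, G p <= r * z p} ->
   forall zt : R * N.-tuple R -> R,
   is_dual_solution T mu (fun=> 0) z0 zt ->
   {ae QT_measure T N, forall p, z p <= zt p * expR (r * p.1)}).
Proof.
have bmu := Lfuny_ae_bdd hmu.
have [mmu [M muM]] := bmu.
have [al al0 alm] := hmu_lb.
(* The maximum secures [al <= M'] without comparing the two almost everywhere bounds. *)
pose M' := Num.max al M.
have alM : al <= M' by rewrite le_max lexx.
have mub : {ae QT_measure T N, forall p, al <= mu p <= M'}.
  apply: QT_aeS2 alm muM => p h1 h2; rewrite h1/= le_max.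
  by rewrite (le_trans (ler_norm _) h2) orbT.
have sG := Lfun2_sq_integrable hG; have sz0 := Lfun2_sq_integrable hz0; have sz := Lfun2_sq_integrable hz.1.
have wz := dual_weak_solution hz.
split=> [z0_ge0 G_ge0|r Gr zt hzt].
  exact: (weak_solution_nonneg hT mmu al0 alM mub sG sz0 sz z0_ge0 G_ge0 wz).
have szt := Lfun2_sq_integrable hzt.1; have wzt := dual_weak_solution hzt.
have we := weak_solution_expR r bmu sG sz0 sz hT wz.
have [mw [K wK]] := @expR_ae_bdd R N T (- r).
have sze : sq_integrable (QT_measure T N) (fun p => z p * expR (- r * p.1)).
  by under eq_fun do rewrite mulrC; exact: (sq_integrable_bddM mw wK).
pose Y p := zt p - z p * expR (- r * p.1).
have sY : sq_integrable (QT_measure T N) Y by exact: sq_integrableB.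
pose F p := (r * z p - G p) * expR (- r * p.1).
have sF : sq_integrable (QT_measure T N) F.
  rewrite /F; under eq_fun do rewrite mulrC.
  by apply: (sq_integrable_bddM mw wK); apply: sq_integrableB => //; exact: sq_integrableZ.
have F0 : {ae QT_measure T N, forall p, 0 <= F p}.
  by apply: QT_aeS Gr => p h; rewrite mulr_ge0 ?expR_ge0// subr_ge0.
have s00 : sq_integrable (torus_measure R N) (fun=> 0).
  by have := sq_integrableZ 0 sz0; under eq_fun do rewrite mul0r.
have wY : weak_solution T mu F Y (fun=> 0).
  move=> l tl; have := wzt l tl; have := we l tl.
  have spm := sq_integrable_parabolic bmu tl.
  have sev : sq_integrable (QT_measure T N) (wave_sumQ l) by apply/tame_sq_integrable/tame_wave_sumQ; exact: all_test_smooth tl.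
  have i1 := sq_integrable_mul szt spm; have i2 := sq_integrable_mul sze spm; have i3 := sq_integrable_mul sF sev.
  have -> : \int[QT_measure T N]_p (Y p * parabolic mu l p) =
      \int[QT_measure T N]_p (zt p * parabolic mu l p) -
      \int[QT_measure T N]_p (z p * expR (- r * p.1) * parabolic mu l p).
    by rewrite -RintegralB//; apply: eq_Rintegral => p _; rewrite /Y; ring.
  have -> : \int[QT_measure T N]_p ((G p - r * z p) * expR (- r * p.1) * wave_sumQ l p) =
      - (\int[QT_measure T N]_p (F p * wave_sumQ l p)).
    by rewrite -[RHS]mulN1r -RintegralZl//; apply: eq_Rintegral => p _; rewrite /F; ring.
  have -> : \int[QT_measure T N]_p (0 * wave_sumQ l p) = 0.
    by under eq_Rintegral do rewrite mul0r; rewrite Rintegral_cst// mul0r.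
  have -> : \int[torus_measure R N]_x (0 * wave_sumQ l (0, x)) = 0.
    by under eq_Rintegral do rewrite mul0r; rewrite Rintegral_cst// mul0r.
  lra.
have Y0 := weak_solution_nonneg hT mmu al0 alM mub sF s00 sY
  (aeW _ (fun _ => lexx 0)) F0 wY.
apply: QT_aeS Y0 => p; rewrite /Y subr_ge0 mulNr expRN ler_pdivrMr ?expR_gt0//.
Qed.
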